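(* Let $Q$ be a real non-degenerate quadratic form in $x,y,z$. (1) The space of real homogeneous polynomials admits an $O_Q(3;\mathbb R)$-invariant decomposition $$V(d;\mathbb R)=\bigoplus_{d-2k\ge0}Q^k\cdot Har_Q(d-2k;\mathbb R).$$ The summands are orthogonal with respect to the inner product $\langle f,g\rangle^{\mathbb R}=\mathsf{Re}\big\{\int_{\Upsilon_Q}f\cdot\bar g\,dm_Q\big\}$. (2) Any polynomial function $F$ on the surface $\mathcal S^{\mathbb R}=\{Q(x,y,z)=const\}$ can be obtained by restricting to $\mathcal S^{\mathbb R}$ a polynomial $P\in Har_Q(\mathbb R)$. (3) For any two polynomials $M$ and $N$, the Dirichlet problem $$\{\Delta_Q(P)=M,\quad P|_{\mathcal S^{\mathbb R}}=N|_{\mathcal S^{\mathbb R}}\}$$ has a unique real polynomial solution $P$. (4) Any real polynomial $P$ of degree at most $d$, being restricted to the surface $\mathcal S^{\mathbb R}$, admits a Maxwell-type representation $$P(x,y,z)=\sum_{d-2k\ge0}Q(x,y,z)^{d-k+\frac12}\cdot\nabla_{\mathbf u_{1,k}}\nabla_{\mathbf u_{2,k}}\cdots\nabla_{\mathbf u_{d-2k,k}}\Big(Q(x,y,z)^{-\frac12}\Big),$$ where $\{\mathbf u_{j,k}\}$ are complex 3-vectors. These vectors are real and the representation is unique, provided that $Q$ is positive-definite.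
   Context: All polynomials here ($F$, $M$, $N$, $P$) are real, and $\mathcal S^{\mathbb R}\subset\mathbb R^3$. $V(d;\mathbb R)$ is the space of real homogeneous polynomials of degree $d$ in $x,y,z$. Write $Q(v)=vBv^T$, $v=(x,y,z)$, $B$ symmetric invertible, and $B=AA^T$ with $A\in GL(3;\mathbb C)$. $\Delta_Q=\sum_{j,k}b^{jk}\partial_j\partial_k$ with $(b^{jk})=B^{-1}$. $Har_Q(\mathbb R)$ is the space of real polynomials annihilated by $\Delta_Q$, and $Har_Q(m;\mathbb R)=Har_Q(\mathbb R)\cap V(m;\mathbb R)$. $O_Q(3;\mathbb R)\subset GL(3;\mathbb R)$ is the group of linear transformations preserving $Q$. $\Upsilon_Q=\{v\in\mathbb C^3:vA\in\mathbb R^3,\ Q(v)=1\}$ is the image of the unit sphere $S^2\subset\mathbb R^3$ under $A^{-1}$, with measure $dm_Q$ corresponding to the standard measure $dm$ on $S^2$, so that $\int_{\Upsilon_Q}f\bar g\,dm_Q=\int_{S^2}f(uA^{-1})\overline{g(uA^{-1})}\,dm(u)$. $\nabla_{\mathbf u}$ is the directional derivative along $\mathbf u$; the same (local) branch of $Q^{1/2}$ is used in both places of each term, so sign ambiguities cancel.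
   Formalization: Uniqueness in (3), (4) needs a nonzero point on the surface. In (4): const≠0; the k=d/2 term gets a scalar; P has only degrees of d's parity, or else the sums for d and d-1 are added; uniqueness is among real vectors, up to order and rescaling with product 1. *)

(* Defs.v *)
From HB Require Import structures.
From mathcomp Require Import all_boot all_order all_algebra.
From mathcomp Require Import all_classical all_reals all_analysis.
From mathcomp Require Import perm complex.
(* The notations of mpoly are incompatible with those of the analysis library,
   hence the prefix forms: mpoly n R = {mpoly R[n]}, mpolyX R (mnm1 i) = 'X_i,
   meval x p = p.@[x], comp_mpoly lq p = p \mPo lq,
   ishomog1 d mdeg = d.-homog. *)
From mathcomp Require Import -(notations) mpoly.

Set Implicit Arguments.
Unset Strict Implicit.
Unset Printing Implicit Defensive.

Import Order.TTheory GRing.Theory Num.Theory.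
Import numFieldNormedType.Exports.

Local Open Scope classical_set_scope.
Local Open Scope ring_scope.
Local Open Scope complex_scope.

Definition qform (K : comNzRingType) (B : 'M[K]_3) (v : 'rV[K]_3) : K :=
  (v *m B *m v^T) 0 0.

Definition mx_complex (R : realType) m n (M : 'M[R]_(m, n)) : 'M[R[i]]_(m, n) :=
  map_mx (real_complex R) M.

Section Polynomials.
Variable R : realType.
Implicit Types (B g : 'M[R]_3) (p q : mpoly 3 R).

Definition peval p (v : 'rV[R]_3) : R := meval (fun i => v 0 i) p.

Definition pevalC p (w : 'rV[R[i]]_3) : R[i] :=
  meval (fun i => w 0 i) (map_mpoly (real_complex R) p).

Definition qpoly B : mpoly 3 R :=
  \sum_i \sum_j B i j *: (mpolyX R (mnm1 i) * mpolyX R (mnm1 j)).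

Definition laplacian B p : mpoly 3 R :=
  \sum_j \sum_k invmx B j k *: mderiv j (mderiv k p).

Definition harmonic_poly B : set (mpoly 3 R) := [set p | laplacian B p = 0].

Definition homogeneous (d : nat) : set (mpoly 3 R) :=
  [set p | p \is ishomog1 d mdeg].

Definition harmonic_homog B (m : nat) : set (mpoly 3 R) :=
  harmonic_poly B `&` homogeneous m.

Definition harmonic_summand B (d k : nat) : set (mpoly 3 R) :=
  [set qpoly B ^+ k * h | h in harmonic_homog B (d - k.*2)].

Definition linear_subset (W : set (mpoly 3 R)) : Prop :=
  W 0 /\ forall (a : R) p q, W p -> W q -> W (a *: p + q).

Definition is_direct_sum (V : set (mpoly 3 R)) n
    (W : 'I_n -> set (mpoly 3 R)) : Prop :=
  (forall k, linear_subset (W k) /\ W k `<=` V) /\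
  (forall p, V p -> exists! w : {ffun 'I_n -> mpoly 3 R},
    (forall k, W k (w k)) /\ p = \sum_k w k).

Definition orthogonal_group B : set 'M[R]_3 :=
  [set g | g \in unitmx /\ forall v, qform B (v *m g) = qform B v].

(* the polynomial v |-> p (v g) *)
Definition psubst g p : mpoly 3 R :=
  comp_mpoly [tuple \sum_j g j i *: mpolyX R (mnm1 j) | i < 3] p.

Definition degree_le p (d : nat) : Prop :=
  {in msupp p, forall m, (mdeg m <= d)%N}.

Definition degrees_congruent_mod2 p (d : nat) : Prop :=
  {in msupp p, forall m, odd (mdeg m) = odd d}.

Definition surface B (c : R) : set 'rV[R]_3 := [set v | qform B v = c].

(* For B invertible and symmetric, [surface B c] is two-dimensional exactly
   when it has a nonzero point; the excluded cases are definite forms for which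
   the level set is empty or reduced to the origin. *)
Definition genuine_surface B (c : R) : Prop :=
  exists v, v != 0 /\ surface B c v.

Definition dirichlet_solution B (c : R) (M N P : mpoly 3 R) : Prop :=
  laplacian B P = M /\ {in surface B c, peval P =1 peval N}.

Definition positive_definite B : Prop := forall v, v != 0 -> 0 < qform B v.

End Polynomials.

Section Integration.
Variable R : realType.

Definition sphere_point (theta phi : R) : 'rV[R]_3 :=
  \row_(i < 3) tnth [tuple sin theta * cos phi; sin theta * sin phi; cos theta] i.

(* the surface measure of the unit sphere in spherical coordinates *)
Definition sphere_integral_real (F : 'rV[R]_3 -> R) : R :=
  (\int[lebesgue_measure]_(phi in `[0%R, (2 * pi)%R])
    \int[lebesgue_measure]_(theta in `[0%R, pi])
      (F (sphere_point theta phi) * sin theta))%R.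

Definition sphere_integral (F : 'rV[R]_3 -> R[i]) : R[i] :=
  sphere_integral_real (fun u => complex.Re (F u))
  +i* sphere_integral_real (fun u => complex.Im (F u)).

(* the integral over the image of the unit sphere under A^-1, with respect to
   the image of the surface measure *)
Definition upsilon_integral (A : 'M[R[i]]_3) (F : 'rV[R[i]]_3 -> R[i]) : R[i] :=
  sphere_integral (fun u => F (mx_complex u *m invmx A)).

Definition inner_product (A : 'M[R[i]]_3) (f g : mpoly 3 R) : R :=
  complex.Re (upsilon_integral A (fun w => pevalC f w * (pevalC g w)^*)).

End Integration.

(* Stated over a numFieldType K, to be instantiated at R[i]: derivatives and
   continuity are then complex ones. K^o is K as a normed space over itself. *)
Section Branches.
Variable K : numFieldType.
Implicit Types (B : 'M[K]_3) (s f : 'rV[K]_3 -> K^o).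

Definition iter_derive (us : seq 'rV[K]_3) f : 'rV[K]_3 -> K^o :=
  foldr (fun u h => fun w => 'D_u h w) f us.

(* s is a branch of the square root of the form B near w0 *)
Definition sqrt_branch B (w0 : 'rV[K]_3) s : Prop :=
  \forall w \near w0, {for w, continuous s} /\ s w ^+ 2 = qform B w.

End Branches.

Section Maxwell.
Variable R : realType.
Local Notation C := (R[i]).
Implicit Types (B : 'M[R]_3) (s : 'rV[C]_3 -> C).

Definition poles (K : Type) (d : nat) : Type :=
  forall k : 'I_(d./2).+1, (d - k.*2).-tuple 'rV[K]_3.

Definition poles_complex d (u : poles R d) : poles C d :=
  fun k => map_tuple (@mx_complex R 1 3) (u k).

(* The scalar a multiplies the term of order d - 2k = 0 (present when d is
   even), in which no vector is available to carry a coefficient. *)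
Definition maxwell_sum B d (a : C) (u : poles C d) s (w : 'rV[C]_3) : C :=
  \sum_(k < (d./2).+1)
    (if k.*2 == d then a else 1) *
    (qform (mx_complex B) w ^+ (d - k) * s w *
     iter_derive (u k) (fun w' => (s w')^-1) w).

(* E gives the right-hand side as an expression in a branch and a point; the
   equality is required for every local branch. *)
Definition represents_on_surface B (c : R) (P : mpoly 3 R)
    (E : ('rV[C]_3 -> C) -> 'rV[C]_3 -> C) : Prop :=
  forall v, surface B c v -> forall s, sqrt_branch (mx_complex B) (mx_complex v) s ->
    (peval P v)%:C = E s (mx_complex v).

(* equality of lists of vectors up to a permutation and a rescaling with total
   factor 1; a list containing 0 stands for the zero term *)
Definition equivalent_vectors m (u u' : m.-tuple 'rV[R]_3) : Prop :=
  (0 \in u /\ 0 \in u') \/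
  exists (sigma : 'S_m) (t : 'I_m -> R),
    \prod_j t j = 1 /\ forall j, tnth u' j = t j *: tnth u (sigma j).

Definition equivalent_poles d (a : R) (u : poles R d) (a' : R) (u' : poles R d) :
    Prop :=
  (~~ odd d -> a = a') /\ forall k, equivalent_vectors (u k) (u' k).

End Maxwell.

(* Main.v *)
Require Import Defs.
From HB Require Import structures.
From mathcomp Require Import all_boot all_order all_algebra.
From mathcomp Require Import all_classical all_reals all_analysis.
From mathcomp Require Import perm complex.
From mathcomp Require Import -(notations) mpoly.
From mathcomp Require Import ring lra zify.

(** Write [Q] for the quadratic form of [B] and [Delta] for its Laplacian.

    The decomposition.  [Q], [Delta] and the Euler operator satisfy the
    commutation relation [lap_quadM], which on forms of degree [d] reads
    [Delta Q = Q Delta + 4 d + 6].  As [4 d + 6] is positive, [Delta Q] is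
    bijective on every space of forms ([lap_quadM_eigen], [lap_quadM_surj]);
    iterating, a form is in exactly one way a sum of products [Q^k h] with [h]
    harmonic ([harmonic_decomp], [harmonic_decomp_uniq]).  Orthogonality is
    checked on the unit sphere.  The surface integral is invariant under
    infinitesimal rotations, which in spherical coordinates comes down to
    integrations by parts ([moment3_rot01], [moment3_rot02], [moment3_rot12]);
    hence the sum of the squares of the infinitesimal rotations is symmetric,
    and it acts on harmonic forms of degree [m] as the scalar [- m (m + 1)]
    ([rotation_invariant_orthogonal]).

    The Dirichlet problem.  On the surface [Q = c] every power of [Q] is a
    constant, so that a polynomial may be replaced by a harmonic one without
    changing its values ([harmonic_on_surface]); together with the surjectivity
    of [Delta] this gives existence.  For uniqueness, let a harmonic polynomial
    vanish on the surface.  In diagonal coordinates it can be divided by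
    [Q - c] with respect to a variable that does not vanish identically on the
    surface, and the remainder vanishes because near a suitable point the
    surface consists of two graphs ([vanish_on_diagonal_surface]).  So the
    polynomial is a multiple of [Q - c], and by comparison of top components no
    nonzero multiple of [Q - c] is harmonic ([harmonic_quad_multiple]).

    Maxwell's representation.  Differentiating [Q^(-1/2)] along [n] vectors
    gives [H Q^(-(2 n + 1)/2)] with [H] a harmonic form of degree [n], the
    multipole of the vectors ([iter_derive_inv_sqrt], [lap_multipole]); on the
    surface the terms of the representation therefore become the [c^k H_k].
    With [surface_decomp] it remains to see that every harmonic form is a
    multipole, and to what extent its vectors are determined.  A harmonic form
    is determined by its restriction to the null cone of [Q]
    ([cone_restr_harmonic_inj]).  The cone is parametrized by a conic, so that
    the restriction of a form of degree [n] is a binary form of degree [2 n],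
    treated as a polynomial in one variable; and the restriction of a multipole
    is, up to a universal constant, the product of the restrictions of the
    linear forms [v |-> u B v^T], which are arbitrary binary quadratic forms
    ([cone_restr_multipole]).  Any factorization of a binary form of degree
    [2 n] into [n] quadratic ones thus produces vectors ([multipole_exists]).

    If [Q] is positive definite, the conic has no real point, and complex
    conjugation acts on it as the antipodal map [z |-> - 1 / z^*].  Real linear
    forms restrict to the quadratic forms compatible with this map, those whose
    zeros are a pair of antipodes, up to a real factor.  The zeros of a real
    form fall into such pairs, since a point differs from its antipode, and
    there is a single way to match each zero with its antipode: this gives real
    vectors ([real_multipole_exists]) and their uniqueness up to order and real
    factors ([real_multipole_unique]). *)

Import Order.TTheory GRing.Theory Num.Theory.
Import numFieldNormedType.Exports.

Local Open Scope classical_set_scope.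
Local Open Scope ring_scope.
Local Open Scope complex_scope.

Set Implicit Arguments.
Unset Strict Implicit.
Unset Printing Implicit Defensive.

(** * Differential calculus of polynomials *)

Lemma mpoly_alg_ind (n : nat) (K : comNzRingType) (P : mpoly n K -> Prop) :
  (forall c, P (mpolyC n c)) -> (forall i, P (mpolyX K (mnm1 i))) ->
  (forall p q, P p -> P q -> P (p + q)) ->
  (forall p q, P p -> P q -> P (p * q)) -> forall p, P p.
Proof.
move=> PC PX PD PM; elim/mpolyind => [|c m p _ _ Pp].
  by rewrite -(mpolyC0 n K).
apply: PD => //; rewrite -mul_mpolyC; apply: (PM _ _ (PC _)).
rewrite mpolyXE_id; elim/big_ind: _ => // [|i _]; first by rewrite -mpolyC1.
elim: (m i) => [|k IHk]; first by rewrite expr0 -mpolyC1.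
by rewrite exprS; exact: PM.
Qed.

Section Calculus.
Variable K : numFieldType.
Implicit Types (p q : mpoly 3 K) (B C : 'M[K]_3) (u : 'rV[K]_3).

Local Notation "''X_' i" := (mpolyX K (mnm1 i)) : ring_scope.

Definition euler p : mpoly 3 K := \sum_i 'X_i * mderiv i p.

Definition lap C p : mpoly 3 K :=
  \sum_j \sum_k C j k *: mderiv j (mderiv k p).

Definition quad B : mpoly 3 K := \sum_i \sum_j B i j *: ('X_i * 'X_j).

Definition linform u : mpoly 3 K := \sum_i u 0 i *: 'X_i.

Definition dirderiv u p : mpoly 3 K := \sum_i u 0 i *: mderiv i p.

(** The polarized gradient: the bilinear form measuring how far [lap C] is from
    being a derivation. *)
Definition gradform C p q : mpoly 3 K :=
  \sum_j \sum_k C j k *: (mderiv j p * mderiv k q).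

Lemma mderivXU (i j : 'I_3) : mderiv i 'X_j = (i == j)%:R.
Proof.
rewrite mderivX mnm1E eq_sym; case: eqP => [->|_]; last by rewrite scale0r.
have -> : mnm_sub (mnm1 j) (mnm1 j) = mnm0 :> multinom 3.
  by apply/mnmP => k; rewrite mnmBE mnm0E subnn.
by rewrite mpolyX0 scale1r.
Qed.

Fact euler_is_linear : linear euler.
Proof.
move=> c p q; rewrite /euler scaler_sumr -big_split /=; apply: eq_bigr => i _.
by rewrite mderivD mderivZ mulrDr -scalerAr.
Qed.
HB.instance Definition _ :=
  GRing.isLinear.Build K (mpoly 3 K) (mpoly 3 K) _ euler euler_is_linear.

Fact lap_is_linear C : linear (lap C).
Proof.
move=> c p q; rewrite /lap scaler_sumr -big_split /=; apply: eq_bigr => i _.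
rewrite scaler_sumr -big_split /=; apply: eq_bigr => j _.
by rewrite !mderivD !mderivZ scalerDr !scalerA mulrC.
Qed.
HB.instance Definition _ C :=
  GRing.isLinear.Build K (mpoly 3 K) (mpoly 3 K) _ (lap C) (lap_is_linear C).

Fact dirderiv_is_linear u : linear (dirderiv u).
Proof.
move=> c p q; rewrite /dirderiv scaler_sumr -big_split /=.
by apply: eq_bigr => i _; rewrite mderivD mderivZ scalerDr !scalerA mulrC.
Qed.
HB.instance Definition _ u :=
  GRing.isLinear.Build K (mpoly 3 K) (mpoly 3 K) _ (dirderiv u)
    (dirderiv_is_linear u).

Lemma eulerD p q : euler (p + q) = euler p + euler q.
Proof. exact: linearD. Qed.

Lemma eulerZ c p : euler (c *: p) = c *: euler p.
Proof. exact: linearZ. Qed.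

Lemma lapD C p q : lap C (p + q) = lap C p + lap C q.
Proof. exact: linearD. Qed.

Lemma lapB C p q : lap C (p - q) = lap C p - lap C q.
Proof. exact: linearB. Qed.

Lemma lap0 C : lap C 0 = 0.
Proof. exact: linear0. Qed.

Lemma lapZ C c p : lap C (c *: p) = c *: lap C p.
Proof. exact: linearZ. Qed.

Lemma dirderivD u p q : dirderiv u (p + q) = dirderiv u p + dirderiv u q.
Proof. exact: linearD. Qed.

Lemma dirderivM u p q :
  dirderiv u (p * q) = dirderiv u p * q + p * dirderiv u q.
Proof.
rewrite /dirderiv mulr_suml mulr_sumr -big_split /=; apply: eq_bigr => i _.
by rewrite mderivM scalerDr -scalerAl -scalerAr.
Qed.

Lemma dirderivC u c : dirderiv u (mpolyC 3 c) = 0.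
Proof. by rewrite /dirderiv big1 // => i _; rewrite mderivC scaler0. Qed.

Lemma dirderivXU u i : dirderiv u 'X_i = mpolyC 3 (u 0 i).
Proof.
rewrite /dirderiv (bigD1 i) //= big1 ?addr0 => [|j /negbTE ji].
  by rewrite mderivXU eqxx -mul_mpolyC mulr1.
by rewrite mderivXU ji scaler0.
Qed.

Lemma eulerX (m : multinom 3) : euler (mpolyX K m) = (mdeg m)%:R *: mpolyX K m.
Proof.
rewrite mdegE natr_sum scaler_suml; apply: eq_bigr => i _.
rewrite mderivX -scalerAr -mpolyXD; have [->|mi0] := eqVneq (m i) 0%N.
  by rewrite !scale0r.
congr (_ *: mpolyX K _); apply/mnmP => j; rewrite mnmDE mnmBE mnm1E.
by case: (eqVneq i j) => [<-|_] /=; [case: (m i) mi0 => // k _; lia | lia].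
Qed.

Lemma mcoeff_euler p m : mcoeff m (euler p) = (mdeg m)%:R * mcoeff m p.
Proof.
elim/mpolyind: p => [|c k p _ _ IHp]; first by rewrite linear0 !mcoeff0 mulr0.
rewrite eulerD eulerZ eulerX !mcoeffD !mcoeffZ IHp mcoeffX mulrDr.
by case: eqVneq => [->|]; rewrite ?mulr0 // mulr1 mulrC mulr1.
Qed.

(** Euler's identity characterizes homogeneity in characteristic zero; this is
    how the homogeneity of derivatives and of substitutions is obtained. *)
Lemma homog_eulerP d p :
  reflect (euler p = d%:R *: p) (p \is ishomog1 d mdeg).
Proof.
apply: (iffP idP) => [/dhomogP hp|hp].
  apply/mpolyP => m; rewrite mcoeff_euler mcoeffZ.
  case: (boolP (m \in msupp p)) => [/hp -> //|].
  by rewrite -mcoeff_eq0 => /eqP ->; rewrite !mulr0.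
apply/dhomogP => m; rewrite mcoeff_msupp => mp.
have /(congr1 (mcoeff m)) := hp; rewrite mcoeff_euler mcoeffZ.
by move/(mulIf mp)/eqP; rewrite eqr_nat => /eqP.
Qed.

Lemma euler_mderiv i p : euler (mderiv i p) = mderiv i (euler p) - mderiv i p.
Proof.
rewrite /euler raddf_sum /=.
under [in RHS]eq_bigr do rewrite mderivM mderivXU mderiv_comm.
rewrite big_split /= [X in _ = X + _ - _](bigD1 i) //= eqxx mul1r.
rewrite [X in _ + X + _ - _]big1 ?addr0 => [|j /negbTE ji]; first by rewrite addrC addKr.
by rewrite eq_sym ji mul0r.
Qed.

Lemma homog_mderiv i d p :
  p \is ishomog1 d.+1 mdeg -> mderiv i p \is ishomog1 d mdeg.
Proof.
move=> /homog_eulerP hp; apply/homog_eulerP; rewrite euler_mderiv hp.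
by rewrite mderivZ -{2}[mderiv i p]scale1r -scalerBl -[d.+1]addn1 natrD addrK.
Qed.

Lemma homog0_mderiv i p : p \is ishomog1 0 mdeg -> mderiv i p = 0.
Proof.
move=> hp; suff -> : p = mpolyC 3 (mcoeff mnm0 p) by rewrite mderivC.
apply/mpolyP => m; rewrite mcoeffC; case: eqVneq => [->|m0]; rewrite ?mulr1 //.
by rewrite mulr0 (dhomog_nemf_coeff hp) ?mdeg_eq0.
Qed.

Lemma homog1_lap C p : p \is ishomog1 1 mdeg -> lap C p = 0.
Proof.
move=> hp; rewrite /lap big1 // => j _; rewrite big1 // => k _.
by rewrite (homog0_mderiv _ (homog_mderiv _ hp)) scaler0.
Qed.

Lemma homog0_lap C p : p \is ishomog1 0 mdeg -> lap C p = 0.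
Proof.
move=> hp; rewrite /lap big1 // => j _; rewrite big1 // => k _.
by rewrite (homog0_mderiv _ hp) mderiv0 scaler0.
Qed.

Lemma homog_lap C d p :
  p \is ishomog1 d.+2 mdeg -> lap C p \is ishomog1 d mdeg.
Proof.
move=> hp; rewrite /lap; do 2!(apply: rpred_sum => ? _).
by apply: dhomogZ; do 2!apply: homog_mderiv.
Qed.

Lemma pihomog_lap C d p :
  pihomog mdeg d (lap C p) = lap C (pihomog mdeg d.+2 p).
Proof.
rewrite {1}(pihomog_partitionE (leqnn (msize p))) (raddf_sum (lap C)).
rewrite (raddf_sum (pihomog mdeg d)) /=.
have [lt_dp|ge_dp] := ltnP d.+2 (msize p).
  rewrite (bigD1 (Ordinal lt_dp)) //= pihomog_dE; last exact/homog_lap/pihomogP.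
  rewrite big1 ?addr0 // => -[e /= ep] /eqP/val_eqP /= ne_ed.
  by have := pihomogP mdeg e p; case: e ep ne_ed => [|[|e]] ep ne_ed he;
    rewrite ?(homog0_lap C he) ?(homog1_lap C he) ?pihomog0 //;
    rewrite (pihomog_ne0 _ (homog_lap C he)).
rewrite big1 => [|[e /= ep] _].
  rewrite pihomogE big_seq_cond big_pred0 ?linear0 // => m.
  by apply/andP => -[/msize_mdeg_lt mp /eqP/= me]; lia.
by have := pihomogP mdeg e p; case: e ep => [|[|e]] ep he;
    rewrite ?(homog0_lap C he) ?(homog1_lap C he) ?pihomog0 //;
    rewrite (pihomog_ne0 _ (homog_lap C he)) //; lia.
Qed.

Lemma homogX (i : 'I_3) : 'X_i \is ishomog1 1 mdeg.
Proof. by rewrite dhomogX /= mdeg1. Qed.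

Lemma homog_linform u : linform u \is ishomog1 1 mdeg.
Proof. by apply: rpred_sum => i _; apply: dhomogZ; exact: homogX. Qed.

Lemma homog_quad B : quad B \is ishomog1 2 mdeg.
Proof.
rewrite /quad; do 2!(apply: rpred_sum => ? _); apply: dhomogZ.
by apply: (@dhomogM _ _ _ 1 _ 1); exact: homogX.
Qed.

Lemma homog_quadX B k : quad B ^+ k \is ishomog1 k.*2 mdeg.
Proof. by rewrite -mul2n; apply: dhomogMn; exact: homog_quad. Qed.

Lemma mderiv_linform i u : mderiv i (linform u) = mpolyC 3 (u 0 i).
Proof.
rewrite /linform raddf_sum /= (bigD1 i) //= big1 ?addr0 => [|j /negbTE ji].
  by rewrite mderivZ mderivXU eqxx -mul_mpolyC mulr1.
by rewrite mderivZ mderivXU eq_sym ji scaler0.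
Qed.

Lemma mderiv_quad i B : B^T = B ->
  mderiv i (quad B) = 2%:R *: linform (row i B).
Proof.
move=> Bs; have Bji a b : B a b = B b a by rewrite -{1}Bs mxE.
rewrite /quad /linform !raddf_sum /=.
under eq_bigr => a _.
  rewrite raddf_sum; under eq_bigr => b _ do
    rewrite /= mderivZ mderivM !mderivXU scalerDr.
  rewrite big_split /=.
  over.
rewrite big_split /= (bigD1 i) //= [X in _ + X + _]big1 => [|a /negbTE ai]; last first.
  by apply: big1 => b _; rewrite eq_sym ai mul0r scaler0.
rewrite addr0 -big_split /=; apply: eq_bigr => a _.
rewrite eqxx mul1r (bigD1 i) //= eqxx mulr1 big1 => [|b /negbTE bi].
  by rewrite addr0 mxE (Bji a) -scalerDl scalerA; congr (_ *: _); ring.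
by rewrite eq_sym bi mulr0 scaler0.
Qed.

Lemma lapM C p q : C^T = C ->
  lap C (p * q) = lap C p * q + p * lap C q + 2%:R *: gradform C p q.
Proof.
move=> Cs; have Cji a b : C a b = C b a by rewrite -{1}Cs mxE.
have gradC : gradform C p q = gradform C q p.
  rewrite /gradform exchange_big; apply: eq_bigr => j _; apply: eq_bigr => k _.
  by rewrite Cji mulrC.
rewrite scaler_nat mulr2n {1}gradC /lap /gradform mulr_suml mulr_sumr.
rewrite -!big_split /=; apply: eq_bigr => j _.
rewrite mulr_suml mulr_sumr -!big_split /=; apply: eq_bigr => k _.
rewrite !mderivM raddfD /= !mderivM -!mul_mpolyC; ring.
Qed.

Lemma lap_linform C u : lap C (linform u) = 0.
Proof. exact/homog1_lap/homog_linform. Qed.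

Section Laplacian.
Variable B : 'M[K]_3.
Hypotheses (Bsym : B^T = B) (Binv : B \in unitmx).
Local Notation Q := (quad B).
Local Notation Delta := (lap (invmx B)).

Let Csym : (invmx B)^T = invmx B. Proof. by rewrite trmx_inv Bsym. Qed.
Let Bji i j : B i j = B j i. Proof. by rewrite -{1}Bsym mxE. Qed.
Let Cji i j : invmx B i j = invmx B j i. Proof. by rewrite -{1}Csym mxE. Qed.

Lemma gradform_linform u p :
  gradform (invmx B) (linform (u *m B)) p = dirderiv u p.
Proof.
rewrite /gradform exchange_big /=; apply: eq_bigr => k _.
under eq_bigr => j _ do rewrite mderiv_linform mul_mpolyC scalerA mulrC.
rewrite -scaler_suml; congr (_ *: _).
have /matrixP/(_ 0 k) := mulmxK Binv u; rewrite mxE => <-.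
by [].
Qed.

Lemma gradform_quad p : gradform (invmx B) Q p = 2%:R *: euler p.
Proof.
rewrite /gradform exchange_big /= scaler_sumr; apply: eq_bigr => k _.
under eq_bigr => j _ do rewrite mderiv_quad // scalerAl.
rewrite -mulr_suml scalerAl; congr (_ * _).
rewrite /linform; under eq_bigr => j _ do rewrite 2!scaler_sumr.
rewrite exchange_big /= (bigD1 k) //= [X in _ + X]big1 => [|i ik].
  rewrite addr0; under eq_bigr => j _ do rewrite mxE !scalerA.
  rewrite -scaler_suml; congr (_ *: _).
  have /matrixP/(_ k k) := mulmxV Binv; rewrite !mxE eqxx => E.
  rewrite -[RHS]mulr1 -[X in _ = _ * X]/(true%:R) -E mulr_sumr; apply: eq_bigr => j _.
  by rewrite (Bji j k); ring.
under eq_bigr => j _ do rewrite mxE !scalerA.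
rewrite -scaler_suml; apply/eqP; rewrite scaler_eq0; apply/orP; left; apply/eqP.
have /matrixP/(_ i k) := mulmxV Binv; rewrite !mxE (negbTE ik) => E.
rewrite -[RHS](mulr0 2%:R) -[X in _ = _ * X]/(false%:R) -E mulr_sumr; apply: eq_bigr => j _.
by rewrite (Bji j i); ring.
Qed.

Lemma lap_quad : Delta Q = 6%:R.
Proof.
have trBC : \tr (B *m invmx B) = 3%:R by rewrite mulmxV // mxtrace1.
rewrite /lap; under eq_bigr => j _ do under eq_bigr => k _ do
  rewrite mderiv_quad // mderivZ mderiv_linform mxE.
transitivity (mpolyC 3 (2%:R * \tr (B *m invmx B))).
  rewrite /mxtrace mulr_sumr raddf_sum exchange_big; apply: eq_bigr => k _ /=.
  rewrite mxE mulr_sumr raddf_sum; apply: eq_bigr => j _ /=.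
  rewrite -!mul_mpolyC -!mpolyCM; congr (mpolyC 3 _).
  ring.
by rewrite trBC -natrM mpolyC_nat.
Qed.

(** The commutation relation of the [sl_2]-triple formed by [Q], [Delta] and
    the Euler operator, on which the whole decomposition rests. *)
Lemma lap_quadM p :
  Delta (Q * p) = Q * Delta p + (4%:R *: euler p + 6%:R *: p).
Proof.
by rewrite lapM // lap_quad gradform_quad scalerA -natrM !scaler_nat; ring.
Qed.

Lemma lap_quadM_homog d p : p \is ishomog1 d mdeg ->
  Delta (Q * p) = Q * Delta p + (4 * d + 6)%:R *: p.
Proof.
move=> /homog_eulerP hp; rewrite lap_quadM hp scalerA -scalerDl.
by rewrite natrD natrM.
Qed.

Lemma homog_quadM d p :
  p \is ishomog1 d mdeg -> Q * p \is ishomog1 d.+2 mdeg.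
Proof. by move=> hp; apply: (@dhomogM _ _ _ 2); first exact: homog_quad. Qed.

(** If [Delta (Q p) = l p] with [l <= 0], the commutation relation gives
    [Q (Delta p) = m p] with [m = l - (4 d + 6) < 0]. Then [Delta p] satisfies
    the same kind of equation in degree [d - 2], so it vanishes by induction,
    and [p] with it. *)
Lemma lap_quadM_eigen d p l : l <= 0 -> p \is ishomog1 d mdeg ->
  Delta (Q * p) = l *: p -> p = 0.
Proof.
have [n] := ubnP d; elim: n d p l => // n IHn d p l dn l0 hp Dp.
pose m := l - (4 * d + 6)%:R.
have m0 : m < 0 by rewrite subr_lt0 (le_lt_trans l0) // ltr0n addnS.
have Qlap : Q * Delta p = m *: p.
  by rewrite scalerBl -Dp (lap_quadM_homog hp) addrK.
have pE : p = m^-1 *: (Q * Delta p) by rewrite Qlap scalerK // lt_eqF.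
suff lap0 : Delta p = 0 by rewrite pE lap0 mulr0 scaler0.
case: d dn hp @m m0 Qlap pE => [|[|d]] dn hp m m0 Qlap pE.
- exact: homog0_lap.
- exact: homog1_lap.
- apply: (IHn d _ m) (homog_lap _ hp) _; [by lia|exact: ltW|].
  by rewrite Qlap lapZ.
Qed.

(** The equation is solved by recursion on the degree. Putting
    [p = (q - Q r) / a] with [a = 4 d + 6 + nu], it reduces to [Delta p = r],
    that is, to the same equation for [r] in degree [d - 2] with right-hand
    side [Delta q] and shift [a]. *)
Lemma lap_quadM_surj d q (nu : K) : 0 <= nu -> q \is ishomog1 d mdeg ->
  exists2 p, p \is ishomog1 d mdeg & Delta (Q * p) + nu *: p = q.
Proof.
have [n] := ubnP d; elim: n d q nu => // n IHn d q nu dn nu0 hq.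
pose a := (4 * d + 6)%:R + nu.
have a0 : 0 < a by rewrite ltr_wpDr // ltr0n addnS.
have aN0 : a != 0 by rewrite gt_eqF.
suff [r hr Dr] : exists2 r, Q * r \is ishomog1 d mdeg &
    Delta (Q * r) + a *: r = Delta q.
  have lapE : Delta (a^-1 *: (q - Q * r)) = r.
    by rewrite lapZ lapB -Dr addrAC subrr add0r scalerK.
  exists (a^-1 *: (q - Q * r)); first by rewrite dhomogZ // rpredB.
  rewrite (@lap_quadM_homog d) ?dhomogZ ?rpredB // lapE.
  by rewrite -addrA -scalerDl scalerKV // addrC subrK.
case: d dn hq @a a0 aN0 => [|[|d]] dn hq a a0 aN0.
- by exists 0; rewrite ?mulr0 ?dhomog0 // lap0 scaler0 addr0 (homog0_lap _ hq).
- by exists 0; rewrite ?mulr0 ?dhomog0 // lap0 scaler0 addr0 (homog1_lap _ hq).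
- have [|r hr Dr] := IHn d (Delta q) a _ (ltW a0) (homog_lap _ hq); first by lia.
  by exists r => //; exact: homog_quadM.
Qed.

(** The harmonic part is what remains after subtracting the [Q q] that has the
    same Laplacian. *)
Lemma homog_split d p : p \is ishomog1 d.+2 mdeg ->
  exists h q, [/\ h \is ishomog1 d.+2 mdeg, q \is ishomog1 d mdeg,
    Delta h = 0 & p = h + Q * q].
Proof.
move=> hp; have [q hq Dq] := lap_quadM_surj (lexx 0) (homog_lap (invmx B) hp).
rewrite scale0r addr0 in Dq.
exists (p - Q * q), q; split=> //; last by rewrite subrK.
  by rewrite rpredB // homog_quadM.
by rewrite lapB Dq subrr.
Qed.

Lemma harmonic_decomp d p : p \is ishomog1 d mdeg ->
  exists h : nat -> mpoly 3 K,
    (forall k, (k <= d./2)%N ->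
       h k \is ishomog1 (d - k.*2) mdeg /\ Delta (h k) = 0) /\
    p = \sum_(k < (d./2).+1) Q ^+ k * h k.
Proof.
have [n] := ubnP d; elim: n d p => // n IHn [|[|d]] p dn hp.
- exists (fun=> p); split; first by case=> // _; split=> //; exact: homog0_lap.
  by rewrite big_ord1 mul1r.
- exists (fun=> p); split; first by case=> // _; split=> //; exact: homog1_lap.
  by rewrite big_ord1 mul1r.
- have [h0 [q [hh hq Dh pE]]] := homog_split hp.
  have [|h [hP qE]] := IHn d q _ hq; first by lia.
  exists (fun k => if k is k'.+1 then h k' else h0); split.
    by case=> [|k] //= kd; exact: hP.
  rewrite big_ord_recl mul1r pE {1}qE mulr_sumr; congr (_ + _).
  by apply: eq_bigr => k _; rewrite /= mulrA -exprS.
Qed.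

(** The sum of the terms with [0 < k] is a harmonic multiple of [Q], hence
    zero; after cancelling [Q] the degree has dropped. *)
Lemma harmonic_decomp_uniq d (h : nat -> mpoly 3 K) :
  (forall k, (k <= d./2)%N ->
       h k \is ishomog1 (d - k.*2) mdeg /\ Delta (h k) = 0) ->
  \sum_(k < (d./2).+1) Q ^+ k * h k = 0 ->
  forall k, (k <= d./2)%N -> h k = 0.
Proof.
have [n] := ubnP d; elim: n d h => // n IHn [|[|d]] h dn hP.
- by rewrite big_ord1 mul1r => h0 [|].
- by rewrite big_ord1 mul1r => h0 [|].
rewrite big_ord_recl mul1r.
pose q := \sum_(k < (d./2).+1) Q ^+ k * h k.+1.
rewrite (_ : \sum_(i < _) _ = Q * q); last first.
  by rewrite mulr_sumr; apply: eq_bigr => k _; rewrite /= mulrA -exprS.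
have hq : q \is ishomog1 d mdeg.
  apply: rpred_sum => k _; have kd := ltn_ord k.
  have := dhomogM (homog_quadX B k) (hP k.+1 kd).1.
  by rewrite (_ : (k.*2 + _)%N = d) //; lia.
move=> h0q; have q0 : q = 0.
  apply: (lap_quadM_eigen (lexx 0) hq); rewrite scale0r.
  have /(congr1 Delta) := h0q; rewrite lapD (hP 0%N isT).2 add0r => ->.
  exact: linear0.
move=> [_|k kd]; first by move: h0q; rewrite q0 mulr0 addr0.
by apply: (IHn d (fun k => h k.+1)) => // [|j jd]; [lia|apply: (hP j.+1)].
Qed.

End Laplacian.
End Calculus.

(** * Evaluation, linear substitution and extension of scalars *)

Section Substitution.
Variable K : numFieldType.
Implicit Types (p q : mpoly 3 K) (B C G H : 'M[K]_3) (v : 'rV[K]_3).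

Local Notation "''X_' i" := (mpolyX K (mnm1 i)) : ring_scope.

Definition ev v p : K := meval (fun i => v 0 i) p.

Definition subst G p : mpoly 3 K :=
  comp_mpoly [tuple \sum_j G j i *: 'X_j | i < 3] p.

HB.instance Definition _ v :=
  GRing.RMorphism.copy (ev v) (meval (fun i => v 0 i)).
HB.instance Definition _ G := GRing.RMorphism.copy (subst G)
  (comp_mpoly [tuple \sum_j G j i *: 'X_j | i < 3]).

Lemma evD v p q : ev v (p + q) = ev v p + ev v q.
Proof. exact: rmorphD. Qed.

Lemma evB v p q : ev v (p - q) = ev v p - ev v q.
Proof. exact: rmorphB. Qed.

Lemma evM v p q : ev v (p * q) = ev v p * ev v q.
Proof. exact: rmorphM. Qed.

Lemma evX v p k : ev v (p ^+ k) = ev v p ^+ k.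
Proof. exact: rmorphXn. Qed.

Lemma ev_sum v I (r : seq I) (P : pred I) (F : I -> mpoly 3 K) :
  ev v (\sum_(i <- r | P i) F i) = \sum_(i <- r | P i) ev v (F i).
Proof. exact: rmorph_sum. Qed.

Lemma evC v c : ev v (mpolyC 3 c) = c.
Proof. exact: mevalC. Qed.

Lemma evZ v c p : ev v (c *: p) = c * ev v p.
Proof. exact: mevalZ. Qed.

Lemma evXU v i : ev v 'X_i = v 0 i.
Proof. exact: mevalXU. Qed.

Lemma ev_quad v B : ev v (quad B) = qform B v.
Proof.
rewrite /quad ev_sum /qform mxE; under eq_bigr => i _ do rewrite ev_sum.
rewrite exchange_big; apply: eq_bigr => j _ /=.
rewrite mxE mulr_suml; apply: eq_bigr => i _.
by rewrite evZ evM !evXU mxE; ring.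
Qed.

Lemma substD G p q : subst G (p + q) = subst G p + subst G q.
Proof. exact: rmorphD. Qed.

Lemma substM G p q : subst G (p * q) = subst G p * subst G q.
Proof. exact: rmorphM. Qed.

Lemma substC G c : subst G (mpolyC 3 c) = mpolyC 3 c.
Proof. exact: comp_mpolyC. Qed.

Lemma substZ G c p : subst G (c *: p) = c *: subst G p.
Proof. exact: comp_mpolyZ. Qed.

Lemma substXU G i : subst G 'X_i = \sum_j G j i *: 'X_j.
Proof. by rewrite /subst comp_mpolyXU -tnth_nth tnth_mktuple. Qed.

Lemma ev_subst v G p : ev v (subst G p) = ev (v *m G) p.
Proof.
rewrite /ev /subst comp_mpoly_meval; apply: meval_eq => i.
rewrite tnth_mktuple -/(ev v _) ev_sum mxE.
by apply: eq_bigr => j _; rewrite evZ evXU mulrC.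
Qed.

Lemma subst1 p : subst 1%:M p = p.
Proof.
elim/mpoly_alg_ind: p => [c|i|p q hp hq|p q hp hq]; first exact: substC.
- rewrite substXU (bigD1 i) //= mxE eqxx scale1r big1 ?addr0 // => j /negbTE ji.
  by rewrite mxE ji scale0r.
- by rewrite substD hp hq.
- by rewrite substM hp hq.
Qed.

Lemma subst_comp G H p : subst G (subst H p) = subst (G *m H) p.
Proof.
elim/mpoly_alg_ind: p => [c|i|p q hp hq|p q hp hq]; first by rewrite !substC.
- rewrite !substXU rmorph_sum /=.
  under eq_bigr => j _ do rewrite substZ substXU scaler_sumr.
  rewrite exchange_big; apply: eq_bigr => j _ /=.
  rewrite mxE scaler_suml; apply: eq_bigr => k _.
  by rewrite scalerA mulrC.
- by rewrite !substD hp hq.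
- by rewrite !substM hp hq.
Qed.

Lemma substK G : G \in unitmx -> cancel (subst G) (subst (invmx G)).
Proof. by move=> Gu p; rewrite subst_comp mulVmx // subst1. Qed.

Lemma mderiv_subst k G p :
  mderiv k (subst G p) = \sum_i G k i *: subst G (mderiv i p).
Proof.
elim/mpoly_alg_ind: p => [c|i|p q hp hq|p q hp hq].
- rewrite substC mderivC big1 // => i _.
  by rewrite mderivC rmorph0 scaler0.
- rewrite substXU raddf_sum /= (bigD1 k) //= big1 ?addr0 => [|j /negbTE jk].
    rewrite mderivZ mderivXU eqxx (bigD1 i) //= big1 ?addr0 => [|j /negbTE ji].
      by rewrite mderivXU rmorph_nat eqxx.
    by rewrite mderivXU rmorph_nat ji scaler0.
  by rewrite mderivZ mderivXU eq_sym jk scaler0.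
- rewrite substD mderivD hp hq -big_split; apply: eq_bigr => i _ /=.
  by rewrite mderivD substD scalerDr.
- rewrite substM mderivM hp hq mulr_suml mulr_sumr -big_split.
  apply: eq_bigr => i _ /=.
  by rewrite mderivM substD !substM scalerDr scalerAl scalerAr.
Qed.

Lemma euler_subst G p : euler (subst G p) = subst G (euler p).
Proof.
rewrite /euler rmorph_sum /=; under eq_bigr do rewrite mderiv_subst mulr_sumr.
rewrite exchange_big; apply: eq_bigr => i _ /=.
rewrite substM substXU mulr_suml; apply: eq_bigr => k _.
by rewrite -scalerAl -scalerAr.
Qed.

Lemma homog_subst G d p :
  p \is ishomog1 d mdeg -> subst G p \is ishomog1 d mdeg.
Proof.
by move=> /homog_eulerP hp; apply/homog_eulerP; rewrite euler_subst hp substZ.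
Qed.

(** This rule matches that of [subst_quad]: when [C] is the inverse of
    [G B G^T], the matrix [G^T C G] is the inverse of [B]. *)
Lemma lap_subst C G p : lap C (subst G p) = subst G (lap (G^T *m C *m G) p).
Proof.
rewrite /lap rmorph_sum /=.
under eq_bigr => j _ do under eq_bigr => k _ do
  rewrite mderiv_subst (raddf_sum (mderiv j)) scaler_sumr /=.
under eq_bigr => j _ do under eq_bigr => k _ do
  under eq_bigr => i _ do rewrite mderivZ mderiv_subst 2!scaler_sumr.
transitivity (\sum_l \sum_i \sum_j \sum_k
  (G^T l j * C j k * G k i) *: subst G (mderiv l (mderiv i p))); last first.
  apply: eq_bigr => l _; rewrite rmorph_sum; apply: eq_bigr => i _ /=.
  rewrite exchange_big substZ mxE scaler_suml; apply: eq_bigr => k _ /=.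
  by rewrite mxE mulr_suml scaler_suml; apply: eq_bigr.
under [RHS]eq_bigr => l _ do rewrite exchange_big.
rewrite [RHS]exchange_big; apply: eq_bigr => j _ /=.
under [RHS]eq_bigr => l _ do rewrite exchange_big.
rewrite [RHS]exchange_big; apply: eq_bigr => k _ /=.
rewrite [RHS]exchange_big; apply: eq_bigr => i _ /=.
apply: eq_bigr => l _; rewrite !scalerA mxE; congr (_ *: _); ring.
Qed.

Lemma subst_quad G B : subst G (quad B) = quad (G *m B *m G^T).
Proof.
rewrite /quad rmorph_sum /=.
under eq_bigr => i _ do rewrite rmorph_sum /=.
under eq_bigr => i _ do under eq_bigr => k _ do
  rewrite substZ substM !substXU mulr_suml scaler_sumr.
under eq_bigr => i _ do under eq_bigr => k _ do
  under eq_bigr => j _ do rewrite mulr_sumr scaler_sumr.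
transitivity (\sum_j \sum_l \sum_i \sum_k
  (G j i * B i k * G^T k l) *: ('X_j * 'X_l)); last first.
  apply: eq_bigr => j _; apply: eq_bigr => l _ /=.
  rewrite exchange_big mxE scaler_suml; apply: eq_bigr => k _ /=.
  by rewrite [(G *m B) j k]mxE mulr_suml scaler_suml; apply: eq_bigr.
under [RHS]eq_bigr => l _ do rewrite exchange_big.
rewrite [RHS]exchange_big; apply: eq_bigr => i _ /=.
under [RHS]eq_bigr => l _ do rewrite exchange_big.
rewrite [RHS]exchange_big; apply: eq_bigr => k _ /=.
apply: eq_bigr => j _; apply: eq_bigr => l _.
rewrite -scalerAl -scalerAr !scalerA mxE; congr (_ *: _); ring.
Qed.

End Substitution.

Section ScalarExtension.
Variables (K L : numFieldType) (f : {rmorphism K -> L}).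
Implicit Types (p q : mpoly 3 K) (B C : 'M[K]_3).

Lemma map_mderiv i p : map_mpoly f (mderiv i p) = mderiv i (map_mpoly f p).
Proof.
apply/mpolyP => m.
by rewrite mcoeff_map_mpoly !mcoeff_deriv mcoeff_map_mpoly /= rmorphMn.
Qed.

Lemma map_lap C p :
  map_mpoly f (lap C p) = lap (map_mx f C) (map_mpoly f p).
Proof.
rewrite /lap raddf_sum; apply: eq_bigr => i _ /=.
rewrite raddf_sum; apply: eq_bigr => j _ /=.
by rewrite map_mpolyZ !map_mderiv mxE.
Qed.

Lemma map_quad B : map_mpoly f (quad B) = quad (map_mx f B).
Proof.
rewrite /quad raddf_sum; apply: eq_bigr => i _ /=.
rewrite raddf_sum; apply: eq_bigr => j _ /=.
by rewrite map_mpolyZ rmorphM /= !map_mpolyX mxE.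
Qed.

Lemma map_linform u : map_mpoly f (linform u) = linform (map_mx f u).
Proof.
rewrite /linform raddf_sum; apply: eq_bigr => i _ /=.
by rewrite map_mpolyZ map_mpolyX mxE.
Qed.

Lemma map_dirderiv u p :
  map_mpoly f (dirderiv u p) = dirderiv (map_mx f u) (map_mpoly f p).
Proof.
rewrite /dirderiv raddf_sum; apply: eq_bigr => i _ /=.
by rewrite map_mpolyZ map_mderiv mxE.
Qed.

Lemma ev_map v p : ev (map_mx f v) (map_mpoly f p) = f (ev v p).
Proof.
elim/mpoly_alg_ind: p => [c|i|p q hp hq|p q hp hq].
- by rewrite map_mpolyC !evC.
- by rewrite map_mpolyX !evXU mxE.
- by rewrite rmorphD /= !evD hp hq rmorphD.
- by rewrite rmorphM /= !evM hp hq rmorphM.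
Qed.

Lemma map_homog d p :
  p \is ishomog1 d mdeg -> map_mpoly f p \is ishomog1 d mdeg.
Proof.
move=> hp; apply/dhomogP => m; rewrite mcoeff_msupp mcoeff_map_mpoly => mp.
apply: (dhomog_mf hp); rewrite mcoeff_msupp.
by apply: contraNneq mp => ->; rewrite /= rmorph0.
Qed.

End ScalarExtension.

(** * Iterated derivatives of the inverse square root *)

Section Multipole.
Variable K : numFieldType.
Variable B : 'M[K]_3.
Hypothesis Bsym : B^T = B.
Implicit Types (p q : mpoly 3 K) (u w : 'rV[K]_3) (us : seq 'rV[K]_3).

Local Notation "''X_' i" := (mpolyX K (mnm1 i)) : ring_scope.

(** The polynomial [H] for which the iterated derivative of [Q^(-1/2)] along
    the [n] vectors is [H Q^(-(2 n + 1)/2)]; the recursion is the quotient rule,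
    in which the derivative of [Q^(1/2)] along [u] is [u B v^T Q^(-1/2)]. *)
Fixpoint multipole us : mpoly 3 K :=
  if us is u :: us' then
    quad B * dirderiv u (multipole us') -
    ((size us').*2.+1)%:R *: (linform (u *m B) * multipole us')
  else 1.

Lemma dirderiv_quad u : dirderiv u (quad B) = 2%:R *: linform (u *m B).
Proof.
rewrite /dirderiv; under eq_bigr => i _ do rewrite mderiv_quad //.
rewrite /linform scaler_sumr; under eq_bigr => i _ do rewrite 2!scaler_sumr.
rewrite exchange_big; apply: eq_bigr => j _ /=.
rewrite mxE scalerA mulr_sumr scaler_suml; apply: eq_bigr => i _.
by rewrite !scalerA mxE; congr (_ *: _); ring.
Qed.

Lemma homog_dirderiv u d p :
  p \is ishomog1 d.+1 mdeg -> dirderiv u p \is ishomog1 d mdeg.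
Proof.
by move=> hp; apply: rpred_sum => i _; apply/dhomogZ/homog_mderiv.
Qed.

Lemma homog0_dirderiv u p : p \is ishomog1 0 mdeg -> dirderiv u p = 0.
Proof.
by move=> hp; apply: big1 => i _; rewrite (homog0_mderiv _ hp) scaler0.
Qed.

Lemma homog_multipole us : multipole us \is ishomog1 (size us) mdeg.
Proof.
elim: us => [|u us IHus] /=; first exact: dhomog1.
rewrite rpredB //; last first.
  by apply: dhomogZ; apply: (@dhomogM _ _ _ 1); first exact: homog_linform.
case: (size us) IHus => [|d] IHus.
  by rewrite homog0_dirderiv // mulr0 dhomog0.
by apply: (@dhomogM _ _ _ 2 _ d); [exact: homog_quad|exact: homog_dirderiv].
Qed.

Lemma is_derive_ev u p w :
  is_derive w u (fun w' => ev w' p : K^o) (ev w (dirderiv u p)).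
Proof.
elim/mpoly_alg_ind: p => [c|i|p q hp hq|p q hp hq].
- rewrite dirderivC (_ : (fun _ => _) = cst c); last first.
    by apply/funext => w'; rewrite evC.
  by rewrite /ev meval0; exact: is_derive_cst.
- rewrite dirderivXU evC (_ : (fun _ => _) = (fun w' => w' 0 i : K^o)); last first.
    by apply/funext => w'; rewrite evXU.
  have cvgE : (fun h : K => h^-1 *: (((fun w' : 'rV_3 => w' 0 i : K^o) \o shift w)
      (h *: u) - (w 0 i : K^o))) @ 0^' --> (u 0 i : K^o).
    apply: cvg_near_cst; near=> h.
    have h0 : h != 0 by near: h; exact: nbhs_dnbhs_neq.
    by rewrite /= !mxE addrK; exact: mulKf.
  by apply: DeriveDef; [apply/cvg_ex; exists (u 0 i)|exact: cvg_lim cvgE].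
- rewrite dirderivD evD (_ : (fun _ => _) =
    (fun w' => ev w' p : K^o) + (fun w' => ev w' q : K^o)); last first.
    by apply/funext => w'; rewrite evD.
  exact: is_deriveD.
- rewrite dirderivM evD !evM (_ : (fun _ => _) =
    (fun w' => ev w' p : K^o) * (fun w' => ev w' q : K^o)); last first.
    by apply/funext => w'; rewrite evM.
  rewrite addrC [X in _ + X]mulrC; exact: is_deriveM.
Unshelve. all: by end_near. Qed.

Lemma continuous_ev p : continuous (fun w => ev w p : K^o).
Proof.
move=> w; elim/mpoly_alg_ind: p => [c|i|p q hp hq|p q hp hq].
- rewrite (_ : (fun _ => _) = cst c); first exact: cst_continuous.
  by apply/funext => w'; rewrite evC.
- rewrite (_ : (fun _ => _) = (fun w' : 'rV_3 => w' 0 i : K^o)).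
    exact: coord_continuous.
  by apply/funext => w'; rewrite evXU.
- rewrite (_ : (fun _ => _) =
    (fun w' => ev w' p : K^o) + (fun w' => ev w' q : K^o)).
    exact: continuousD.
  by apply/funext => w'; rewrite evD.
- rewrite (_ : (fun _ => _) =
    (fun w' => ev w' p : K^o) * (fun w' => ev w' q : K^o)).
    exact: continuousM.
  by apply/funext => w'; rewrite evM.
Qed.

Variable s : 'rV[K]_3 -> K^o.

(** Continuity of a square root upgrades to differentiability through
    [s' - s = (s'^2 - s^2) / (s' + s)]. *)
Lemma is_derive_sqrt u w : {for w, continuous s} -> s w != 0 ->
  (\forall w' \near w, s w' ^+ 2 = qform B w') ->
  is_derive w u s (ev w (linform (u *m B)) / s w).
Proof.
move=> sc sw0 sQ.
have line : (h *: u + w) @[h --> (0 : K)^'] --> w.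
  rewrite -{2}[w]add0r -(scale0r u); apply: cvgD; last exact: cvg_cst.
  by apply: cvgZr_tmp; exact: nbhs_dnbhs.
have scv : s (h *: u + w) @[h --> (0 : K)^'] --> s w.
  exact: (cvg_comp _ _ line sc).
have [Qd Qv] := is_derive_ev u (quad B) w.
have Qcv : (fun h : K => h^-1 *: (((fun w' => ev w' (quad B) : K^o) \o shift w)
    (h *: u) - ev w (quad B))) @ 0^' --> (2%:R * ev w (linform (u *m B)) : K^o).
  by have := Qd; rewrite /derivable => /cvg_ex Qd'; move: Qv;
    rewrite dirderiv_quad evZ => <-; exact: Qd.
have s20 : s w + s w != 0 by rewrite -mulr2n mulrn_eq0.
have scv2 : (s (h *: u + w) + s w)^-1 @[h --> (0 : K)^'] --> (s w + s w)^-1.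
  by apply: cvgV => //; apply: cvgD => //; exact: cvg_cst.
have qcv : (fun h : K => h^-1 *: ((s \o shift w) (h *: u) - s w)) @ 0^' -->
    (ev w (linform (u *m B)) / s w : K^o).
  have -> : ev w (linform (u *m B)) / s w =
      2%:R * ev w (linform (u *m B)) * (s w + s w)^-1.
    have E (x y : K) : y != 0 -> x / y = 2%:R * x / (y + y).
      by move=> y0; rewrite -mulr2n -(mulr_natl y) -mulf_div divff ?mul1r ?pnatr_eq0.
    exact: E.
  apply: cvg_trans (cvgM Qcv scv2); apply: near_eq_cvg; near=> h.
  have h0 : h != 0 by near: h; exact: nbhs_dnbhs_neq.
  have sh0 : s (h *: u + w) + s w != 0.
    near: h; apply: (@cvgr_neq0 _ K^o _ _ _ _ (s w + s w)) => //.
    by apply: cvgD => //; exact: cvg_cst.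
  have Eh : s (h *: u + w) ^+ 2 = qform B (h *: u + w).
    by near: h; exact: (line _ sQ).
  have Ew : s w ^+ 2 = qform B w by exact: nbhs_singleton sQ.
  rewrite /= !ev_quad -Eh -Ew.
  have E (x y z : K) : y + z != 0 ->
      x * (y ^+ 2 - z ^+ 2) / (y + z) = x * (y - z).
    by move=> yz0; rewrite subr_sqr mulrA mulfK.
  exact: E.
by apply: DeriveDef; [apply/cvg_ex; eexists; exact: qcv|exact: cvg_lim qcv].
Unshelve. all: by end_near. Qed.

(** The identity is needed near [w0] and not only at [w0], because the induction
    differentiates it. *)
Lemma iter_derive_inv_sqrt w0 us : sqrt_branch B w0 s -> qform B w0 != 0 ->
  \forall w \near w0, s w != 0 /\
    iter_derive us (fun w' => (s w')^-1) w =
    ev w (multipole us) * (s w)^-1 ^+ (size us).*2.+1.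
Proof.
move=> sb Q0.
have s0 : s w0 != 0.
  have [_ /eqP] := nbhs_singleton sb.
  by apply: contraL => /eqP ->; rewrite expr0n /= eq_sym.
have sneq0 : \forall w \near w0, s w != 0.
  have [sc _] := nbhs_singleton sb.
  exact: (cvgr_neq0 (s w0) sc s0).
elim: us => [|u us IHus].
  near=> w; split; first by near: w.
  by rewrite /= /ev meval1 mul1r expr1.
move: (nbhs_interior IHus) (nbhs_interior sb) => nIH nsb.
near=> w.
have IHw : \forall w' \near w, s w' != 0 /\
    iter_derive us (fun w' => (s w')^-1) w' =
    ev w' (multipole us) * (s w')^-1 ^+ (size us).*2.+1 by near: w.
have sbw : sqrt_branch B w s by near: w.
have [sw0 _] := nbhs_singleton IHw.
have [scw sQ] := nbhs_singleton sbw.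
split=> //=.
have sQw : \forall w' \near w, s w' ^+ 2 = qform B w'.
  by apply: filterS sbw => w' [].
have ds := is_derive_sqrt u scw sw0 sQw.
have dsi : is_derive w u (fun w' => (s w')^-1 : K^o)
    (- (s w) ^- 2 *: (ev w (linform (u *m B)) / s w)).
  apply: DeriveDef; first by apply: derivableV.
  by rewrite deriveV // derive_val.
have mulE (f g : 'rV[K]_3 -> K^o) w' : (f * g) w' = f w' * g w' by [].
have expE (f : 'rV[K]_3 -> K^o) k w' : (f ^+ k) w' = f w' ^+ k.
  by rewrite exprfctE.
rewrite (@near_eq_derive _ _ _ _ ((fun w' => ev w' (multipole us) : K^o) *
  ((fun w' => (s w')^-1 : K^o) ^+ (size us).*2.+1))); last first.
  by apply: filterS IHw => w' [_ ->]; rewrite mulE expE.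
have dp := is_derive_ev u (multipole us) w.
rewrite derive_val /= evB evZ !evM ev_quad -sQ expE doubleS.
have E (x l p p' : K) n : x != 0 ->
    p * (n.+1%:R * x^-1 ^+ n * (- x ^- 2 * (l / x))) + x^-1 ^+ n.+1 * p' =
    (x ^+ 2 * p' - n.+1%:R * (l * p)) * x^-1 ^+ n.+3.
  by move=> x0; rewrite !exprS; field.
exact: E.
Unshelve. all: by end_near. Qed.

End Multipole.

(** * Orthogonality for rotation-invariant functionals *)

Lemma prod3E (S : pzSemiRingType) (F : 'I_3 -> S) :
  \prod_i F i = F 0 * F 1 * F 2%:R.
Proof.
rewrite !big_ord_recr big_ord0 /= mul1r; congr (F _ * F _ * F _); exact/val_inj.
Qed.

Lemma sum3E (S : nmodType) (F : 'I_3 -> S) : \sum_i F i = F 0 + F 1 + F 2%:R.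
Proof.
rewrite !big_ord_recr big_ord0 /= add0r; congr (F _ + F _ + F _); exact/val_inj.
Qed.

Section Rotations.
Variable K : numFieldType.
Implicit Types (p q : mpoly 3 K).

Local Notation "''X_' i" := (mpolyX K (mnm1 i)) : ring_scope.

(** Infinitesimal rotation in the plane of the [i]th and [j]th coordinates. *)
Definition rot (i j : 'I_3) p : mpoly 3 K :=
  'X_i * mderiv j p - 'X_j * mderiv i p.

Lemma rotD i j p q : rot i j (p + q) = rot i j p + rot i j q.
Proof. by rewrite /rot !mderivD; ring. Qed.

Lemma rotZ i j c p : rot i j (c *: p) = c *: rot i j p.
Proof. by rewrite /rot !mderivZ -!scalerAr scalerBr. Qed.

Lemma rotM i j p q : rot i j (p * q) = rot i j p * q + p * rot i j q.
Proof. by rewrite /rot !mderivM; ring. Qed.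

Lemma rotX i j m : rot i j (mpolyX K m) =
  (m j)%:R *: mpolyX K (mnm_add (mnm1 i) (mnm_sub m (mnm1 j))) -
  (m i)%:R *: mpolyX K (mnm_add (mnm1 j) (mnm_sub m (mnm1 i))).
Proof. by rewrite /rot !mderivX -!scalerAr -!mpolyXD. Qed.

(** The Laplacian of the unit sphere, as the sum of the squares of the three
    infinitesimal rotations. *)
Definition casimir p : mpoly 3 K :=
  rot 0 1 (rot 0 1 p) + rot 0 2%:R (rot 0 2%:R p) + rot 1 2%:R (rot 1 2%:R p).

Let rot_rot i j p : i != j -> rot i j (rot i j p) =
  'X_i ^+ 2 * mderiv j (mderiv j p) + 'X_j ^+ 2 * mderiv i (mderiv i p) -
  2%:R * ('X_i * 'X_j * mderiv i (mderiv j p)) -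
  'X_i * mderiv i p - 'X_j * mderiv j p.
Proof.
move=> /negbTE ij; rewrite {2}/rot /rot !mderivB !mderivM !mderivXU !eqxx.
rewrite [j == i]eq_sym ij (mderiv_comm j i) -[true%:R]/1 -[false%:R]/0; ring.
Qed.

Let euler_euler p : euler (euler p) =
  euler p + \sum_i \sum_j 'X_i * 'X_j * mderiv i (mderiv j p).
Proof.
transitivity (\sum_i ('X_i * mderiv i p +
    \sum_j 'X_i * 'X_j * mderiv i (mderiv j p))); last by rewrite big_split.
apply: eq_bigr => i _.
have E : \sum_j (i == j)%:R * mderiv j p = mderiv i p.
  rewrite (bigD1 i) //= eqxx mul1r big1 ?addr0 // => j /negbTE ji.
  by rewrite eq_sym ji mul0r.
rewrite /euler raddf_sum /= -E mulr_sumr [X in _ = X + _]mulr_sumr -big_split.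
by apply: eq_bigr => j _; rewrite mderivM mderivXU mulrDr !mulrA.
Qed.

Lemma casimirE p :
  casimir p = quad 1%:M * lap 1%:M p - euler (euler p) - euler p.
Proof.
have quadE : quad 1%:M = \sum_i 'X_i ^+ 2 :> mpoly 3 K.
  apply: eq_bigr => i _; rewrite (bigD1 i) //= big1 ?addr0 => [|j ji].
    by rewrite mxE eqxx scale1r.
  by rewrite mxE eq_sym (negbTE ji) scale0r.
have lapE : lap 1%:M p = \sum_i mderiv i (mderiv i p).
  apply: eq_bigr => i _; rewrite (bigD1 i) //= big1 ?addr0 => [|j ji].
    by rewrite mxE eqxx scale1r.
  by rewrite mxE eq_sym (negbTE ji) scale0r.
rewrite quadE lapE euler_euler /casimir !rot_rot // /euler.
have : forall F : 'I_3 -> mpoly 3 K, \sum_i F i = F 0 + F 1 + F 2%:R.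
  exact: sum3E.
(* The identity is formal in the three indices. *)
move: (0 : 'I_3) (1 : 'I_3) (2%:R : 'I_3) => i j k sumE.
rewrite !sumE (mderiv_comm j i) (mderiv_comm k i) (mderiv_comm k j).
move: (mderiv i (mderiv i p)) (mderiv j (mderiv j p)) (mderiv k (mderiv k p)).
move: (mderiv i (mderiv j p)) (mderiv i (mderiv k p)) (mderiv j (mderiv k p)).
move: (mderiv i p) (mderiv j p) (mderiv k p) 'X_i 'X_j 'X_k => *; ring.
Qed.

Lemma casimir_harmonic d p : p \is ishomog1 d mdeg -> lap 1%:M p = 0 ->
  casimir p = - (d * d.+1)%:R *: p.
Proof.
move=> /homog_eulerP hp Dp; rewrite casimirE Dp mulr0 sub0r !hp eulerZ hp.
by rewrite scalerA -opprD -scalerDl scaleNr -natrM -natrD mulnS addnC.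
Qed.

(** For a functional that is invariant under rotations, infinitesimal rotations
    are skew and their Casimir operator is symmetric; it acts on harmonic polynomials of
    degree [m] as the scalar [- m (m + 1)], so that different degrees are
    orthogonal. *)
Lemma rotation_invariant_orthogonal (L : {scalar mpoly 3 K}) m n p q :
  (forall (i j : 'I_3) p, (i < j)%N -> L (rot i j p) = 0) -> m != n ->
  p \is ishomog1 m mdeg -> q \is ishomog1 n mdeg ->
  lap 1%:M p = 0 -> lap 1%:M q = 0 -> L (p * q) = 0.
Proof.
move=> Lrot mn hp hq Dp Dq.
have LD r t : L (r + t) = L r + L t by exact: linearD.
have LZ c r : L (c *: r) = c * L r by exact: linearZ.
have skew (i j : 'I_3) (r t : mpoly 3 K) : (i < j)%N ->
    L (rot i j r * t) = - L (r * rot i j t).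
  move=> ij; have := Lrot _ _ (r * t) ij.
  by rewrite rotM LD => /eqP; rewrite addr_eq0 => /eqP.
have sym : L (casimir p * q) = L (p * casimir q).
  rewrite /casimir 2!mulrDl 2!mulrDr 4!LD.
  by congr (_ + _ + _); rewrite skew // skew // opprK.
move: sym; rewrite (casimir_harmonic hp Dp) (casimir_harmonic hq Dq).
rewrite -scalerAl -scalerAr !LZ => /eqP.
rewrite -subr_eq0 -mulrBl mulf_eq0 => /orP[|/eqP //].
rewrite opprK addrC subr_eq0 eqr_nat => /eqP E.
suff : m = n by move/eqP: mn.
by nia.
Qed.

End Rotations.

(** * Integrals over the sphere *)

Section TrigIntegral.
Variable R : realType.
Implicit Types (b x : R) (m n p q : nat).

Local Notation mu := (@lebesgue_measure R).

Definition trig p q : R -> R^o := fun x => sin x ^+ p * cos x ^+ q.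

Definition trigint b p q : R := (\int[mu]_(x in `[0, b]) trig p q x)%R.

Lemma continuous_trig p q : continuous (trig p q).
Proof.
move=> x; apply: (@continuousM R _ (fun x => sin x ^+ p) (fun x => cos x ^+ q)).
  exact: (continuous_comp (@continuous_sin R x) (@exprn_continuous _ p _)).
exact: (continuous_comp (@continuous_cos R x) (@exprn_continuous _ q _)).
Qed.

Lemma integrable_continuous b (f : R -> R^o) : continuous f ->
  mu.-integrable `[0, b] (EFin \o f).
Proof.
move=> cf; apply: continuous_compact_integrable; first exact: segment_compact.
exact: continuous_subspaceT.
Qed.

Lemma Rintegral_lincomb b (I : Type) (r : seq I) (a : I -> R) (f : I -> R -> R^o) :
  (forall i, continuous (f i)) ->
  (\int[mu]_(x in `[0, b]) (\sum_(i <- r) a i * f i x))%R =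
  \sum_(i <- r) a i * (\int[mu]_(x in `[0, b]) f i x)%R.
Proof.
move=> cf; elim: r => [|i r IHr].
  rewrite big_nil; under eq_Rintegral do rewrite big_nil.
  by rewrite Rintegral_cst //= mul0r.
have ci j : continuous (fun x => a j * f j x : R^o).
  by move=> x; apply: continuousM; [exact: cst_continuous|exact: cf].
under eq_Rintegral do rewrite big_cons.
rewrite big_cons -IHr RintegralD //; last 2 first.
- exact: integrable_continuous.
- apply: integrable_continuous.
  elim: r {IHr} => [|j r IHr] x.
    rewrite (_ : (fun _ => _) = cst 0); first exact: cst_continuous.
    by apply/funext => y; rewrite big_nil.
  rewrite (_ : (fun _ => _) =
    (fun x => a j * f j x : R^o) + (fun x => \sum_(i <- r) a i * f i x : R^o)).
    by apply: continuousD; [exact: ci|exact: IHr].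
  by apply/funext => y; rewrite big_cons.
by rewrite RintegralZl //; exact: integrable_continuous.
Qed.

Lemma is_derive_trig m n x : is_derive x 1 (trig m n)
  (m%:R * trig m.-1 n.+1 x - n%:R * trig m.+1 n.-1 x).
Proof.
have -> : trig m n = (@sin R : R -> R^o) ^+ m * (@cos R : R -> R^o) ^+ n.
  by apply/funext => y; rewrite /trig -[in RHS]/(_ * _) !exprfctE.
have ds : is_derive x 1 ((@sin R : R -> R^o) ^+ m)
    ((m%:R * sin x ^+ m.-1) *: cos x) by exact: is_deriveX.
have dc : is_derive x 1 ((@cos R : R -> R^o) ^+ n)
    ((n%:R * cos x ^+ n.-1) *: - sin x) by exact: is_deriveX.
have [dsc vE] := is_deriveM ds dc; apply: DeriveDef => //.
rewrite vE !exprfctE /trig /GRing.scale /= !exprS; ring.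
Qed.

(** Integration of the derivative of [sin^m cos^n] over an interval on whose
    endpoints this function takes the same value. *)
Lemma trigint_rec b m n : 0 < b -> sin b = 0 -> (m == 0%N -> cos b = 1) ->
  m%:R * trigint b m.-1 n.+1 = n%:R * trigint b m.+1 n.-1.
Proof.
move=> b0 sb cb.
have Fb : trig m n b = trig m n 0.
  rewrite /trig sb sin0 cos0; case: m cb => [/(_ isT) ->//|m _].
  by rewrite exprS !mul0r.
pose f x : R^o := m%:R * trig m.-1 n.+1 x + - n%:R * trig m.+1 n.-1 x.
have cf : continuous f.
  move=> x; apply: (@continuousD R R^o _ (fun x => m%:R * trig m.-1 n.+1 x : R^o)
    (fun x => - n%:R * trig m.+1 n.-1 x : R^o)).
    by apply: continuousM; [exact: cst_continuous|exact: continuous_trig].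
  by apply: continuousM; [exact: cst_continuous|exact: continuous_trig].
have : (\int[mu]_(x in `[0, b]) f x)%R = 0.
  rewrite /Rintegral (@continuous_FTC2 _ f (trig m n)) ?Fb //.
  - by rewrite subee.
  - exact: continuous_subspaceT.
  - split.
    + by move=> x _; have [] := is_derive_trig m n x.
    + by apply: cvg_at_right_filter; exact: continuous_trig.
    + by apply: cvg_at_left_filter; exact: continuous_trig.
  - move=> x _; rewrite derive1E; have [_ ->] := is_derive_trig m n x.
    by rewrite /f mulNr.
have := @Rintegral_lincomb b bool [:: true; false]
  (fun i => if i then m%:R else - n%:R)
  (fun i => if i then trig m.-1 n.+1 else trig m.+1 n.-1).
under eq_Rintegral do rewrite !big_cons big_nil addr0.
rewrite !big_cons big_nil addr0 -/f => ->; last by case; exact: continuous_trig.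
by move/eqP; rewrite mulNr subr_eq0 => /eqP.
Qed.

Lemma trigint_pythagoras b p q :
  trigint b p q = trigint b p.+2 q + trigint b p q.+2.
Proof.
rewrite /trigint -RintegralD //; try exact/integrable_continuous/continuous_trig.
apply: eq_Rintegral => x _; rewrite /trig !exprS.
rewrite -[LHS]mulr1 -(cos2Dsin2 x) !expr2; ring.
Qed.

(** The integral of [x^a y^b z^c] over the unit sphere, as the product of the
    integrals over the polar and the azimuthal angle. *)
Definition moment3 (a b c : nat) : R :=
  trigint pi (a + b).+1 c * trigint (2 * pi) b a.

Let sin2piE : sin (2 * pi : R) = 0.
Proof. by rewrite mulrC mulr_natr sin2pi. Qed.
Let cos2piE : cos (2 * pi : R) = 1.
Proof. by rewrite mulrC mulr_natr cos2pi. Qed.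
Let pi2_gt0 : 0 < 2 * pi :> R.
Proof. by rewrite mulr_gt0 // pi_gt0. Qed.

(** The three identities below express the invariance of the surface measure
    under rotations about the coordinate axes, tested on monomials. *)
Lemma moment3_rot01 (a b c : nat) :
  b%:R * moment3 a.+1 b.-1 c = a%:R * moment3 a.-1 b.+1 c.
Proof.
have rec := @trigint_rec (2 * pi) b a pi2_gt0 sin2piE (fun=> cos2piE).
case: b rec => [|b] rec.
  case: a rec => [|a] rec; first by rewrite !mul0r.
  by rewrite mul0r /moment3 [RHS]mulrCA -rec mul0r mulr0.
rewrite /moment3 [LHS]mulrCA rec; case: a {rec} => [|a]; first by rewrite !mul0r mulr0.
by rewrite mulrCA /=; congr (_ * (trigint _ _ _ * _)); lia.
Qed.

Let trigint_polar (a b : nat) :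
  (a + b.+1)%:R * trigint (2 * pi) b a.+1 = a%:R * trigint (2 * pi) b a.-1.
Proof.
have /= rec := @trigint_rec (2 * pi) b.+1 a pi2_gt0 sin2piE (fun=> cos2piE).
rewrite (natrD _ a b.+1) [LHS]mulrDl rec {rec}; case: a => [|a]; first by rewrite !mul0r addr0.
by rewrite /= [in RHS](trigint_pythagoras _ b a) [RHS]mulrDr [RHS]addrC.
Qed.

Let trigint_azimuth (a b : nat) :
  (a.+1 + b)%:R * trigint (2 * pi) b.+1 a = b%:R * trigint (2 * pi) b.-1 a.
Proof.
have /= rec := @trigint_rec (2 * pi) b a.+1 pi2_gt0 sin2piE (fun=> cos2piE).
rewrite (natrD _ a.+1 b) [LHS]mulrDl -rec {rec}; case: b => [|b]; first by rewrite !mul0r addr0.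
by rewrite /= [in RHS](trigint_pythagoras _ b a) [RHS]mulrDr [RHS]addrC.
Qed.

Let trigint_pi (k c : nat) :
  k.+1%:R * trigint pi k c.+1 = c%:R * trigint pi k.+2 c.-1.
Proof. by rewrite -(@trigint_rec pi k.+1 c) ?pi_gt0 ?sinpi. Qed.

Lemma moment3_rot02 (a b c : nat) :
  c%:R * moment3 a.+1 b c.-1 = a%:R * moment3 a.-1 b c.+1.
Proof.
rewrite /moment3 mulrA addSn -trigint_pi mulrAC -addnS trigint_polar.
by case: a => [|a]; rewrite ?mul0r // -mulrA [X in _ * X]mulrC /= addSn.
Qed.

Lemma moment3_rot12 (a b c : nat) :
  c%:R * moment3 a b.+1 c.-1 = b%:R * moment3 a b.-1 c.+1.
Proof.
rewrite /moment3 mulrA addnS -trigint_pi mulrAC -addSn trigint_azimuth.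
by case: b => [|b]; rewrite ?mul0r // -mulrA [X in _ * X]mulrC /= addnS.
Qed.

Definition moment (m : multinom 3) : R := moment3 (m 0) (m 1) (m 2%:R).

Lemma sphere_integral_monomials (s : seq (multinom 3)) (a : multinom 3 -> R) :
  sphere_integral_real (fun u => \sum_(m <- s) a m * \prod_i u 0 i ^+ m i) =
  \sum_(m <- s) a m * moment m.
Proof.
rewrite /sphere_integral_real.
pose f (m : multinom 3) phi : R := trigint pi (m 0 + m 1).+1 (m 2%:R) * trig (m 1) (m 0) phi.
transitivity (\int[mu]_(phi in `[0%R, 2 * pi]) (\sum_(m <- s) a m * f m phi))%R.
  apply: eq_Rintegral => phi _.
  pose c (m : multinom 3) : R := a m * trig (m 1) (m 0) phi.
  transitivity (\int[mu]_(theta in `[0%R, pi])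
    (\sum_(m <- s) c m * trig (m 0 + m 1).+1 (m 2%:R) theta))%R.
    apply: eq_Rintegral => theta _; rewrite mulr_suml; apply: eq_bigr => m _.
    rewrite prod3E !mxE !(tnth_nth 0) /= /c /trig !exprMn exprS exprD; ring.
  rewrite Rintegral_lincomb; last by move=> m; exact: continuous_trig.
  by apply: eq_bigr => m _; rewrite /c /f -/(trigint _ _ _); ring.
rewrite Rintegral_lincomb => [|m x].
  apply: eq_bigr => m _; congr (_ * _).
  by rewrite RintegralZl //; exact/integrable_continuous/continuous_trig.
apply: (@continuousM R R^o (cst (trigint pi (m 0 + m 1).+1 (m 2%:R)))
  (trig (m 1) (m 0)) x); first exact: cst_continuous.
exact: continuous_trig.
Qed.

End TrigIntegral.

Section SphereFunctional.
Variable R : realType.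
Local Notation C := R[i].
Implicit Types (p q : mpoly 3 C).

Local Notation "''X_' i" := (mpolyX C (mnm1 i)) : ring_scope.

Lemma Re_sum (I : Type) (r : seq I) (F : I -> C) :
  complex.Re (\sum_(i <- r) F i) = \sum_(i <- r) complex.Re (F i).
Proof. by apply: big_morph => // -[a b] [c d]. Qed.

Lemma Im_sum (I : Type) (r : seq I) (F : I -> C) :
  complex.Im (\sum_(i <- r) F i) = \sum_(i <- r) complex.Im (F i).
Proof. by apply: big_morph => // -[a b] [c d]. Qed.

(** The integral over the sphere as a linear form on polynomials: linearity and
    invariance under rotations are then checked on monomials, with no further
    appeal to measurability or integrability. *)
Definition sphere_functional p : C :=
  \sum_(m <- msupp p) mcoeff m p * (moment R m)%:C.

Lemma sphere_integral_ev p :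
  sphere_integral (fun u => ev (mx_complex u) p) = sphere_functional p.
Proof.
have evE u : ev (mx_complex u) p =
    \sum_(m <- msupp p) mcoeff m p * (\prod_i u 0 i ^+ m i)%:C.
  rewrite /ev mevalE; apply: eq_bigr => m _; rewrite rmorph_prod.
  by congr (_ * _); apply: eq_bigr => i _; rewrite mxE rmorphXn.
have ReE u : complex.Re (ev (mx_complex u) p) =
    \sum_(m <- msupp p) complex.Re (mcoeff m p) * \prod_i u 0 i ^+ m i.
  rewrite evE Re_sum; apply: eq_bigr => m _.
  by case: (mcoeff m p) => a b /=; rewrite mulr0 subr0.
have ImE u : complex.Im (ev (mx_complex u) p) =
    \sum_(m <- msupp p) complex.Im (mcoeff m p) * \prod_i u 0 i ^+ m i.
  rewrite evE Im_sum; apply: eq_bigr => m _.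
  by case: (mcoeff m p) => a b /=; rewrite mulr0 add0r.
rewrite /sphere_integral (funext ReE) (funext ImE) !sphere_integral_monomials.
apply/eqP; rewrite eq_complex /= Re_sum Im_sum; apply/andP; split; apply/eqP.
  by apply: eq_bigr => m _; case: (mcoeff m p) => a b /=; rewrite mulr0 subr0.
by apply: eq_bigr => m _; case: (mcoeff m p) => a b /=; rewrite mulr0 add0r.
Qed.

Let functional_wide (s : seq (multinom 3)) p : uniq s ->
  {subset msupp p <= s} ->
  sphere_functional p = \sum_(m <- s) mcoeff m p * (moment R m)%:C.
Proof.
move=> us sub; rewrite (bigID (fun m => m \in msupp p)) /=.
rewrite [X in _ + X]big1 ?addr0 => [|m]; last first.
  by rewrite -mcoeff_eq0 => /eqP ->; rewrite mul0r.
rewrite -big_filter; apply: perm_big; apply: uniq_perm.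
- exact: msupp_uniq.
- exact: filter_uniq.
- by move=> m; rewrite mem_filter; case: (boolP (m \in msupp p)) => // /sub ->.
Qed.

Fact sphere_functional_is_scalar : scalar sphere_functional.
Proof.
move=> c p q; pose s := undup (msupp p ++ msupp q ++ msupp (c *: p + q)).
have us : uniq s := undup_uniq _.
rewrite !(functional_wide us) => [|m|m|m];
  try by rewrite mem_undup !mem_cat => ->; rewrite ?orbT.
rewrite mulr_sumr -big_split; apply: eq_bigr => m _ /=.
by rewrite mcoeffD mcoeffZ mulrDl mulrA.
Qed.
HB.instance Definition _ := GRing.isLinear.Build C (mpoly 3 C) C _
  sphere_functional sphere_functional_is_scalar.

Lemma sphere_functionalD p q :
  sphere_functional (p + q) = sphere_functional p + sphere_functional q.
Proof. exact: linearD. Qed.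

Lemma sphere_functionalB p q :
  sphere_functional (p - q) = sphere_functional p - sphere_functional q.
Proof. exact: linearB. Qed.

Lemma sphere_functionalZ c p :
  sphere_functional (c *: p) = c * sphere_functional p.
Proof. exact: linearZ. Qed.

Lemma sphere_functionalX m : sphere_functional (mpolyX C m) = (moment R m)%:C.
Proof. by rewrite /sphere_functional msuppX big_seq1 mcoeffX eqxx mul1r. Qed.

Lemma sphere_functional_rot (i j : 'I_3) p : (i < j)%N ->
  sphere_functional (rot i j p) = 0.
Proof.
move=> ij; elim/mpolyind: p => [|c m p _ _ IHp].
  by rewrite /rot !mderiv0 !mulr0 subr0 linear0.
rewrite rotD rotZ rotX sphere_functionalD IHp addr0 sphere_functionalZ.
rewrite sphere_functionalB !sphere_functionalZ !sphere_functionalX.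
suff E : (m j)%:R * moment R (mnm_add (mnm1 i) (mnm_sub m (mnm1 j))) =
         (m i)%:R * moment R (mnm_add (mnm1 j) (mnm_sub m (mnm1 i))).
  by rewrite -!(rmorph_nat (real_complex R)) -!rmorphM /= E subrr mulr0.
rewrite /moment !mnmDE !mnmBE !mnm1E.
have [[-> ->]|[-> ->]|[-> ->]] : [\/ i = 0 /\ j = 1, i = 0 /\ j = 2%:R |
    i = 1 /\ j = 2%:R].
  clear - ij; case: i ij => [[|[|[|//]]] hi]; case: j => [[|[|[|//]]] hj] //= _;
  [constructor 1|constructor 2|constructor 3]; split; exact: val_inj.
- by rewrite /= !add0n !subn0 !add1n !subn1 moment3_rot01.
- by rewrite /= !add0n !subn0 !add1n !subn1 moment3_rot02.
- by rewrite /= !add0n !subn0 !add1n !subn1 moment3_rot12.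
Qed.

Lemma sphere_functional_orthogonal m n p q : m != n ->
  p \is ishomog1 m mdeg -> q \is ishomog1 n mdeg ->
  lap 1%:M p = 0 -> lap 1%:M q = 0 -> sphere_functional (p * q) = 0.
Proof.
exact: (rotation_invariant_orthogonal (L := sphere_functional)
  sphere_functional_rot).
Qed.

End SphereFunctional.

(** * Diagonalization of quadratic forms *)

Section Diagonalization.
Variable K : numFieldType.

Lemma bilinear_delta n (M : 'M[K]_n) i j :
  ((delta_mx 0 i : 'rV_n) *m M *m (delta_mx 0 j : 'rV_n)^T) 0 0 = M i j.
Proof. by rewrite -rowE trmx_delta -colE !mxE. Qed.

Lemma bilinear_polarization n (M : 'M[K]_n) :
  M^T = M -> (forall v : 'rV[K]_n, (v *m M *m v^T) 0 0 = 0) -> M = 0.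
Proof.
move=> Ms M0; pose b (u v : 'rV[K]_n) : K := (u *m M *m v^T) 0 0.
have bC u v : b u v = b v u.
  by rewrite /b -[in LHS](trmxK (u *m M *m v^T)) mxE !trmx_mul trmxK Ms mulmxA.
have bD u v w : b (u + v) w = b u w + b v w by rewrite /b !mulmxDl mxE.
have b0 u v : b u v = 0.
  have := M0 (u + v); rewrite -/(b _ _) bD ![b _ (u + v)]bC !bD.
  rewrite [b u u]M0 [b v v]M0 add0r addr0 bC -mulr2n => /eqP.
  by rewrite mulrn_eq0 => /eqP.
apply/matrixP => i j; rewrite mxE -[RHS](b0 (delta_mx 0 i) (delta_mx 0 j)).
exact/esym/bilinear_delta.
Qed.

(** Gaussian elimination of a single nonzero row. *)
Lemma row_completion n (v : 'rV[K]_n.+1) : v != 0 ->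
  exists2 E : 'M[K]_n.+1, E \in unitmx & exists c, v = c *: row 0 E.
Proof.
move=> v0; exists (row_ebase v); first exact: row_ebase_unit.
exists (col_ebase v 0 0); rewrite -{1}(mulmx_ebase v) rank_rV v0.
rewrite [col_ebase v in LHS]mx11_scalar mul_scalar_mx -scalemxAl rowE.
congr (_ *: (_ *m _)); apply/matrixP => i j; rewrite !mxE !ord1 !eqxx /=.
by rewrite eq_sym -val_eqE /=; case: (val j).
Qed.

(** Completing the square: a vector [v] with [v B v^T != 0] becomes the first
    basis vector, and [L] splits it off, leaving the Schur complement [S]. *)
Lemma symmetric_diagonalization n (B : 'M[K]_n) : B^T = B ->
  exists P D, P \in unitmx /\ P *m B *m P^T = diag_mx D.
Proof.
elim: n B => [|n IHn] B Bs.
  by exists 1%:M, 0; split; [exact: unitmx1|apply/matrixP => -[]].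
have [->|B0] := eqVneq B 0.
  exists 1%:M, 0; split; first exact: unitmx1.
  by rewrite mulmx0 mul0mx; apply/matrixP => i j; rewrite !mxE mul0rn.
have [v vBv] : exists v : 'rV[K]_n.+1, (v *m B *m v^T) 0 0 != 0.
  apply: contrapT => H; case/eqP: B0; apply: bilinear_polarization => // v.
  by apply/eqP; apply: contrapT => /negP vB; apply: H; exists v.
have v0 : v != 0.
  by apply: contraNneq vBv => ->; rewrite !mul0mx mxE.
have [E Eu [c vE]] := row_completion v0.
pose B' : 'M[K]_(1 + n) := E *m B *m E^T.
have B's : B'^T = B' by rewrite /B' !trmx_mul trmxK Bs mulmxA.
have a0 : B' 0 0 != 0.
  apply: contraNneq vBv => B'0; rewrite vE linearZ /= -!scalemxAl -scalemxAr.
  suff -> : row 0 E *m B *m (row 0 E)^T = 0 by rewrite !scaler0 mxE.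
  rewrite [LHS]mx11_scalar rowE trmx_mul !mulmxA -(mulmxA _ E) -(mulmxA _ (E *m B)).
  by rewrite bilinear_delta -/B' B'0 raddf0.
have B'def : E *m B *m E^T = B' by [].
clearbody B'; pose al := B' 0 0; pose r := ursubmx B'.
have B'E : B' = block_mx al%:M r r^T (drsubmx B').
  rewrite -{1}(submxK B') -[dlsubmx B']trmxK trmx_dlsub B's; congr block_mx.
  rewrite [LHS]mx11_scalar !mxE; congr (_%:M); congr (B' _ _); exact: val_inj.
pose L : 'M[K]_(1 + n) := block_mx 1%:M 0 (- al^-1 *: r^T) 1%:M.
have Lu : L \in unitmx by rewrite unitmxE det_lblock !det1 mulr1 unitr1.
pose S := drsubmx B' - al^-1 *: (r^T *m r).
have LBL : L *m B' *m L^T = block_mx al%:M 0 0 S.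
  rewrite B'E /L tr_block_mx !trmx1 !trmx0 linearZ /= trmxK !mulmx_block.
  rewrite !mul1mx !mul0mx !mulmx0 !mulmx1 !addr0 !mul_scalar_mx !mul_mx_scalar.
  rewrite !scalerA !mulrN mulfV // scaleN1r addNr -!scalemxAl.
  by rewrite scaleN1r addNr mul0mx add0r /S scaleNr addrC.
have Ss : S^T = S.
  have : (L *m B' *m L^T)^T = L *m B' *m L^T by rewrite !trmx_mul trmxK B's mulmxA.
  by rewrite LBL tr_block_mx => /eq_block_mx [].
have [P [D [Pu PD]]] := IHn S Ss.
pose P' : 'M[K]_(1 + n) := block_mx 1%:M 0 0 P.
have P'u : P' \in unitmx by rewrite unitmxE det_lblock det1 mul1r -unitmxE.
exists (P' *m L *m E), (row_mx al%:M D); split.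
  by rewrite unitmx_mul Eu andbT unitmx_mul; apply/andP.
transitivity (P' *m (L *m (E *m B *m E^T) *m L^T) *m P'^T).
  by rewrite !trmx_mul !mulmxA.
rewrite B'def LBL /P' tr_block_mx !trmx1 !trmx0 !mulmx_block.
rewrite !mul1mx !mul0mx !mulmx0 !mulmx1 !addr0 !add0r PD.
transitivity (block_mx (diag_mx al%:M) 0 0 (diag_mx D)).
  have {1}-> : (al%:M : 'M[K]_1) = diag_mx (al%:M : 'rV[K]_1).
    by apply/matrixP => i j; rewrite !ord1 !mxE.
  by rewrite mul0mx.
exact: (esym (@diag_mx_row _ n 1 al%:M D)).
Qed.

Lemma diagonal_factor n (B P : 'M[K]_n) D : P \in unitmx ->
  P *m B *m P^T = diag_mx D -> B = invmx P *m diag_mx D *m (invmx P)^T.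
Proof.
move=> Pu <-; rewrite -!mulmxA -trmx_mul mulVmx // trmx1 mulmx1.
by rewrite mulKmx.
Qed.

Lemma diagonal_neq0 n (B P : 'M[K]_n) D : B \in unitmx -> P \in unitmx ->
  P *m B *m P^T = diag_mx D -> forall i, D 0 i != 0.
Proof.
move=> Bu Pu PD i; have : diag_mx D \in unitmx.
  by rewrite -PD !unitmx_mul unitmx_tr Pu Bu.
by rewrite unitmxE det_diag unitfE => /prodf_neq0 /(_ i isT).
Qed.

(** Square roots of the diagonal entries turn a diagonalization into a
    factorization [B = A A^T]. *)
Lemma square_factor n (B P : 'M[K]_n) D (e : 'rV[K]_n) : P \in unitmx ->
  P *m B *m P^T = diag_mx D ->
  (forall i, e 0 i ^+ 2 = D 0 i) -> B = (invmx P *m diag_mx e) *m (invmx P *m diag_mx e)^T.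
Proof.
move=> Pu PD eD; rewrite {1}(diagonal_factor Pu PD) trmx_mul tr_diag_mx !mulmxA.
congr (_ *m _); rewrite -mulmxA; congr (_ *m _).
rewrite mulmx_diag; congr diag_mx; apply/rowP => i.
by rewrite !mxE -eD.
Qed.

End Diagonalization.

Section SquareFactorization.
Variable R : realType.
Variable B : 'M[R]_3.
Hypotheses (Bsym : B^T = B) (Binv : B \in unitmx).

Lemma complex_square_factor :
  exists2 A : 'M[R[i]]_3, A \in unitmx & mx_complex B = A *m A^T.
Proof.
have [P [D [Pu PD]]] := symmetric_diagonalization Bsym.
pose f := real_complex R : {rmorphism R -> R[i]}.
have Pu' : map_mx f P \in unitmx by rewrite map_unitmx.
have PD' : map_mx f P *m map_mx f B *m (map_mx f P)^T = diag_mx (map_mx f D).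
  by rewrite map_trmx -!map_mxM PD map_diag_mx.
pose e : 'rV[R[i]]_3 := \row_i sqrtc (D 0 i)%:C.
have eD i : e 0 i ^+ 2 = map_mx f D 0 i by rewrite !mxE sqr_sqrtc.
have E := square_factor Pu' PD' eD.
exists (invmx (map_mx f P) *m diag_mx e) => //.
have : map_mx f B \in unitmx by rewrite map_unitmx.
by rewrite E unitmx_mul => /andP[].
Qed.

Lemma real_square_factor : positive_definite B ->
  exists2 A : 'M[R]_3, A \in unitmx & B = A *m A^T.
Proof.
move=> Bpos; have [P [D [Pu PD]]] := symmetric_diagonalization Bsym.
have D0 i : 0 <= D 0 i.
  rewrite (_ : D 0 i = qform B (row i P)).
    have [->|/Bpos/ltW //] := eqVneq (row i P) 0.
    by rewrite /qform !mul0mx mxE.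
  have <- : diag_mx D i i = D 0 i by rewrite mxE eqxx.
  rewrite -PD -bilinear_delta /qform rowE trmx_mul !mulmxA //.
pose e : 'rV[R]_3 := \row_i Num.sqrt (D 0 i).
have eD i : e 0 i ^+ 2 = D 0 i by rewrite mxE sqr_sqrtr.
have E := square_factor Pu PD eD.
exists (invmx P *m diag_mx e) => //.
by move: Binv; rewrite E unitmx_mul => /andP[].
Qed.

End SquareFactorization.

(** * Polynomials vanishing on a level surface *)

Section TopComponent.
Variable K : numFieldType.
Variable B : 'M[K]_3.
Hypotheses (Bsym : B^T = B) (Binv : B \in unitmx).
Implicit Types (p q : mpoly 3 K).

Lemma mcoeff_pihomog d p m :
  mcoeff m (pihomog mdeg d p) = if mdeg m == d then mcoeff m p else 0.
Proof.
elim/mpolyind: p => [|c k p _ _ IHp]; first by rewrite pihomog0 mcoeff0 if_same.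
rewrite pihomogD linearZ /= pihomogX !mcoeffD IHp !mcoeffZ mcoeffX.
case: (eqVneq k m) => [->|km] /=.
  by case: eqP => _; rewrite ?mcoeffX ?eqxx // mcoeff0 mulr0 addr0.
rewrite !mulr0 !add0r; case: (mdeg k == d); rewrite ?mcoeffX ?(negbTE km) ?mcoeff0 mulr0 add0r //.
Qed.

Lemma pihomog_quadM d p :
  pihomog mdeg d.+2 (quad B * p) = quad B * pihomog mdeg d p.
Proof.
rewrite {1}(pihomog_partitionE (leqnn (msize p))) mulr_sumr.
rewrite (raddf_sum (pihomog mdeg d.+2)) /=.
under eq_bigr => e _.
  rewrite (_ : pihomog _ _ _ =
    if e == d :> nat then quad B * pihomog mdeg d p else 0); last first.
    have he := homog_quadM B (pihomogP mdeg e p).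
    case: eqP => [<-|/eqP ed]; first by rewrite pihomog_dE.
    by rewrite (pihomog_ne0 _ he).
  over.
have [lt_dp|ge_dp] := ltnP d (msize p).
  rewrite (bigD1 (Ordinal lt_dp)) //= eqxx big1 ?addr0 // => e.
  by rewrite -val_eqE /= => /negbTE ->.
rewrite big1 => [|[e /= ep] _]; last by case: eqP => // ed; lia.
suff -> : pihomog mdeg d p = 0 by rewrite mulr0.
apply/mpolyP => m; rewrite mcoeff_pihomog mcoeff0; case: eqP => // md.
by apply/eqP; rewrite mcoeff_eq0 msize_mdeg_ge // md.
Qed.

(** The component of top degree of a multiple of [Q - c] is a multiple of [Q],
    to which [lap_quadM_eigen] applies with eigenvalue [0]. *)
Lemma harmonic_quad_multiple (c : K) q :
  lap (invmx B) ((quad B - mpolyC 3 c) * q) = 0 -> q = 0.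
Proof.
rewrite mulrBl lapB mul_mpolyC lapZ => /eqP; rewrite subr_eq0 => /eqP Dq.
apply/eqP; apply: contraT => q0; pose e := (msize q).-1.
have mq : mdeg (mlead q) = e by rewrite /e -mlead_deg.
suff qe0 : pihomog mdeg e q = 0.
  have := congr1 (mcoeff (mlead q)) qe0.
  by rewrite mcoeff_pihomog mq eqxx mcoeff0 => /eqP; rewrite mleadc_eq0 (negbTE q0).
apply: (lap_quadM_eigen Bsym Binv (lexx 0) (pihomogP mdeg e q)).
rewrite scale0r -pihomog_quadM -pihomog_lap Dq linearZ /= pihomog_lap.
rewrite (_ : pihomog mdeg e.+2 q = 0) ?lap0 ?scaler0 //.
apply/mpolyP => m; rewrite mcoeff_pihomog mcoeff0; case: eqP => // md.
apply/eqP; rewrite mcoeff_eq0 msize_mdeg_ge // md /e -(mlead_deg q0) /=; lia.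
Qed.

End TopComponent.

Section LocalVanishing.
Variable K : numFieldType.
Implicit Types (p : mpoly 3 K) (v : 'rV[K]_3).

Lemma msize_mderiv i p d : (msize p <= d.+1)%N -> (msize (mderiv i p) <= d)%N.
Proof.
move=> pd; rewrite msizeE; apply/bigmax_leqP_seq => m mp _.
have : mnm_add m (mnm1 i) \in msupp p.
  rewrite mcoeff_msupp; move: mp; rewrite mcoeff_msupp mcoeff_deriv.
  by apply: contraNneq => ->; rewrite mul0rn.
by move/msize_mdeg_lt; rewrite mdegD mdeg1; lia.
Qed.

(** The partial derivatives vanish on the same open set, so that induction on
    the degree applies to them. *)
Lemma mpoly_vanish_near p v : (\forall w \near v, ev w p = 0) -> p = 0.
Proof.
have [d] := ubnP (msize p); elim: d p => // d IHd p pd pv.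
have [p0|p0] := leqP (msize p) 0.
  by apply/eqP; rewrite -msize_poly_eq0 -leqn0.
have Dp i : mderiv i p = 0.
  apply: IHd.
    by have := @msize_mderiv i p (msize p).-1; move: pd p0; clear; lia.
  have := nbhs_interior pv; apply: filterS => w pw.
  have <- : dirderiv (delta_mx 0 i) p = mderiv i p.
    rewrite /dirderiv (bigD1 i) //= mxE !eqxx scale1r big1 ?addr0 // => j ji.
    by rewrite mxE (negbTE ji) andbF scale0r.
  have [_ <-] := is_derive_ev (delta_mx 0 i) p w.
  rewrite (@near_eq_derive _ _ _ _ (cst (0 : K^o))).
    exact: derive_cst.
  exact: pw.
have hp : p \is ishomog1 0 mdeg.
  apply/homog_eulerP; rewrite scale0r /euler big1 // => i _.
  by rewrite Dp mulr0.
have pC : p = mpolyC 3 (mcoeff mnm0 p).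
  apply/mpolyP => m; rewrite mcoeffC; case: eqVneq => [->|m0]; rewrite ?mulr1 //.
  by rewrite mulr0 (dhomog_nemf_coeff hp) ?mdeg_eq0.
by have := nbhs_singleton pv; rewrite pC evC => ->; rewrite mpolyC0.
Qed.

End LocalVanishing.

Section LevelSurface.
Variable R : realType.
Implicit Types (p q a : mpoly 3 R) (v w : 'rV[R]_3).

Local Notation "''X_' i" := (mpolyX R (mnm1 i)) : ring_scope.

Section Diagonal.
Variables (D : 'rV[R]_3) (c : R) (i : 'I_3).
Hypothesis D0 : D 0 i != 0.

Definition independent_of p := forall v w,
  (forall j, j != i -> v 0 j = w 0 j) -> ev v p = ev w p.

Definition solved_square : mpoly 3 R :=
  (D 0 i)^-1 *: (mpolyC 3 c - \sum_(j | j != i) D 0 j *: 'X_j ^+ 2).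

Lemma quad_diag : quad (diag_mx D) = \sum_j D 0 j *: 'X_j ^+ 2.
Proof.
apply: eq_bigr => j _; rewrite (bigD1 j) //= big1 ?addr0 => [|k kj].
  by rewrite mxE eqxx expr2.
by rewrite mxE eq_sym (negbTE kj) scale0r.
Qed.

Lemma sqr_variable :
  'X_i ^+ 2 = solved_square + (quad (diag_mx D) - mpolyC 3 c) * mpolyC 3 (D 0 i)^-1.
Proof.
rewrite mulrC mul_mpolyC -scalerDr quad_diag [X in _ + (X - _)](bigD1 i) //=.
by rewrite [X in _ *: X](_ : _ = D 0 i *: 'X_i ^+ 2) ?scalerK //; ring.
Qed.

Lemma independent_square : independent_of solved_square.
Proof.
move=> v w vw; rewrite !evZ !evB !evC !ev_sum; congr (_ * (_ - _)).
by apply: eq_bigr => j ji; rewrite !evZ !evX !evXU vw.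
Qed.

(** Division by [Q - c] with respect to the variable [X_i]. *)
Lemma surface_division p : exists a0 a1 q,
  [/\ independent_of a0, independent_of a1 &
      p = a0 + 'X_i * a1 + (quad (diag_mx D) - mpolyC 3 c) * q].
Proof.
elim/mpoly_alg_ind: p => [e|j|p q|p q].
- exists (mpolyC 3 e), 0, 0; split; last by rewrite !mulr0 !addr0.
    by move=> v w _; rewrite !evC.
  by move=> v w _; rewrite /ev !meval0.
- have [->|ji] := eqVneq j i.
    exists 0, 1, 0; split; last by rewrite mulr1 mulr0 addr0 add0r.
      by move=> v w _; rewrite /ev !meval0.
    by move=> v w _; rewrite /ev !meval1.
  exists 'X_j, 0, 0; split; last by rewrite !mulr0 !addr0.
    by move=> v w vw; rewrite !evXU vw.
  by move=> v w _; rewrite /ev !meval0.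
- move=> [a0 [a1 [r [ia0 ia1 ->]]]] [b0 [b1 [t [ib0 ib1 ->]]]].
  exists (a0 + b0), (a1 + b1), (r + t); split; last by ring.
    by move=> v w vw; rewrite !evD (ia0 v w) // (ib0 v w).
  by move=> v w vw; rewrite !evD (ia1 v w) // (ib1 v w).
- move=> [a0 [a1 [r [ia0 ia1 pE]]]] [b0 [b1 [t [ib0 ib1 qE]]]].
  exists (a0 * b0 + solved_square * (a1 * b1)), (a0 * b1 + a1 * b0).
  pose S := quad (diag_mx D) - mpolyC 3 c.
  exists (a1 * b1 * mpolyC 3 (D 0 i)^-1 + (a0 + 'X_i * a1) * t +
          (b0 + 'X_i * b1) * r + S * (r * t)); split.
  + move=> v w vw; rewrite !evD !evM (ia0 v w) // (ib0 v w) // (ia1 v w) //.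
    by rewrite (ib1 v w) // (independent_square vw).
  + move=> v w vw; rewrite !evD !evM (ia0 v w) // (ib0 v w) // (ia1 v w) //.
    by rewrite (ib1 v w).
  + have := sqr_variable; rewrite pE qE -/S => X2.
    transitivity (a0 * b0 + 'X_i * (a0 * b1 + a1 * b0) + 'X_i ^+ 2 * (a1 * b1) +
      S * ((a0 + 'X_i * a1) * t + (b0 + 'X_i * b1) * r + S * (r * t))).
      by ring.
    by rewrite X2; ring.
Qed.

(** Near a point with [v_i != 0] the surface is a pair of graphs
    [x_i = +- sqrt r] over the other two coordinates, so that both
    coefficients of the remainder [a0 + X_i a1] vanish on an open set. *)
Lemma vanish_on_diagonal_surface p v : v 0 i != 0 ->
  qform (diag_mx D) v = c ->
  (forall w, qform (diag_mx D) w = c -> ev w p = 0) ->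
  exists q, p = (quad (diag_mx D) - mpolyC 3 c) * q.
Proof.
move=> vi Qv pS; have [a0 [a1 [q [ia0 ia1 pE]]]] := surface_division p.
have r_gt0 : \forall w \near v, 0 < ev w solved_square.
  have rv : 0 < ev v solved_square.
    have /(congr1 (ev v)) := sqr_variable; rewrite evX evXU evD evM evB evC.
    rewrite ev_quad Qv subrr mul0r addr0 => <-.
    by rewrite exprn_even_gt0.
  have cv : ev w solved_square @[w --> v] --> ev v solved_square.
    exact: continuous_ev.
  exact: (cvgr_gt _ cv _ rv).
have vanish w : 0 < ev w solved_square -> ev w a0 = 0 /\ ev w a1 = 0.
  move=> r0; pose s := Num.sqrt (ev w solved_square).
  have s0 : s != 0 by rewrite gt_eqF // sqrtr_gt0.
  have eqn e : e ^+ 2 = 1 -> ev w a0 + e * s * ev w a1 = 0.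
    move=> e2; pose w' : 'rV[R]_3 := \row_j if j == i then e * s else w 0 j.
    have w'E j : j != i -> w 0 j = w' 0 j by move=> ji; rewrite mxE (negbTE ji).
    have Qw' : qform (diag_mx D) w' = c.
      have /(congr1 (ev w')) := sqr_variable.
      rewrite evX evXU evD evM evB !evC ev_quad mxE eqxx exprMn e2 mul1r.
      rewrite sqr_sqrtr ?(ltW r0) // (independent_square w'E) => /eqP.
      rewrite -subr_eq0 opprD addNKr oppr_eq0 mulf_eq0 invr_eq0 (negbTE D0).
      by rewrite orbF subr_eq0 => /eqP.
    have := pS _ Qw'; rewrite pE !evD !evM evB evC evXU ev_quad Qw'.
    by rewrite subrr mul0r addr0 mxE eqxx -(ia0 _ _ w'E) -(ia1 _ _ w'E).
  have E1 := eqn (-1) (etrans (sqrrN 1) (expr1n _ _)); rewrite mulN1r in E1.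
  have E2 := eqn 1 (expr1n _ _); rewrite mul1r in E2.
  have a00 : ev w a0 = 0 by lra.
  split=> //; move: E2; rewrite a00 add0r => /eqP.
  by rewrite mulf_eq0 (negbTE s0) => /eqP.
have a00 : a0 = 0.
  by apply: (@mpoly_vanish_near _ _ v); apply: filterS r_gt0 => w /vanish [].
have a10 : a1 = 0.
  by apply: (@mpoly_vanish_near _ _ v); apply: filterS r_gt0 => w /vanish [].
by exists q; rewrite pE a00 a10 mulr0 !add0r.
Qed.

End Diagonal.

(** In diagonal coordinates at least one coordinate of the given nonzero point
    does not vanish, so that the polynomial is a multiple of [Q - c]; being
    harmonic, it is zero. *)
Lemma harmonic_vanish_on_surface (B : 'M[R]_3) (c : R) p :
  B^T = B -> B \in unitmx -> genuine_surface B c ->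
  lap (invmx B) p = 0 -> (forall w, qform B w = c -> ev w p = 0) -> p = 0.
Proof.
move=> Bsym Binv [v [v0 Qv]] Dp pS.
have [P [D [Pu PD]]] := symmetric_diagonalization Bsym.
have D0 := diagonal_neq0 Binv Pu PD.
have QD w : qform (diag_mx D) w = qform B (w *m P).
  by rewrite /qform -PD trmx_mul !mulmxA.
pose v' := v *m invmx P.
have v'P : v' *m P = v by rewrite mulmxKV.
have [i vi] : exists i, v' 0 i != 0.
  apply: contrapT => H; case/eqP: v0; rewrite -v'P (_ : v' = 0) ?mul0mx //.
  by apply/rowP => i; rewrite [RHS]mxE; apply/eqP; apply: contrapT => /negP vi;
    apply: H; exists i.
have [|w Qw|q qE] := @vanish_on_diagonal_surface D c i (D0 i) (subst P p) v' vi.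
- by rewrite QD v'P.
- by rewrite ev_subst pS // -QD.
have Ds : (diag_mx D)^T = diag_mx D by rewrite tr_diag_mx.
have Du : diag_mx D \in unitmx by rewrite -PD !unitmx_mul unitmx_tr Pu Binv.
have q0 : q = 0.
  apply: (harmonic_quad_multiple Ds Du (c := c)); rewrite -qE lap_subst.
  rewrite (_ : P^T *m invmx (diag_mx D) *m P = invmx B) ?Dp ?rmorph0 //.
  rewrite -PD; apply: (can_inj (mulKmx Binv)); rewrite mulmxV //.
  have PTu : P^T \in unitmx by rewrite unitmx_tr.
  apply: (can_inj (mulKmx Pu)).
  rewrite mulmx1 !mulmxA mulmxV ?mul1mx // !unitmx_mul Pu Binv PTu //.
by rewrite -(substK Pu p) qE q0 mulr0 rmorph0.
Qed.

End LevelSurface.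

(** * Factorization of polynomials invariant under the antipodal map *)

Local Close Scope complex_scope.

Section Factorization.
Variable K : numClosedFieldType.
Implicit Types (f g r : {poly K}) (t z : K).

(** Zeros are grouped in pairs in any way; a factor may have degree less than 2
    when [f] has zeros at infinity as a form of degree [2 m + 2]. *)
Lemma quadratic_factors m f : (size f <= m.*2.+3)%N ->
  exists fs : m.+1.-tuple {poly K},
    (forall j, (size (tnth fs j) <= 3)%N) /\ f = \prod_j tnth fs j.
Proof.
elim: m f => [|m IHm] f sf.
  exists [tuple f]; split; first by move=> j; rewrite ord1.
  by rewrite big_ord1.
suff [g [h [sg sh fE]]] : exists g h : {poly K},
    [/\ (size g <= 3)%N, (size h <= m.*2.+3)%N & f = g * h].
  have [fs [sfs hE]] := IHm h sh.
  exists [tuple of g :: fs]; split.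
    by move=> j; case: (unliftP ord0 j) => [i ->|->]; rewrite ?tnthS ?tnth0.
  rewrite big_ord_recl tnth0 fE hE; congr (_ * _).
  by apply: eq_bigr => i _; rewrite tnthS.
have step (h : {poly K}) : (1 < size h)%N ->
    exists z (h' : {poly K}), h = ('X - z%:P) * h' /\ size h' = (size h).-1.
  move=> sh; have /closed_rootP [r /factor_theorem [h' hE]] : size h != 1%N by lia.
  exists r, h'; rewrite mulrC; split=> //.
  have h'0 : h' != 0.
    by apply: contraTneq sh => h'0; rewrite hE h'0 mul0r size_poly0.
  by rewrite hE size_mul ?polyXsubC_eq0 // size_XsubC addn2.
have [small|large] := leqP (size f) m.*2.+3.
  by exists 1, f; rewrite size_poly1 mul1r.
have [r [f1 [fE sf1]]] : exists z (h' : {poly K}), f = ('X - z%:P) * h' /\ size h' = (size f).-1.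
  by apply: step; lia.
have [small|large1] := leqP (size f1) m.*2.+3.
  by exists ('X - r%:P), f1; rewrite size_XsubC.
have [r' [f2 [f1E sf2]]] : exists z (h' : {poly K}), f1 = ('X - z%:P) * h' /\ size h' = (size f1).-1.
  by apply: step; lia.
exists (('X - r%:P) * ('X - r'%:P)), f2; split; last by rewrite fE f1E mulrA.
  by rewrite size_mul ?polyXsubC_eq0 // !size_XsubC.
by rewrite sf2 sf1; lia.
Qed.

Lemma poly_vanish f : (forall n : nat, f.[n.+1%:R] = 0) -> f = 0.
Proof.
move=> f0; apply/eqP; apply: contraT => fN0.
pose rs := [seq n.+1%:R : K | n <- iota 0 (size f)].
have : (size rs < size f)%N.
  apply: max_poly_roots fN0 _ _.
    by apply/allP => x /mapP [n _ ->]; apply/rootP.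
  rewrite map_inj_uniq ?iota_uniq // => a b /eqP.
  by rewrite eqr_nat eqSS => /eqP.
by rewrite size_map size_iota ltnn.
Qed.

Local Notation "f ^J" := (map_poly Num.conj f) (at level 2, format "f ^J").

(** [antipodal m f] says that [f], seen as a binary form of degree [2 m], is
    real for the quaternionic structure of the projective line, whose map on
    points is [z |-> - 1 / z^*]. *)
Definition antipodal m f := (size f <= m.*2.+1)%N /\
  forall i, (i <= m.*2)%N -> (f`_i)^* = (-1) ^+ (m + i) * f`_(m.*2 - i).

Definition antipodal_at m f t := f^J.[t] = (-1) ^+ m * t ^+ m.*2 * f.[- t^-1].

Let sign_rev m i : (i <= m.*2)%N ->
  (-1) ^+ (m + (m.*2 - i)) = (-1) ^+ m * (-1) ^+ i :> K.
Proof.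
move=> im; rewrite exprD; congr (_ * _).
by rewrite -signr_odd oddB // odd_double signr_odd.
Qed.

(** The pointwise form of the condition is multiplicative, and may be checked
    away from the zeros of an auxiliary polynomial. *)
Lemma antipodalP m f : (size f <= m.*2.+1)%N ->
  antipodal m f <->
  exists2 r, r != 0 & forall t, t != 0 -> r.[t] != 0 -> antipodal_at m f t.
Proof.
move=> sf; pose g := \poly_(i < m.*2.+1) ((-1) ^+ (m + i) * f`_(m.*2 - i)).
have gE t : t != 0 -> g.[t] = (-1) ^+ m * t ^+ m.*2 * f.[- t^-1].
  move=> t0; rewrite horner_poly (horner_coef_wide _ sf) mulr_sumr.
  rewrite (reindex_inj rev_ord_inj) /=; apply: eq_bigr => i _.
  have im : (i <= m.*2)%N by rewrite -ltnS.
  rewrite subSS subKn // (exprNn t^-1) exprVn sign_rev //.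
  by rewrite expfB_cond ?(negbTE t0) //; ring.
have gP : f^J = g <-> antipodal m f.
  split=> [fg|[_ fP]].
    by split=> // i im; have /(congr1 (coefp i)) := fg;
      rewrite /= coef_map coef_poly ltnS im.
  apply/polyP => i; rewrite coef_map coef_poly ltnS.
  case: leqP => [/fP //|im]; rewrite nth_default ?raddf0 //.
  exact: leq_trans sf im.
split=> [/gP fg|[r r0 fr]].
  by exists 1; [exact: oner_neq0|move=> t t0 _; rewrite /antipodal_at fg gE].
apply/gP/eqP; rewrite -subr_eq0; apply/eqP.
suff /eqP : (f^J - g) * r = 0 by rewrite mulf_eq0 (negbTE r0) orbF => /eqP.
apply: poly_vanish => n; rewrite hornerM.
have [->|rn] := eqVneq r.[n.+1%:R] 0; first by rewrite mulr0.
have n0 : n.+1%:R != 0 :> K by rewrite pnatr_eq0.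
by rewrite hornerD hornerN gE // (fr _ n0 rn) subrr mul0r.
Qed.

Lemma antipodal_atE m f t : antipodal m f -> t != 0 -> antipodal_at m f t.
Proof.
move=> [sf fP] t0; rewrite /antipodal_at (horner_coef_wide _ sf) mulr_sumr.
rewrite (@horner_coef_wide _ m.*2.+1); last first.
  by rewrite (leq_trans (size_poly _ _)).
rewrite (reindex_inj rev_ord_inj) /=; apply: eq_bigr => i _.
have im : (i <= m.*2)%N by rewrite -ltnS.
rewrite coef_map /= subSS fP ?leq_subr // subKn // sign_rev //.
by rewrite (exprNn t^-1) exprVn expfB_cond ?(negbTE t0) //; ring.
Qed.

Lemma antipodalM m n f g :
  antipodal m f -> antipodal n g -> antipodal (m + n) (f * g).
Proof.
move=> fP gP; apply/antipodalP.
  by move: fP.1 gP.1 (size_polyMleq f g); rewrite doubleD; lia.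
exists 1; [exact: oner_neq0|move=> t t0 _].
rewrite /antipodal_at rmorphM !hornerM (antipodal_atE fP t0) (antipodal_atE gP t0).
by rewrite doubleD !exprD; ring.
Qed.

Lemma antipodalD m f g : antipodal m f -> antipodal m g -> antipodal m (f + g).
Proof.
move=> [sf fP] [sg gP]; split=> [|i im].
  by rewrite (leq_trans (size_polyD _ _)) // geq_max sf.
by rewrite !coefD rmorphD /= fP // gP // mulrDr.
Qed.

Lemma antipodalZ m c f :
  c \is Num.real -> antipodal m f -> antipodal m (c *: f).
Proof.
move=> /CrealP cr [sf fP]; split=> [|i im].
  by rewrite (leq_trans (size_scale_leq _ _)).
by rewrite !coefZ rmorphM /= fP // cr; ring.
Qed.

Lemma antipodal0 m : antipodal m 0.
Proof.
split=> [|i im]; first by rewrite size_poly0.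
by rewrite !coef0 rmorph0 mulr0.
Qed.

Lemma antipodal0P f :
  antipodal 0 f <-> exists2 c, c \is Num.real & f = c%:P.
Proof.
split=> [[sf fP]|[c /CrealP cr ->]].
  exists f`_0; last exact: size1_polyC.
  by apply/CrealP; rewrite fP // mul1r.
by split=> [|i]; rewrite ?size_polyC_leq1 // leqn0 => /eqP ->; rewrite coefC mul1r.
Qed.

(** The real quadratic form whose zeros are [z] and its antipode. *)
Definition antipodal_pair z : {poly K} := ('X - z%:P) * (1 + z^* *: 'X).

Lemma antipodal_pair_antipodal z : antipodal 1 (antipodal_pair z).
Proof.
apply/antipodalP.
  have : (size (1 + z^* *: 'X)%R <= 2)%N.
    rewrite (leq_trans (size_polyD _ _)) // size_poly1 geq_max /=.
    by rewrite (leq_trans (size_scale_leq _ _)) // size_polyX.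
  move=> s2; apply: leq_trans (size_polyMleq _ _) _; rewrite size_XsubC.
  by move: s2; move: (size _) => k; lia.
exists 1; [exact: oner_neq0|move=> t t0 _].
rewrite /antipodal_at.
have -> : (antipodal_pair z)^J = ('X - (z^*)%:P) * (1 + z *: 'X).
  rewrite rmorphM rmorphB rmorphD rmorph1 /= map_polyC map_polyZ !map_polyX /=.
  by rewrite conjCK.
by rewrite /antipodal_pair !hornerE /= expr1; field.
Qed.

Lemma antipode_neq z : 1 + z * z^* != 0.
Proof. by rewrite -normCK gt_eqF // ltr_wpDr ?exprn_ge0. Qed.

Lemma antipodal_pair_neq0 z : antipodal_pair z != 0.
Proof.
rewrite mulf_neq0 ?polyXsubC_eq0 //.
apply: contraNneq (antipode_neq z) => /(congr1 (fun p => p.[z])).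
by rewrite !hornerE mulrC => ->.
Qed.

(** The antipode of a zero is again a zero, and it is a different point because
    [- 1 / z^* = z] would give [z z^* = - 1]. For [z = 0] the antipode is at
    infinity, and the second zero shows in a drop of the degree. *)
Lemma antipodal_divide m f z : antipodal m.+1 f -> root f z ->
  exists2 g, antipodal m g & f = antipodal_pair z * g.
Proof.
move=> fP fz.
suff [g [sg fE]] : exists g : {poly K},
    (size g <= m.*2.+1)%N /\ f = antipodal_pair z * g.
  exists g => //; apply/antipodalP => //.
  exists ((antipodal_pair z)^J).
    by rewrite map_poly_eq0; exact: antipodal_pair_neq0.
  move=> t t0 qt; apply: (mulfI qt); rewrite /antipodal_at.
  have := antipodal_atE fP t0; rewrite /antipodal_at fE rmorphM 2!hornerM => ->.
  have := antipodal_atE (antipodal_pair_antipodal z) t0.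
  by rewrite /antipodal_at => ->; rewrite doubleS !exprS /=; ring.
have [sf fc] := fP.
have /factor_theorem [g gE] := fz.
have [f0|f0] := eqVneq f 0.
  by exists 0; rewrite size_poly0 mulr0.
have g0 : g != 0 by apply: contraNneq f0 => g0; rewrite gE g0 mul0r.
have sgE : size f = (size g).+1.
  by rewrite gE size_mul ?polyXsubC_eq0 // size_XsubC addn2.
have [z0|z0] := eqVneq z 0.
  exists g; split.
    have f2m : f`_(m.+1).*2 = 0.
      have := fc _ (leqnn _); rewrite subnn -horner_coef0.
      move: fz; rewrite z0 => /rootP ->; rewrite mulr0.
      by move/eqP; rewrite fmorph_eq0 => /eqP.
    suff : (size f <= (m.+1).*2)%N by rewrite sgE doubleS.
    by apply/leq_sizeP => j; rewrite leq_eqVlt => /orP [/eqP <- //|jm];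
      rewrite nth_default // (leq_trans sf).
  by rewrite gE /antipodal_pair z0 /= conjC0 scale0r addr0 mulr1 mulrC.
have z'0 : z^* != 0 by rewrite fmorph_eq0.
have : root f (- (z^*)^-1).
  have := antipodal_atE fP z'0; rewrite /antipodal_at horner_map /=.
  move/rootP: fz => ->; rewrite rmorph0 => /esym/eqP.
  rewrite mulf_eq0 (negbTE (mulf_neq0 _ _)) //; last exact: expf_neq0.
  by rewrite expf_neq0 // oppr_eq0 oner_eq0.
rewrite gE rootM root_XsubC => /orP[|/eqP E]; last first.
  case/eqP: (antipode_neq z); rewrite -{1}E.
  by rewrite mulNr mulVf // addrN.
move=> /factor_theorem [h hE]; exists ((z^*)^-1 *: h); split.
  have h0 : h != 0 by apply: contraNneq g0 => h0; rewrite hE h0 mul0r.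
  rewrite (leq_trans (size_scale_leq _ _)) //.
  have : size g = (size h).+1.
    by rewrite hE size_mul ?polyXsubC_eq0 // size_XsubC addn2.
  by move=> sgh; move: sf; rewrite sgE sgh doubleS !ltnS.
rewrite hE /antipodal_pair -!mul_polyC polyCN opprK.
have -> : 1 + (z^*)%:P * 'X = (z^*)%:P * ('X + (z^*)^-1%:P).
  by rewrite mulrDr -polyCM mulfV // addrC.
transitivity (('X - z%:P) * ('X + (z^*)^-1%:P) * h * ((z^*)%:P * (z^*)^-1%:P)).
  by rewrite -polyCM mulfV // mulr1; ring.
ring.
Qed.

(** A form with no finite zero has all its zeros at infinity, hence also their
    antipode [0]. *)
Lemma antipodal_root m f : antipodal m.+1 f -> exists z, root f z.
Proof.
move=> [sf fP]; apply/closed_rootP; apply/eqP => sf1.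
have := fP 0%N isT; rewrite subn0 (nth_default _ (n := (m.+1).*2)) ?sf1 // mulr0.
move/eqP; rewrite fmorph_eq0 => /eqP f0.
by have := size1_polyC (eq_leq sf1); move=> fE; move: sf1; rewrite fE f0 size_poly0.
Qed.

Lemma antipodal_factors m f : antipodal m.+1 f ->
  exists fs : m.+1.-tuple {poly K},
    (forall j, antipodal 1 (tnth fs j)) /\ f = \prod_j tnth fs j.
Proof.
elim: m f => [|m IHm] f fP.
  exists [tuple f]; split; first by move=> j; rewrite ord1.
  by rewrite big_ord1.
have [z fz] := antipodal_root fP.
have [g gP fE] := antipodal_divide fP fz.
have [gs [gsP gE]] := IHm g gP.
exists [tuple of antipodal_pair z :: gs]; split.
  move=> j; case: (unliftP ord0 j) => [i ->|->]; rewrite ?tnthS ?tnth0 //.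
  exact: antipodal_pair_antipodal.
rewrite big_ord_recl tnth0 fE gE; congr (_ * _).
by apply: eq_bigr => i _; rewrite tnthS.
Qed.

(** With a common zero the two forms share its antipode, and these two zeros
    leave only a constant factor, which is real by [antipodal0P]. *)
Lemma antipodal_proportional f g z : antipodal 1 f -> antipodal 1 g ->
  f != 0 -> root f z -> root g z -> exists2 c, c \is Num.real & g = c *: f.
Proof.
move=> fP gP f0 fz gz.
have [f1 /antipodal0P [a ar ->] fE] := antipodal_divide fP fz.
have [g1 /antipodal0P [b br ->] gE] := antipodal_divide gP gz.
have a0 : a != 0.
  by apply: contraNneq f0 => a0; rewrite fE a0 mulr0.
exists (b / a); first by rewrite rpred_div.
by rewrite fE gE -mul_polyC mulrCA -polyCM divfK.
Qed.

End Factorization.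

Local Open Scope complex_scope.

(** * The rational parametrization of the null cone *)

Local Close Scope complex_scope.

Section ModelCone.
Variable K : numFieldType.
Implicit Types (p q : mpoly 3 K) (f g : {poly K}).

Local Notation "''X_' i" := (mpolyX K (mnm1 i)) : ring_scope.
Local Notation i0 := (0%R : 'I_3).
Local Notation i1 := (1%R : 'I_3).
Local Notation i2 := (2%:R%R : 'I_3).
Local Notation x0 := (mpolyX K (mnm1 i0)).
Local Notation x1 := (mpolyX K (mnm1 i1)).
Local Notation x2 := (mpolyX K (mnm1 i2)).

(** Restriction to the curve [(1, t, t^2)] of the cone [y^2 = x z]. *)
Definition conic p : {poly K} := mmap (@polyC K) (fun j : 'I_3 => 'X^j) p.

HB.instance Definition _ := GRing.RMorphism.copy conic
  (mmap (@polyC K) (fun j : 'I_3 => 'X^j)).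

Lemma conicD p q : conic (p + q) = conic p + conic q.
Proof. exact: rmorphD. Qed.

Lemma conicZ c p : conic (c *: p) = c *: conic p.
Proof. by rewrite /conic mmapZ mul_polyC. Qed.

Lemma conicXU j : conic 'X_j = 'X^j.
Proof. by rewrite /conic mmapX mmap1U. Qed.

Lemma conicX (k : multinom 3) : conic (mpolyX K k) = 'X^(k i1 + (k i2).*2).
Proof.
rewrite /conic mmapX /mmap1 prod3E /= expr0 expr1n mul1r expr1.
by rewrite -exprM -exprD mul2n.
Qed.

(** The normal form of degree [m] restricting to [t^e]. *)
Definition conic_monomial m e : mpoly 3 K :=
  x0 ^+ (m - uphalf e) * x1 ^+ (odd e) * x2 ^+ e./2.

Definition conic_lift m f : mpoly 3 K :=
  \sum_(e < m.*2.+1) f`_e *: conic_monomial m e.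

Lemma mdeg3 (k : multinom 3) : mdeg k = (k i0 + k i1 + k i2)%N.
Proof.
rewrite mdegE !big_ord_recr big_ord0 /= add0n.
by congr (k _ + k _ + k _)%N; exact: val_inj.
Qed.

Lemma conic_lift_linear m c f g :
  conic_lift m (c *: f + g) = c *: conic_lift m f + conic_lift m g.
Proof.
rewrite /conic_lift scaler_sumr -big_split; apply: eq_bigr => e _ /=.
by rewrite coefD coefZ scalerDl scalerA.
Qed.

Lemma conic_lift_monomial (k : multinom 3) :
  conic_lift (mdeg k) (conic (mpolyX K k)) =
  x0 ^+ (k i0 + (k i1)./2) * x1 ^+ odd (k i1) * x2 ^+ (k i2 + (k i1)./2).
Proof.
rewrite conicX /conic_lift; set e := (k i1 + _)%N.
have em : (e < (mdeg k).*2.+1)%N by rewrite mdeg3 /e; lia.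
rewrite (bigD1 (Ordinal em)) //= big1 ?addr0 => [|i]; last first.
  by rewrite -val_eqE /= coefXn => /negbTE ->; rewrite scale0r.
rewrite coefXn eqxx scale1r /conic_monomial mdeg3 /e.
congr (_ ^+ _ * _ ^+ _ * _ ^+ _); [lia| |lia].
by rewrite oddD odd_double addbF.
Qed.

(** Modulo [y^2 - x z] a form is determined by its restriction to the curve:
    the normal forms [x^i y^j z^k] with [j <= 1] of degree [m] restrict to the
    distinct powers [t^(j + 2 k)]. *)
Lemma conic_lift_reduce m p : p \is ishomog1 m mdeg ->
  exists q, p = conic_lift m (conic p) + (x1 ^+ 2 - x0 * x2) * q.
Proof.
move=> hp; rewrite (mpolyE p).
have : all (fun k => mdeg k == m) (msupp p) by rewrite -dhomogE.
elim: (msupp p) => [|k s IHs] /=.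
  exists 0; rewrite big_nil rmorph0 mulr0 addr0 /conic_lift big1 // => e _.
  by rewrite coef0 scale0r.
case/andP=> /eqP km /IHs [q sE]; rewrite big_cons conicD conicZ.
rewrite conic_lift_linear -{1}km conic_lift_monomial.
pose r := x0 ^+ k i0 * x1 ^+ odd (k i1) * x2 ^+ k i2 *
  \sum_(i < (k i1)./2) (x1 ^+ 2) ^+ ((k i1)./2.-1 - i) * (x0 * x2) ^+ i.
exists (mcoeff k p *: r + q).
have kE : mpolyX K k =
    x0 ^+ (k i0 + (k i1)./2) * x1 ^+ odd (k i1) * x2 ^+ (k i2 + (k i1)./2) +
    (x1 ^+ 2 - x0 * x2) * r.
  rewrite [(_ - _) * r]mulrCA -subrXX mpolyXE_id prod3E.
  rewrite -{1}[k i1]odd_double_half -mul2n exprD exprM [(x0 * x2) ^+ _]exprMn.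
  by rewrite !exprD; ring.
rewrite {1}sE {1}kE -!mul_mpolyC; ring.
Qed.

Lemma conic_inj m p : p \is ishomog1 m mdeg -> conic p = 0 ->
  exists q, p = (x1 ^+ 2 - x0 * x2) * q.
Proof.
move=> /conic_lift_reduce [q pE] p0; exists q; rewrite {1}pE p0.
rewrite /conic_lift big1 ?add0r // => e _.
by rewrite coef0 scale0r.
Qed.

Lemma size_conic m p : p \is ishomog1 m mdeg -> (size (conic p) <= m.*2.+1)%N.
Proof.
move=> hp; rewrite (mpolyE p).
have : all (fun k => mdeg k == m) (msupp p) by rewrite -dhomogE.
elim: (msupp p) => [|k s IHs] /=; first by rewrite big_nil rmorph0 size_poly0.
case/andP=> /eqP km /IHs ss; rewrite big_cons conicD conicZ.
rewrite (leq_trans (size_polyD _ _)) // geq_max ss andbT.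
rewrite (leq_trans (size_scale_leq _ _)) // conicX size_polyXn -km mdeg3; lia.
Qed.

End ModelCone.

Section Cone.
Variable K : numClosedFieldType.
Implicit Types (p q h : mpoly 3 K) (f g : {poly K}) (u x : 'rV[K]_3).

Local Notation "''X_' i" := (mpolyX K (mnm1 i)) : ring_scope.

Local Notation i0 := (0%R : 'I_3).
Local Notation i1 := (1%R : 'I_3).
Local Notation i2 := (2%:R%R : 'I_3).
Local Notation hI := (- 'i / 2 : K).

(** Rows of coefficients of the isotropic curve
    [((1 - t^2) / 2, (1 + t^2) / (2 i), t)]. *)
Definition isotropic_mx : 'M[K]_3 :=
  \matrix_(j, i) nth 0 (nth [::] [:: [:: 2^-1; hI; 0]; [:: 0; 0; 1];
    [:: - 2^-1; hI; 0]] j) i.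

(** The matrix of [y^2 - x z]. *)
Definition conic_form : 'M[K]_3 :=
  \matrix_(j, i) nth 0 (nth [::] [:: [:: 0; 0; - 2^-1]; [:: 0; 1; 0];
    [:: - 2^-1; 0; 0]] j) i.

Let hI2 : hI * hI = - (2^-1 * 2^-1).
Proof. by rewrite mulrACA mulrNN -expr2 sqrCi mulN1r. Qed.

Lemma isotropic_mxE : isotropic_mx *m isotropic_mx^T = conic_form.
Proof.
apply/matrixP => j k; rewrite !mxE sum3E !mxE.
by case: j => [[|[|[|//]]] ?]; case: k => [[|[|[|//]]] ?] /=; rewrite ?hI2; field.
Qed.

Lemma isotropic_mx_unit : isotropic_mx \in unitmx.
Proof.
pose N : 'M[K]_3 := \matrix_(j, i) nth 0 (nth [::] [:: [:: 0; 0; - 2];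
  [:: 0; 1; 0]; [:: - 2; 0; 0]] j) i.
suff E : conic_form *m N = 1%:M.
  by apply: (proj1 (mulmx1_unit (B := isotropic_mx^T *m N) _));
    rewrite mulmxA isotropic_mxE.
apply/matrixP => j k; rewrite !mxE sum3E !mxE.
by case: j => [[|[|[|//]]] ?]; case: k => [[|[|[|//]]] ?] /=; field.
Qed.

Lemma quad_conic_form : quad conic_form = 'X_i1 ^+ 2 - 'X_i0 * 'X_i2.
Proof.
rewrite /quad !sum3E !mxE /= !scale0r !add0r !addr0 scale1r.
rewrite ['X_i2 * _]mulrC [LHS]addrAC -scalerDl [LHS]addrC expr2.
by rewrite (_ : - 2^-1 - 2^-1 = -1) ?scaleN1r //; field.
Qed.

Lemma conic_linform x : conic (linform x) = \sum_j x 0 j *: 'X^j.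
Proof.
by rewrite /linform rmorph_sum; apply: eq_bigr => j _; rewrite /= conicZ conicXU.
Qed.

Lemma coef_conic_linform x (j : 'I_3) : (conic (linform x))`_j = x 0 j.
Proof.
rewrite conic_linform coef_sum (bigD1 j) //= coefZ coefXn eqxx mulr1.
rewrite big1 ?addr0 // => i ij.
rewrite coefZ coefXn (_ : (j == i :> nat) = false) ?mulr0 //.
by apply/negbTE; rewrite eq_sym.
Qed.

Lemma conic_linform_surj f : (size f <= 3)%N ->
  f = conic (linform (\row_j f`_j)).
Proof.
move=> sf; apply/polyP => k; have [k3|k3] := ltnP k 3.
  by rewrite (coef_conic_linform _ (Ordinal k3)) mxE.
rewrite !nth_default //; last exact: leq_trans sf k3.
exact: leq_trans (size_conic (homog_linform _)) k3.
Qed.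

Section Restriction.
Variables (B A : 'M[K]_3).
Hypotheses (Au : A \in unitmx) (BE : B = A *m A^T).

Let G := isotropic_mx *m invmx A.

Let Bsym : B^T = B. Proof. by rewrite BE trmx_mul trmxK. Qed.
Let Binv : B \in unitmx.
Proof. by rewrite BE unitmx_mul unitmx_tr Au. Qed.
Let Gu : G \in unitmx.
Proof. by rewrite unitmx_mul unitmx_inv Au isotropic_mx_unit. Qed.
Let AtK : A^T *m (invmx A)^T = 1%:M.
Proof. by rewrite -trmx_mul mulVmx // trmx1. Qed.

(** Restriction of polynomials to a parametrization of the null cone of the
    quadratic form, as polynomials in the parameter. *)
Definition cone_restr p : {poly K} := conic (subst G p).

HB.instance Definition _ := GRing.RMorphism.copy cone_restr
  (@conic K \o subst G).

Lemma cone_restrM p q : cone_restr (p * q) = cone_restr p * cone_restr q.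
Proof. exact: rmorphM. Qed.

Lemma cone_restrD p q : cone_restr (p + q) = cone_restr p + cone_restr q.
Proof. exact: rmorphD. Qed.

Lemma cone_restrB p q : cone_restr (p - q) = cone_restr p - cone_restr q.
Proof. exact: rmorphB. Qed.

Lemma cone_restrZ c p : cone_restr (c *: p) = c *: cone_restr p.
Proof. by rewrite /cone_restr substZ conicZ. Qed.

Lemma subst_quad_cone : subst G (quad B) = quad conic_form.
Proof.
rewrite subst_quad; congr quad; rewrite -isotropic_mxE /G BE trmx_mul !mulmxA.
by rewrite mulmxKV // -(mulmxA _ A^T) AtK mulmx1.
Qed.

Lemma cone_restr_quad : cone_restr (quad B) = 0.
Proof.
rewrite /cone_restr subst_quad_cone quad_conic_form rmorphB /= rmorphXn /=.
by rewrite rmorphM /= !conicXU -exprM -exprD subrr.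
Qed.

Lemma cone_restr_linform w :
  cone_restr (linform w) = conic (linform (w *m (invmx A)^T *m isotropic_mx^T)).
Proof.
rewrite /cone_restr; congr conic; rewrite /linform rmorph_sum /=.
under eq_bigr => i _ do rewrite substZ substXU scaler_sumr.
rewrite exchange_big; apply: eq_bigr => j _ /=.
rewrite -mulmxA -trmx_mul mxE scaler_suml; apply: eq_bigr => i _.
by rewrite scalerA [_^T i j]mxE.
Qed.

Lemma cone_restr_pole u : cone_restr (linform (u *m B)) =
  conic (linform (u *m A *m isotropic_mx^T)).
Proof. by rewrite cone_restr_linform BE !mulmxA -(mulmxA _ A^T) AtK mulmx1. Qed.

(** A form vanishing on the cone is a multiple of [Q], and no nonzero multiple
    of [Q] is harmonic. *)
Lemma cone_restr_harmonic_inj m p q :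
  p \is ishomog1 m mdeg -> q \is ishomog1 m mdeg ->
  lap (invmx B) p = 0 -> lap (invmx B) q = 0 ->
  cone_restr p = cone_restr q -> p = q.
Proof.
move=> hp hq Dp Dq pq; apply/eqP; rewrite -subr_eq0; apply/eqP.
have hpq : p - q \is ishomog1 m mdeg by rewrite rpredB.
have [|r rE] := conic_inj (homog_subst G hpq).
  by rewrite -/(cone_restr _) cone_restrB pq subrr.
have {rE} pqE : p - q = quad B * subst (invmx G) r.
  by rewrite -[LHS](substK Gu) rE -quad_conic_form -subst_quad_cone substM substK.
have : lap (invmx B) (quad B * subst (invmx G) r) = 0.
  by rewrite -pqE lapB Dp Dq subrr.
rewrite -[quad B]subr0 -(mpolyC0 3 K) => /(harmonic_quad_multiple Bsym Binv) r0.
by rewrite pqE r0 mulr0.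
Qed.

End Restriction.
End Cone.

Local Open Scope complex_scope.

(** * Harmonic polynomials as multipoles *)

Local Close Scope complex_scope.

Section MultipoleHarmonic.
Variable K : numFieldType.
Variable B : 'M[K]_3.
Hypotheses (Bsym : B^T = B) (Binv : B \in unitmx).

Lemma lap_dirderiv C u (p : mpoly 3 K) :
  lap C (dirderiv u p) = dirderiv u (lap C p).
Proof.
rewrite /dirderiv (raddf_sum (lap C)); apply: eq_bigr => i _ /=.
rewrite lapZ; congr (_ *: _); rewrite /lap raddf_sum; apply: eq_bigr => j _ /=.
rewrite raddf_sum; apply: eq_bigr => k _ /=.
by rewrite mderivZ (mderiv_comm i k) (mderiv_comm i j).
Qed.

(** By the commutation relation the Laplacians of the two terms of the
    recursion are both multiples of the derivative of the shorter multipole;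
    the factor [2 n + 1] in the recursion makes them cancel. *)
Lemma lap_multipole us : lap (invmx B) (multipole B us) = 0.
Proof.
have Csym : (invmx B)^T = invmx B by rewrite trmx_inv Bsym.
elim: us => [|u us IHus] /=; first exact/homog0_lap/dhomog1.
have hH := homog_multipole B us.
have lapl : lap (invmx B) (linform (u *m B) * multipole B us) =
    2%:R *: dirderiv u (multipole B us).
  rewrite (lapM _ _ Csym) lap_linform IHus mul0r mulr0 !add0r.
  by rewrite gradform_linform.
rewrite lapB lapZ lapl.
case: (size us) hH => [|m] hH.
  by rewrite (homog0_dirderiv _ hH) mulr0 lap0 !scaler0 subr0.
rewrite (lap_quadM_homog Bsym Binv (homog_dirderiv u hH)) lap_dirderiv IHus.
rewrite /dirderiv [X in _ * X]big1 => [|i _]; last by rewrite mderiv0 scaler0.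
rewrite mulr0 add0r scalerA -natrM; apply/eqP; rewrite subr_eq0; apply/eqP.
by congr (_%:R *: _); lia.
Qed.

End MultipoleHarmonic.

Section IsotropicReality.
Variable K : numClosedFieldType.
Implicit Types (f : {poly K}) (x : 'rV[K]_3).

Local Notation W := (isotropic_mx K).
Local Notation i0 := (0%R : 'I_3).
Local Notation i1 := (1%R : 'I_3).
Local Notation i2 := (2%:R%R : 'I_3).
Local Notation hI := (- 'i / 2 : K).

Lemma isotropic_coefs x : [/\ (x *m W^T) 0 i0 = x 0 i0 / 2 + x 0 i1 * hI,
  (x *m W^T) 0 i1 = x 0 i2 & (x *m W^T) 0 i2 = - (x 0 i0 / 2) + x 0 i1 * hI].
Proof. by split; rewrite mxE sum3E !mxE /= ?mulr0 ?addr0 ?add0r ?mulr1 ?mulrN. Qed.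

(** Conjugation fixes the coordinates of a real vector and changes the sign of
    the entries of the matrix that contain [i]; up to sign, this exchanges the
    outer coefficients of the quadratic polynomial. *)
Lemma antipodal_isotropic x : x \is a mxOver Num.real ->
  antipodal 1 (conic (linform (x *m W^T))).
Proof.
move=> /mxOverP xr; have xJ j : (x 0 j)^* = x 0 j by apply/CrealP/xr.
have hIJ : hI^* = - hI.
  by rewrite rmorphM rmorphN /= conjCi fmorphV rmorph_nat; ring.
have h2J : (2^-1 : K)^* = 2^-1 by rewrite fmorphV rmorph_nat.
have x0J : (x 0 i0 / 2)^* = x 0 i0 / 2 by rewrite rmorphM /= xJ h2J.
have x1J : (x 0 i1 * hI)^* = - (x 0 i1 * hI).
  by rewrite rmorphM /= xJ hIJ mulrN.
have [y0 y1 y2] := isotropic_coefs x.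
split; first exact: size_conic (homog_linform _).
have cE (j : 'I_3) := coef_conic_linform (x *m W^T) j.
case=> [|[|[|//]]] _ /=; rewrite ?(cE i0) ?(cE i1) ?(cE i2) ?y0 ?y1 ?y2.
- by rewrite rmorphD /= x1J x0J; ring.
- by rewrite xJ; ring.
- by rewrite rmorphD rmorphN /= x1J x0J; ring.
Qed.

Lemma antipodal_isotropic_surj f : antipodal 1 f ->
  exists2 x, x \is a mxOver Num.real & conic (linform (x *m W^T)) = f.
Proof.
move=> [sf fP].
have f0J : (f`_0)^* = - f`_2 by rewrite (fP 0%N) // expr1 mulN1r.
have f1J : (f`_1)^* = f`_1 by rewrite (fP 1%N) // -signr_odd expr0 mul1r.
have f2J : (f`_2)^* = - f`_0 by rewrite (fP 2%N) // -signr_odd expr1 mulN1r.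
pose x : 'rV[K]_3 := \row_j [:: f`_0 - f`_2; 'i * (f`_0 + f`_2); f`_1]`_j.
exists x.
  apply/mxOverP => i j; rewrite mxE; apply/CrealP.
  case: j => [[|[|[|//]]] ?] /=; rewrite ?rmorphM ?rmorphD ?rmorphN /= ?conjCi
    ?f0J ?f1J ?f2J //; ring.
rewrite (conic_linform_surj sf); congr (conic (linform _)).
have [y0 y1 y2] := isotropic_coefs x.
have ii : 'i * 'i = -1 :> K by rewrite -expr2 sqrCi.
have iE (z : K) : 'i * z * hI = z / 2 by rewrite mulrAC !mulrA mulrN ii; ring.
apply/rowP => j.
have [->|->|->] : [\/ j = i0, j = i1 | j = i2].
  by case: j => [[|[|[|//]]] ?]; [constructor 1|constructor 2|constructor 3];
    exact: val_inj.
- by rewrite y0 !mxE /= iE; field.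
- by rewrite y1 !mxE.
- by rewrite y2 !mxE /= iE; field.
Qed.

End IsotropicReality.

Section MultipoleCone.
Variable K : numClosedFieldType.
Implicit Types (p q h : mpoly 3 K) (f g : {poly K}) (u x : 'rV[K]_3).
Variables (B A : 'M[K]_3).
Hypotheses (Au : A \in unitmx) (BE : B = A *m A^T).

Let Bsym : B^T = B. Proof. by rewrite BE trmx_mul trmxK. Qed.
Let Binv : B \in unitmx.
Proof. by rewrite BE unitmx_mul unitmx_tr Au. Qed.

(** The restriction to the cone of the linear form [v |-> u B v^T]. *)
Definition pole u : {poly K} := conic (linform (u *m A *m (isotropic_mx K)^T)).

Lemma poleZ c u : pole (c *: u) = c *: pole u.
Proof.
rewrite /pole -!scalemxAl !conic_linform scaler_sumr; apply: eq_bigr => j _.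
by rewrite mxE scalerA.
Qed.

Lemma pole_inj : injective pole.
Proof.
move=> u u' uu'; apply: (can_inj (mulmxK Au)).
have Wu : (isotropic_mx K)^T \in unitmx by rewrite unitmx_tr isotropic_mx_unit.
apply: (can_inj (mulmxK Wu)); apply/rowP => j.
by rewrite -!coef_conic_linform -/(pole u) uu'.
Qed.

Lemma pole0 : pole 0 = 0.
Proof. by rewrite -[0 in LHS](scale0r 0) poleZ scale0r. Qed.

Lemma pole_surj f : (size f <= 3)%N -> exists u, pole u = f.
Proof.
move=> sf; pose x : 'rV[K]_3 := \row_j f`_j.
exists (x *m invmx (isotropic_mx K)^T *m invmx A).
have Wu : (isotropic_mx K)^T \in unitmx by rewrite unitmx_tr isotropic_mx_unit.
by rewrite /pole mulmxKV // mulmxKV // -conic_linform_surj.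
Qed.

Definition multipole_coef n : K := \prod_(k < n) - (k.*2.+1)%:R.

Lemma multipole_coef_neq0 n : multipole_coef n != 0.
Proof. by apply/prodf_neq0 => k _; rewrite oppr_eq0 pnatr_eq0. Qed.

(** On the cone [Q] vanishes, hence only the last term of the recursion for
    multipoles survives. *)
Lemma cone_restr_multipole us : cone_restr A (multipole B us) =
  multipole_coef (size us) *: \prod_(u <- us) pole u.
Proof.
elim: us => [|u us IHus].
  by rewrite /= big_nil /multipole_coef big_ord0 scale1r rmorph1.
rewrite /= cone_restrB cone_restrM cone_restr_quad // mul0r sub0r.
rewrite cone_restrZ cone_restrM (cone_restr_pole Au BE) IHus big_cons.
rewrite /multipole_coef big_ord_recr /= -scalerAr scalerA mulrC mulrN scaleNr.
by rewrite -/(pole u).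
Qed.

(** A harmonic form is determined by its restriction to the cone, and factoring
    this restriction into polynomials of degree at most 2 prescribes the
    vectors. *)
Lemma multipole_exists m h : h \is ishomog1 m.+1 mdeg ->
  lap (invmx B) h = 0 -> exists us : m.+1.-tuple 'rV[K]_3, multipole B us = h.
Proof.
move=> hh Dh; pose f := (multipole_coef m.+1)^-1 *: cone_restr A h.
have sf : (size f <= m.*2.+3)%N.
  rewrite (leq_trans (size_scale_leq _ _)) // -doubleS.
  exact/size_conic/homog_subst.
have [fs [sfs fE]] := quadratic_factors sf.
have [u uE] := choice (fun j => pole_surj (sfs j)).
exists [tuple u j | j < m.+1].
have hu := homog_multipole B [tuple u j | j < m.+1].
rewrite size_tuple in hu.
apply: (cone_restr_harmonic_inj Au BE hu hh _ Dh); first exact: lap_multipole.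
rewrite cone_restr_multipole size_tuple big_tuple.
under eq_bigr => j _ do rewrite tnth_mktuple uE.
by rewrite -fE scalerKV // multipole_coef_neq0.
Qed.

(** * Real multipoles of a positive definite form *)

Hypotheses (Areal : A \is a mxOver Num.real)
  (iAreal : invmx A \is a mxOver Num.real).

Lemma pole_antipodal u : u \is a mxOver Num.real -> antipodal 1 (pole u).
Proof. by move=> ur; apply: antipodal_isotropic; exact: mxOverM. Qed.

Lemma pole_antipodal_surj f : antipodal 1 f ->
  exists2 u, u \is a mxOver Num.real & pole u = f.
Proof.
move=> /antipodal_isotropic_surj [x xr <-]; exists (x *m invmx A).
  exact: mxOverM.
by rewrite /pole mulmxKV.
Qed.

(** Being real is preserved by sums and products, so that it need only be
    checked for the coordinates. *)
Lemma cone_restr_antipodal m h : h \is ishomog1 m mdeg ->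
  (forall k, mcoeff k h \is Num.real) -> antipodal m (cone_restr A h).
Proof.
move=> hh hr; rewrite (mpolyE h).
have : all (fun k => mdeg k == m) (msupp h) by rewrite -dhomogE.
have XP i : antipodal 1 (cone_restr A (mpolyX K (mnm1 i))).
  have -> : mpolyX K (mnm1 i) = linform (delta_mx 0 i).
    rewrite /linform (bigD1 i) //= mxE !eqxx scale1r big1 ?addr0 // => j ji.
    by rewrite mxE (negbTE ji) andbF scale0r.
  rewrite cone_restr_linform; apply: antipodal_isotropic; apply: mxOverM.
    by apply/mxOverP => a b; rewrite mxE; exact: realn.
  by apply/mxOverP => a b; rewrite mxE; exact: (mxOverP iAreal).
elim: (msupp h) => [|k s IHs] /=.
  by rewrite big_nil rmorph0 => _; exact: antipodal0.
case/andP=> /eqP km /IHs sP; rewrite big_cons cone_restrD cone_restrZ.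
apply: antipodalD => //; apply: antipodalZ (hr k) _.
have XnP i n : antipodal n (cone_restr A (mpolyX K (mnm1 i) ^+ n)).
  elim: n => [|n IHn]; last by rewrite exprS cone_restrM; exact: (antipodalM (XP i) IHn).
  by rewrite expr0 rmorph1; apply/antipodal0P; exists 1.
rewrite mpolyXE_id prod3E !cone_restrM -km mdeg3.
by do 2!apply: antipodalM => //.
Qed.

Let multipole_coef_real n : (multipole_coef n)^-1 \is Num.real.
Proof. by rewrite rpredV; apply: rpred_prod => k _; rewrite rpredN realn. Qed.

Lemma real_multipole_exists m h : h \is ishomog1 m.+1 mdeg ->
  lap (invmx B) h = 0 -> (forall k, mcoeff k h \is Num.real) ->
  exists us : m.+1.-tuple 'rV[K]_3,
    (forall j, tnth us j \is a mxOver Num.real) /\ multipole B us = h.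
Proof.
move=> hh Dh hr; pose f := (multipole_coef m.+1)^-1 *: cone_restr A h.
have fP : antipodal m.+1 f.
  by apply: antipodalZ (multipole_coef_real _) _; exact: cone_restr_antipodal.
have [fs [fsP fE]] := antipodal_factors fP.
have ex j : exists v, v \is a mxOver Num.real /\ pole v = tnth fs j.
  by have [v vr vE] := pole_antipodal_surj (fsP j); exists v.
have [u uP] := choice ex.
exists [tuple u j | j < m.+1]; split=> [j|].
  by rewrite tnth_mktuple; exact: (uP j).1.
have hu := homog_multipole B [tuple u j | j < m.+1].
rewrite size_tuple in hu.
apply: (cone_restr_harmonic_inj Au BE hu hh _ Dh); first exact: lap_multipole.
rewrite cone_restr_multipole size_tuple big_tuple.
under eq_bigr => j _ do rewrite tnth_mktuple (uP j).2.
by rewrite -fE scalerKV // multipole_coef_neq0.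
Qed.

(** Unique factorization: a zero of one pole polynomial is a zero of some pole
    polynomial of the other list, and then the two are proportional. *)
Lemma real_poles_unique (us us' : seq 'rV[K]_3) (c : K) :
  size us = size us' ->
  {in us, forall u, u \is a mxOver Num.real /\ u != 0} ->
  {in us', forall u, u \is a mxOver Num.real /\ u != 0} ->
  \prod_(u <- us') pole u = c *: \prod_(u <- us) pole u ->
  exists vs ts, [/\ perm_eq vs us, size ts = size vs,
    {in ts, forall t, t \is Num.real},
    us' = [seq tv.1 *: tv.2 | tv <- zip ts vs] & \prod_(t <- ts) t = c].
Proof.
elim: us' us c => [|u' us' IHus] us c.
  move=> /size0nil -> _ _; rewrite !big_nil -{1}[1]/(1%:P) => E.
  exists [::], [::]; split=> //; rewrite big_nil.
  by move: E; rewrite -mul_polyC mulr1 => /polyC_inj.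
move=> sz usP us'P; rewrite big_cons => E.
have [u'r u'0] := us'P u' (mem_head _ _).
have pole_neq0 u : u != 0 -> pole u != 0.
  by apply: contraNneq => pu0; apply/eqP/pole_inj; rewrite pole0.
have [z zu'] := antipodal_root (pole_antipodal u'r).
have c0 : c != 0.
  apply: contra_eq_neq E => ->; rewrite scale0r mulf_neq0 ?pole_neq0 //.
  rewrite prodf_seq_neq0; apply/allP => v vus /=; apply: pole_neq0.
  by have [] := us'P v (mem_behead (s := u' :: us') vus).
have : root (c *: \prod_(u <- us) pole u) z by rewrite -E rootM zu'.
rewrite rootZ // rootE horner_prod prodf_seq_eq0 => /hasP [u uus /= zu].
have [ur u0] := usP u uus.
have [t tr tE] := antipodal_proportional (pole_antipodal ur)
  (pole_antipodal u'r) (pole_neq0 _ u0) zu zu'.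
have u'E : u' = t *: u by apply: pole_inj; rewrite poleZ.
have t0 : t != 0 by apply: contraNneq u'0 => t0; rewrite u'E t0 scale0r.
have [||||vs [ts [pvs sts tsr us'E cE]]] := IHus (rem u us) (c / t).
- by rewrite size_rem // sz.
- by move=> v /mem_rem /usP.
- by move=> v vus; apply: us'P; rewrite inE vus orbT.
- apply: (mulfI (pole_neq0 _ u'0)); rewrite E.
  rewrite (perm_big _ (perm_to_rem uus)) big_cons tE.
  by rewrite -scalerAr -scalerAl scalerA divfK.
exists (u :: vs), (t :: ts); split=> /=.
- by rewrite (perm_trans _ (_ : perm_eq (u :: rem u us) us)) ?perm_cons //
    perm_sym perm_to_rem.
- by rewrite sts.
- by move=> v; rewrite inE => /orP [/eqP -> //|/tsr].
- by rewrite u'E us'E.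
- by rewrite big_cons cE mulrC divfK.
Qed.

Lemma real_multipole_unique (us us' : seq 'rV[K]_3) : size us = size us' ->
  {in us, forall u, u \is a mxOver Num.real} ->
  {in us', forall u, u \is a mxOver Num.real} ->
  multipole B us = multipole B us' ->
  (0 \in us /\ 0 \in us') \/
  exists vs ts, [/\ perm_eq vs us, size ts = size vs,
    {in ts, forall t, t \is Num.real},
    us' = [seq tv.1 *: tv.2 | tv <- zip ts vs] & \prod_(t <- ts) t = 1].
Proof.
move=> sz usr usr' /(congr1 (cone_restr A)).
rewrite !cone_restr_multipole sz => /(scalerI (multipole_coef_neq0 _)) E.
have prod0 (vs : seq 'rV[K]_3) : (\prod_(u <- vs) pole u == 0) = (0 \in vs).
  rewrite prodf_seq_eq0; apply/hasP/idP => [[v vvs /= /eqP v0]|v0].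
    by rewrite (_ : 0 = v) //; apply: pole_inj; rewrite pole0.
  by exists 0; rewrite //= pole0.
have [us0|us0] := boolP (0 \in us).
  by left; split=> //; rewrite -prod0 -E prod0.
right; apply: real_poles_unique => //; last by rewrite scale1r.
  by move=> v vus; split; [exact: usr|apply: contraNneq us0 => <-].
move=> v vus; split; [exact: usr'|].
by apply: contraNneq us0 => v0; rewrite -prod0 E prod0 -v0.
Qed.

End MultipoleCone.

Local Open Scope complex_scope.

(** * Local branches of the square root *)

(** A section [g] of the squaring map that is Lipschitz near [Q(w0)] gives a
    branch by composition with [Q]. *)
Lemma lipschitz_sqrt_branch (K : numFieldType) (B : 'M[K]_3) w0 (g : K -> K)
    (e r : K) : 0 < e -> 0 < r -> (forall z, g z ^+ 2 = z) ->
  (forall z z', `|z - qform B w0| < e -> `|z' - qform B w0| < e ->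
    `|g z - g z'| * r <= `|z - z'|) ->
  sqrt_branch B w0 (fun w => g (qform B w) : K^o).
Proof.
move=> e0 r0 g2 glip.
have Qc w : qform B w' @[w' --> w] --> (qform B w : K^o).
  have := @continuous_ev _ (quad B) w.
  rewrite (_ : (fun w => ev w (quad B)) = qform B) //.
  by apply/funext => w'; rewrite ev_quad.
have near0 : \forall w \near w0, `|qform B w - qform B w0| < e.
  have /cvgrPdist_lt/(_ _ e0) := Qc w0.
  by apply: filterS => w; rewrite distrC.
have cont (w : 'rV[K]_3) :
    (\forall w' \near w, `|qform B w' - qform B w0| < e) ->
    g (qform B w') @[w' --> w] --> (g (qform B w) : K^o).
  move=> nw; apply/(@cvgrPdist_lt K K^o _ _ (nbhs_filter w)) => d d0.
  have d'0 : 0 < d * r by rewrite mulr_gt0.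
  have /cvgrPdist_lt/(_ _ d'0) nQ := Qc w.
  near=> w'; rewrite -(ltr_pM2r r0).
  apply: le_lt_trans (glip _ _ (nbhs_singleton nw) _) _.
    by near: w'.
  by near: w'.
have := nbhs_interior near0; apply: filterS => w nw.
by split; [exact: cont|exact: g2].
Unshelve. all: by end_near. Qed.

Section Branch.
Variable K : numClosedFieldType.
Implicit Types (w : 'rV[K]_3) (y z : K).

(** Choosing the root by its distance to [y] makes it continuous near
    [y ^+ 2]. *)
Definition near_sqrt y z : K :=
  if `|sqrtC z - y| <= `|sqrtC z + y| then sqrtC z else - sqrtC z.

Lemma near_sqrtK y z : near_sqrt y z ^+ 2 = z.
Proof. by rewrite /near_sqrt; case: ifP => _; rewrite ?sqrrN sqrtCK. Qed.

Lemma near_sqrt_closer y z : `|near_sqrt y z - y| <= `|near_sqrt y z + y|.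
Proof.
rewrite /near_sqrt; case: ifP => //.
case: real_leP; rewrite ?normr_real // => yz _.
by rewrite -opprD normrN [- sqrtC z + y]addrC distrC ltW.
Qed.

(** From [s^2 - y^2 = (s - y) (s + y)] and [|y| <= |s + y|], the latter because
    [s + y] is the longer of the two factors and they differ by [2 y]. *)
Lemma near_sqrt_dist y z : `|near_sqrt y z - y| * `|y| <= `|z - y ^+ 2|.
Proof.
set s := near_sqrt y z; have le : `|s - y| <= `|s + y| := near_sqrt_closer y z.
rewrite -[z](near_sqrtK y) -/s subr_sqr normrM ler_wpM2l //.
have : `|y *+ 2| <= `|s + y| *+ 2.
  rewrite (_ : y *+ 2 = (s + y) - (s - y)); last by ring.
  by rewrite (le_trans (ler_normB _ _)) // mulr2n lerD2l.
by rewrite normrMn lerMn2r.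
Qed.

Lemma near_sqrt_lipschitz y z z' : y != 0 ->
  `|z - y ^+ 2| < `|y| ^+ 2 / 2 -> `|z' - y ^+ 2| < `|y| ^+ 2 / 2 ->
  `|near_sqrt y z - near_sqrt y z'| * `|y| <= `|z - z'|.
Proof.
move=> y0 zy z'y; set s := near_sqrt y z; set s' := near_sqrt y z'.
have ny : 0 < `|y| by rewrite normr_gt0.
have close x : `|x - y ^+ 2| < `|y| ^+ 2 / 2 -> `|near_sqrt y x - y| <= `|y| / 2.
  move=> xy; rewrite -(ler_pM2r ny) (le_trans (near_sqrt_dist y x)) //.
  by rewrite mulrAC -expr2 ltW.
rewrite -[in leRHS](near_sqrtK y z) -[in leRHS](near_sqrtK y z') -/s -/s'.
rewrite subr_sqr normrM ler_wpM2l //.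
have : `|y *+ 2| <= `|s + s'| + (`|y| / 2 + `|y| / 2).
  rewrite (_ : y *+ 2 = (s + s') - ((s - y) + (s' - y))); last by ring.
  rewrite (le_trans (ler_normB _ _)) // lerD2l (le_trans (ler_normD _ _)) //.
  by rewrite lerD ?close.
by rewrite -splitr normrMn mulr2n lerD2r.
Qed.

Lemma sqrt_branch_exists (B : 'M[K]_3) w0 : qform B w0 != 0 ->
  exists s : 'rV[K]_3 -> K^o, sqrt_branch B w0 s.
Proof.
move=> Q0; pose y := sqrtC (qform B w0).
have y0 : y != 0 by rewrite sqrtC_eq0.
have ny : 0 < `|y| by rewrite normr_gt0.
exists (fun w => near_sqrt y (qform B w)).
apply: (@lipschitz_sqrt_branch _ _ _ _ (`|y| ^+ 2 / 2) `|y|) => //.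
- by rewrite divr_gt0 ?exprn_gt0.
- exact: near_sqrtK.
- by move=> z z'; rewrite -(sqrtCK (qform B w0)); exact: near_sqrt_lipschitz.
Qed.

End Branch.

(** * Harmonic representatives on a level surface *)

Lemma parity_components (K : numFieldType) d (p : mpoly 3 K) :
  {in msupp p, forall m, (mdeg m <= d)%N} ->
  {in msupp p, forall m, odd (mdeg m) = odd d} ->
  p = \sum_(j < (d./2).+1) pihomog mdeg (d - j.*2) p.
Proof.
move=> pd po; apply/mpolyP => m; rewrite raddf_sum /=.
have [mp|] := boolP (m \in msupp p); last first.
  rewrite -mcoeff_eq0 => /eqP mp; rewrite mp big1 // => j _.
  by rewrite mcoeff_pihomog mp if_same.
have md := pd m mp; have mo := po m mp.
have jd : ((d - mdeg m)./2 < (d./2).+1)%N by lia.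
rewrite (bigD1 (Ordinal jd)) //= mcoeff_pihomog ifT; last first.
  by apply/eqP; have := odd_double_half (d - mdeg m); rewrite oddB // mo addbb; lia.
rewrite big1 ?addr0 // => j; rewrite -val_eqE /= => /eqP ne.
rewrite mcoeff_pihomog ifF //; apply/negP => /eqP E; apply: ne.
by have := ltn_ord j; lia.
Qed.

Section SurfaceHarmonic.
Variable K : numFieldType.
Variable B : 'M[K]_3.
Hypotheses (Bsym : B^T = B) (Binv : B \in unitmx).
Implicit Types (p q h : mpoly 3 K) (v : 'rV[K]_3) (c : K).

Local Notation Delta := (lap (invmx B)).

Lemma lap_surj q : exists p, Delta p = q.
Proof.
have ex d : exists p, Delta p = pihomog mdeg d q.
  have [p _] := lap_quadM_surj Bsym Binv (lexx 0) (pihomogP mdeg d q).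
  by rewrite scale0r addr0 => <-; exists (quad B * p).
have [f fE] := choice ex.
exists (\sum_(d < msize q) f d).
rewrite raddf_sum [RHS](pihomog_partitionE (leqnn (msize q))).
by apply: eq_bigr => d _; rewrite /= fE.
Qed.

(** On the surface each power of [Q] in the decomposition may be replaced by a
    power of [c]. *)
Lemma harmonic_on_surface c p : exists2 h, Delta h = 0 &
  forall v, qform B v = c -> ev v h = ev v p.
Proof.
have ex d : exists h, Delta h = 0 /\
    forall v, qform B v = c -> ev v h = ev v (pihomog mdeg d p).
  have [h [hP hE]] := harmonic_decomp Bsym Binv (pihomogP mdeg d p).
  exists (\sum_(k < (d./2).+1) c ^+ k *: h k); split.
    rewrite raddf_sum big1 // => k _ /=.
    by rewrite lapZ (hP k _).2 ?scaler0 // -ltnS.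
  move=> v Qv; rewrite hE !ev_sum; apply: eq_bigr => k _.
  by rewrite evZ evM evX ev_quad Qv.
have [f fP] := choice ex.
exists (\sum_(d < msize p) f d).
  by rewrite raddf_sum big1 // => d _ /=; rewrite (fP d).1.
move=> v Qv; rewrite [in RHS](pihomog_partitionE (leqnn (msize p))) !ev_sum.
by apply: eq_bigr => d _; rewrite (fP d).2.
Qed.

(** Multiplying lower components by powers of [Q / c] makes a polynomial
    homogeneous without changing it on the surface [Q = c]. *)
Lemma surface_decomp c d p : c != 0 ->
  {in msupp p, forall m, (mdeg m <= d)%N} ->
  {in msupp p, forall m, odd (mdeg m) = odd d} ->
  exists h : nat -> mpoly 3 K,
    (forall k, (k <= d./2)%N ->
       h k \is ishomog1 (d - k.*2) mdeg /\ Delta (h k) = 0) /\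
    forall v, qform B v = c ->
      ev v p = \sum_(k < (d./2).+1) c ^+ k * ev v (h k).
Proof.
move=> c0 pd po.
pose P := \sum_(j < (d./2).+1) c ^- j *: (quad B ^+ j * pihomog mdeg (d - j.*2) p).
have hP : P \is ishomog1 d mdeg.
  apply: rpred_sum => j _; apply: dhomogZ; have jd := ltn_ord j.
  have := dhomogM (homog_quadX B j) (pihomogP mdeg (d - j.*2) p).
  by rewrite (_ : (j.*2 + _)%N = d) //; lia.
have [h [hh hE]] := harmonic_decomp Bsym Binv hP.
exists h; split=> // v Qv.
transitivity (ev v P).
  rewrite {1}(parity_components pd po) !ev_sum; apply: eq_bigr => j _.
  by rewrite evZ evM evX ev_quad Qv mulKf // expf_neq0.
by rewrite hE ev_sum; apply: eq_bigr => k _; rewrite evM evX ev_quad Qv.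
Qed.

End SurfaceHarmonic.

(** * Maxwell representations *)

Section MaxwellPoly.
Variable K : numFieldType.
Variable B : 'M[K]_3.

(** The polynomial with which a Maxwell sum agrees on the surface [Q = c]: the
    factor [Q^(d - k + 1/2)] cancels the denominator of the derivative up to
    [Q^k]. *)
Definition maxwell_poly (c a : K) d (u : poles K d) : mpoly 3 K :=
  \sum_(k < (d./2).+1)
    (if k.*2 == d then a else 1) *: (c ^+ k *: multipole B (u k)).

Lemma homog_poles d (u : poles K d) k : multipole B (u k) \is ishomog1 (d - k.*2) mdeg.
Proof. by have := homog_multipole B (u k); rewrite size_tuple. Qed.

Lemma maxwell_component c a d (u : poles K d) (k : 'I_(d./2).+1) :
  pihomog mdeg (d - k.*2) (maxwell_poly c a u) =
  (if k.*2 == d then a else 1) *: (c ^+ k *: multipole B (u k)).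
Proof.
rewrite /maxwell_poly raddf_sum (bigD1 k) //= pihomog_dE; last first.
  by do 2!apply: dhomogZ; exact: homog_poles.
rewrite big1 ?addr0 // => j; rewrite -val_eqE /= => jk.
rewrite (pihomog_ne0 (d := (d - j.*2)%N)) //; last by do 2!apply: dhomogZ; exact: homog_poles.
by have := ltn_ord j; have := ltn_ord k; move: jk; lia.
Qed.

Lemma maxwell_component_parity c a d (u : poles K d) e : odd e != odd d ->
  pihomog mdeg e (maxwell_poly c a u) = 0.
Proof.
move=> ed; rewrite /maxwell_poly raddf_sum big1 // => j _ /=.
rewrite (pihomog_ne0 (d := (d - j.*2)%N)) //; last by do 2!apply: dhomogZ; exact: homog_poles.
by have := ltn_ord j; apply: contraTneq => je; rewrite -je in ed; lia.
Qed.

(** A component of degree 0 is a constant, and it is carried by the scalar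
    coefficient instead of a vector. *)
Lemma maxwell_poly_sum c d (u : poles K d) (h : nat -> mpoly 3 K) :
  (forall k, (k <= d./2)%N -> h k \is ishomog1 (d - k.*2) mdeg) ->
  (forall k : 'I_(d./2).+1, (0 < d - k.*2)%N -> multipole B (u k) = h k) ->
  maxwell_poly c (mcoeff mnm0 (h d./2)) u = \sum_(k < (d./2).+1) c ^+ k *: h k.
Proof.
move=> hh hu; apply: eq_bigr => k _; have kd := ltn_ord k.
case: eqP => [kE|kN]; last by rewrite scale1r hu //; lia.
have hE : h d./2 = h k.
  by congr h; have := congr1 half kE; rewrite doubleK.
have hC : h k = mpolyC 3 (mcoeff mnm0 (h d./2)).
  have := hh k; rewrite kE subnn -ltnS => /(_ kd) hk.
  apply/mpolyP => m; rewrite mcoeffC; case: eqVneq => [->|m0].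
    by rewrite mulr1 hE.
  by rewrite mulr0 (dhomog_nemf_coeff hk) ?mdeg_eq0.
have us0 : u k = [::] :> seq _ by apply: size0nil; rewrite size_tuple kE subnn.
by rewrite us0 /= hC -!mul_mpolyC; ring.
Qed.

Hypotheses (Bsym : B^T = B) (Binv : B \in unitmx).

Lemma maxwell_sum_ev d (a : K) (u : poles K d) s w : qform B w != 0 ->
  sqrt_branch B w s ->
  \sum_(k < (d./2).+1) (if k.*2 == d then a else 1) *
    (qform B w ^+ (d - k) * s w * iter_derive (u k) (fun w' => (s w')^-1) w) =
  ev w (maxwell_poly (qform B w) a u).
Proof.
move=> Q0 sb; rewrite /maxwell_poly ev_sum; apply: eq_bigr => k _.
have [s0 ->] := nbhs_singleton (iter_derive_inv_sqrt Bsym (u k) sb Q0).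
have [_ sQ] := nbhs_singleton sb.
have kd : (k.*2 <= d)%N by have := ltn_ord k; lia.
rewrite !evZ size_tuple; congr (_ * _).
have E (x m : K) : x != 0 ->
    (x ^+ 2) ^+ (d - k) * x * (m * x^-1 ^+ (d - k.*2).*2.+1) = (x ^+ 2) ^+ k * m.
  move=> x0; rewrite mulrCA mulrC exprVn; congr (_ * _).
  have -> : (x ^+ 2) ^+ (d - k) * x = (x ^+ 2) ^+ k * x ^+ (d - k.*2).*2.+1.
    by rewrite -!exprM -exprSr -exprD; congr (_ ^+ _); lia.
  by rewrite mulfK // expf_neq0.
by rewrite -sQ; exact: E.
Qed.

Lemma lap_maxwell_poly c a d (u : poles K d) :
  lap (invmx B) (maxwell_poly c a u) = 0.
Proof.
rewrite /maxwell_poly raddf_sum big1 // => k _ /=.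
by rewrite !lapZ lap_multipole // !scaler0.
Qed.

End MaxwellPoly.

Section MapMultipole.
Variables (K L : numFieldType) (f : {rmorphism K -> L}).

Lemma map_multipole (B : 'M[K]_3) us :
  map_mpoly f (multipole B us) = multipole (map_mx f B) (map (map_mx f) us).
Proof.
elim: us => [|u us IHus] /=; first by rewrite rmorph1.
rewrite rmorphB rmorphM /= map_mpolyZ rmorphM /= map_quad map_dirderiv.
by rewrite map_linform map_mxM IHus size_map rmorph_nat.
Qed.

Lemma map_mpoly_inj : injective (map_mpoly f : mpoly 3 K -> mpoly 3 L).
Proof.
move=> p q pq; apply/mpolyP => m; apply: (fmorph_inj f).
by have := congr1 (mcoeff m) pq; rewrite !mcoeff_map_mpoly.
Qed.

End MapMultipole.

Section RealMaxwell.
Variable R : realType.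
Local Notation C := R[i].
Local Notation toC := (real_complex R : {rmorphism R -> C}).
Variable B : 'M[R]_3.
Hypotheses (Bsym : B^T = B) (Binv : B \in unitmx).

Let BC : 'M[C]_3 := map_mx toC B.
Let BCsym : BC^T = BC. Proof. by rewrite /BC map_trmx Bsym. Qed.
Let BCinv : BC \in unitmx. Proof. by rewrite map_unitmx. Qed.

Lemma qform_complex v : qform (mx_complex B) (mx_complex v) = (qform B v)%:C.
Proof. by rewrite -!ev_quad -map_quad ev_map. Qed.

Lemma map_harmonic h : lap (invmx B) h = 0 ->
  lap (invmx (mx_complex B)) (map_mpoly toC h) = 0.
Proof. by move=> Dh; rewrite -map_invmx -map_lap Dh rmorph0. Qed.

Lemma complex_poles_exist m h : h \is ishomog1 m mdeg -> lap (invmx B) h = 0 ->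
  exists u : m.-tuple 'rV[C]_3, (0 < m)%N ->
    multipole (mx_complex B) u = map_mpoly toC h.
Proof.
case: m => [|m] hh Dh; first by exists [tuple].
have [A Au BE] := complex_square_factor Bsym Binv.
have [u uE] := multipole_exists Au BE (map_homog toC hh) (map_harmonic Dh).
by exists u.
Qed.

Section PositiveDefinite.
Hypothesis Bpos : positive_definite B.

Let realC n m (M : 'M[R]_(n, m)) : map_mx toC M \is a mxOver Num.real.
Proof. by apply/mxOverP => i j; rewrite mxE complex_real. Qed.

Let real_row (u : 'rV[C]_3) : u \is a mxOver Num.real ->
  exists v : 'rV[R]_3, mx_complex v = u.
Proof.
move=> /mxOverP ur; exists (map_mx (@complex.Re R) u).
by apply/matrixP => i j; rewrite !mxE RRe_real.
Qed.

Let definite_factor : exists A : 'M[C]_3, [/\ A \in unitmx,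
  mx_complex B = A *m A^T, A \is a mxOver Num.real & invmx A \is a mxOver Num.real].
Proof.
have [A Au BE] := real_square_factor Bsym Binv Bpos.
exists (map_mx toC A); split.
- by rewrite map_unitmx.
- by rewrite map_trmx -map_mxM -BE.
- exact: realC.
- by rewrite -map_invmx; exact: realC.
Qed.

Lemma real_poles_exist m h : h \is ishomog1 m mdeg -> lap (invmx B) h = 0 ->
  exists u : m.-tuple 'rV[R]_3, (0 < m)%N -> multipole B u = h.
Proof.
case: m => [|m] hh Dh; first by exists [tuple].
have [A [Au BE Ar iAr]] := definite_factor.
have hr k : mcoeff k (map_mpoly toC h) \is Num.real.
  by rewrite mcoeff_map_mpoly complex_real.
have [us [usr usE]] := real_multipole_exists Au BE iAr (map_homog toC hh)
  (map_harmonic Dh) hr.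
have [v vE] := choice (fun j => real_row (usr j)).
exists [tuple v j | j < m.+1] => _; apply: (map_mpoly_inj (f := toC)).
rewrite map_multipole -usE; congr multipole.
apply: (@eq_from_nth _ 0); rewrite size_map !size_tuple // => j jm.
rewrite (nth_map 0) ?size_tuple // -[j]/(val (Ordinal jm)) -!tnth_nth.
by rewrite tnth_mktuple; exact: vE.
Qed.

(** The uniqueness statement holds over the complex numbers for real vectors;
    its permutation and scalars are transported back to the real numbers. *)
Lemma equivalent_vectors_multipole m (u u' : m.-tuple 'rV[R]_3) :
  multipole B u = multipole B u' -> equivalent_vectors u u'.
Proof.
move=> /(congr1 (map_mpoly toC)); rewrite !map_multipole => E.
have [A [Au BE Ar iAr]] := definite_factor.
have sz : size (map (map_mx toC) u) = size (map (map_mx toC) u').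
  by rewrite !size_map !size_tuple.
have rl (w : seq 'rV[R]_3) : {in map (map_mx toC) w, forall x, x \is a mxOver Num.real}.
  by move=> x /mapP [y _ ->]; exact: realC.
have inj : injective (map_mx toC : 'rV[R]_3 -> 'rV[C]_3).
  move=> x y xy; apply/matrixP => i j; apply: (fmorph_inj toC).
  by have /matrixP/(_ i j) := xy; rewrite !mxE.
have mem0 (w : seq 'rV[R]_3) : 0 \in map (map_mx toC) w -> 0 \in w.
  by move=> /mapP [y yw /esym/eqP]; rewrite map_mx_eq0 => /eqP <-.
have [[u0 u'0]|[vs [ts [pvs sts tsr u'E tsE]]]] :=
    real_multipole_unique Au BE Ar sz (rl u) (rl u') E.
  by left; split; exact: mem0.
right; have /tuple_permP [sigma vsE] : perm_eq vs (map_tuple (map_mx toC) u) by [].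
have svs : size vs = m by rewrite vsE size_tuple.
pose t (j : 'I_m) := complex.Re (nth 0 ts j).
have tE (j : 'I_m) : (t j)%:C = nth 0 ts j.
  by rewrite RRe_real // tsr // mem_nth // sts svs.
exists sigma, t; split.
  apply: (fmorph_inj toC); rewrite rmorph_prod rmorph1 -[RHS]tsE [RHS](big_nth 0) big_mkord.
  by rewrite sts svs; apply: eq_bigr => j _; rewrite -tE.
move=> j; apply: inj; rewrite map_mxZ /= [toC _]tE.
transitivity (nth 0 (map (map_mx toC) u') j).
  by rewrite (nth_map 0) ?size_tuple // -tnth_nth.
rewrite u'E (nth_map (0, 0)) ?size_zip ?sts ?minnn ?svs // nth_zip ?sts //=.
by rewrite vsE -tnth_nth tnth_mktuple tnth_map.
Qed.

End PositiveDefinite.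
End RealMaxwell.

(** * The orthogonal decomposition *)

Section Main.
Variable R : realType.
Local Notation C := R[i].
Local Notation toC := (real_complex R : {rmorphism R -> C}).
Variable B : 'M[R]_3.
Hypotheses (Bsym : B^T = B) (Binv : B \in unitmx).
Implicit Types (p q P : mpoly 3 R) (c : R).

Lemma harmonic_summandP d k p : harmonic_summand B d k p <->
  exists h, [/\ h \is ishomog1 (d - k.*2) mdeg, lap (invmx B) h = 0 &
    p = quad B ^+ k * h].
Proof.
split=> [[h [Dh hh] <-]|[h [hh Dh ->]]]; first by exists h.
by exists h.
Qed.

Lemma harmonic_direct_sum d : is_direct_sum (homogeneous (R := R) d)
  (fun k : 'I_(d./2).+1 => harmonic_summand B d k).
Proof.
split=> [k|p hp].
  split.
    split.
      by apply/harmonic_summandP; exists 0; rewrite dhomog0 lap0 mulr0.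
    move=> a p q /harmonic_summandP [h [hh Dh ->]] /harmonic_summandP [g [hg Dg ->]].
    apply/harmonic_summandP; exists (a *: h + g); split.
    - by rewrite rpredD // dhomogZ.
    - by rewrite lapD lapZ Dh Dg scaler0 addr0.
    - by rewrite mulrDr scalerAr.
  move=> p /harmonic_summandP [h [hh _ ->]].
  have := dhomogM (homog_quadX B k) hh; have := ltn_ord k.
  by rewrite /homogeneous /= => kd; rewrite (_ : (k.*2 + _)%N = d) //; lia.
have [h [hP pE]] := harmonic_decomp Bsym Binv hp.
exists [ffun k : 'I__ => quad B ^+ k * h k]; split.
  split=> [k|]; last by rewrite pE; apply: eq_bigr => k _; rewrite ffunE.
  rewrite ffunE; apply/harmonic_summandP; exists (h k).
  by have [] := hP k (ltn_ord k); split.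
move=> w [wP wE].
have /choice [g gP] : forall k : 'I_(d./2).+1, exists h,
    [/\ h \is ishomog1 (d - k.*2) mdeg, lap (invmx B) h = 0 &
    w k = quad B ^+ k * h].
  by move=> k; apply/harmonic_summandP.
pose e k := h k - g (inord k).
have e0 := @harmonic_decomp_uniq _ _ Bsym Binv d e.
have eP k : (k <= d./2)%N -> e k = 0.
  apply: e0 => [j jd|].
    have [hh Dh] := hP j jd; have [hg Dg _] := gP (inord j).
    rewrite inordK // in hg; split; first by rewrite rpredB.
    by rewrite lapB Dh Dg subrr.
  under eq_bigr => j _ do rewrite mulrBr.
  rewrite sumrB -pE wE -sumrB big1 // => j _; rewrite inord_val.
  by have [_ _ ->] := gP j; rewrite subrr.
apply/ffunP => k; rewrite ffunE; have [_ _ ->] := gP k; congr (_ * _).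
apply/eqP; rewrite -subr_eq0; apply/eqP.
by have := eP k (ltn_ord k); rewrite /e inord_val.
Qed.

Lemma orthogonal_group_mx g : orthogonal_group B g -> g *m B *m g^T = B.
Proof.
move=> [_ gB]; apply/eqP; rewrite -subr_eq0; apply/eqP.
apply: bilinear_polarization => [|v].
  by rewrite linearB /= !trmx_mul trmxK Bsym mulmxA.
have := gB v; rewrite /qform trmx_mul !mulmxA => gv.
have entryB (M N : 'M[R]_1) : (M - N) 0 0 = M 0 0 - N 0 0 by rewrite !mxE.
by rewrite mulmxBr mulmxBl entryB !mulmxA gv subrr.
Qed.

Lemma harmonic_summand_invariant d k g p : orthogonal_group B g ->
  harmonic_summand B d k p -> harmonic_summand B d k (psubst g p).
Proof.
move=> og; have gBg := orthogonal_group_mx og.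
move=> /harmonic_summandP [h [hh Dh ->]]; apply/harmonic_summandP.
exists (subst g h); split; first exact: homog_subst.
  rewrite lap_subst (_ : g^T *m invmx B *m g = invmx B) ?Dh ?rmorph0 //.
  have gBgV : g *m (B *m g^T *m invmx B) = 1%:M by rewrite !mulmxA gBg mulmxV.
  have := congr1 (mulmx (invmx B)) (mulmx1C gBgV).
  by rewrite mulmx1 -!mulmxA mulKmx.
by rewrite -[psubst g _]/(subst g _) substM rmorphXn /= subst_quad gBg.
Qed.

(** On [Upsilon_Q] the powers of [Q] become [1], and in the coordinates
    [u = v A] the two summands become harmonic polynomials of different
    degrees for the standard form. Since [u] is real, the conjugate of the
    second factor is the value of the polynomial with conjugate coefficients,
    which is harmonic of the same degree. *)
Lemma harmonic_summand_orthogonal (A : 'M[C]_3) d k l p q :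
  A \in unitmx -> mx_complex B = A *m A^T ->
  (k <= d./2)%N -> (l <= d./2)%N -> k != l ->
  harmonic_summand B d k p -> harmonic_summand B d l q ->
  inner_product A p q = 0.
Proof.
move=> Au BE kd ld kl /harmonic_summandP [h [hh Dh pE]].
move=> /harmonic_summandP [g [hg Dg qE]].
pose conjr : {rmorphism C -> C} := @conjc R.
pose h' := subst (invmx A) (map_mpoly toC h).
pose g' := map_mpoly conjr (subst (invmx A) (map_mpoly toC g)).
have lapA r : lap (invmx B) r = 0 -> lap 1%:M (subst (invmx A) (map_mpoly toC r)) = 0.
  move=> Dr; rewrite lap_subst mulmx1.
  have -> : (invmx A)^T *m invmx A = invmx (map_mx toC B).
    have AV : A *m (A^T *m ((invmx A)^T *m invmx A)) = 1%:M.
      by rewrite (mulmxA A^T) -trmx_mul mulVmx // trmx1 mul1mx mulmxV.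
    rewrite [map_mx toC B]BE -[RHS]mulmx1 -AV mulmxA mulKmx //.
    by rewrite unitmx_mul unitmx_tr Au.
  by rewrite -map_invmx -map_lap Dr !rmorph0.
have Dg' : lap 1%:M g' = 0.
  have := congr1 (map_mpoly conjr) (lapA g Dg).
  by rewrite map_lap map_scalar_mx rmorph1 rmorph0.
have spE theta phi : let u := sphere_point theta phi in
    (u *m u^T) 0 0 = 1 :> R.
  rewrite /= mxE sum3E !mxE !(tnth_nth 0) /=.
  transitivity ((sin theta * sin theta) * (cos phi * cos phi + sin phi * sin phi)
    + cos theta * cos theta : R); first by ring.
  by rewrite -!expr2 cos2Dsin2 mulr1 addrC cos2Dsin2.
have evE (u : 'rV[R]_3) r : (u *m u^T) 0 0 = 1 -> forall j s, r = quad B ^+ j * s ->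
    pevalC r (mx_complex u *m invmx A) =
    ev (mx_complex u) (subst (invmx A) (map_mpoly toC s)).
  move=> u1 j s ->; rewrite ev_subst -[LHS]/(ev _ (map_mpoly toC _)).
  rewrite rmorphM rmorphXn /= map_quad evM evX ev_quad.
  rewrite (_ : qform _ _ = 1) ?expr1n ?mul1r //.
  rewrite /qform [map_mx toC B]BE trmx_mul !mulmxA mulmxKV //.
  have AtK : A^T *m (invmx A)^T = 1%:M by rewrite -trmx_mul mulVmx // trmx1.
  rewrite -(mulmxA _ A^T) AtK mulmx1 /mx_complex map_trmx -map_mxM.
  by rewrite mxE u1.
have intE : upsilon_integral A (fun w => pevalC p w * (pevalC q w)^*) =
    sphere_integral (fun u => ev (mx_complex u) (h' * g')).
  have E theta phi : let u := sphere_point theta phi in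
      pevalC p (mx_complex u *m invmx A) * (pevalC q (mx_complex u *m invmx A))^* =
      ev (mx_complex u) (h' * g').
    rewrite /= (evE _ _ (spE _ _) _ _ pE) (evE _ _ (spE _ _) _ _ qE) evM.
    congr (_ * _); rewrite /g' -[LHS]/(conjr _) -ev_map; congr (ev _ _).
    by apply/matrixP => a b; rewrite !mxE; exact: conjc_real.
  rewrite /upsilon_integral /sphere_integral /sphere_integral_real.
  by congr (_ +i* _); apply: eq_Rintegral => phi _; apply: eq_Rintegral => theta _;
    rewrite E.
rewrite /inner_product intE sphere_integral_ev {intE}.
have Dh' : lap 1%:M h' = 0 by exact: lapA.
have hh' : h' \is ishomog1 (d - k.*2) mdeg by exact/homog_subst/map_homog.
have hg' : g' \is ishomog1 (d - l.*2) mdeg by exact/map_homog/homog_subst/map_homog.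
have ne : (d - k.*2)%N != (d - l.*2)%N by apply: contra_neq kl => E; lia.
by rewrite (sphere_functional_orthogonal ne hh' hg' Dh' Dg').
Qed.

End Main.

(** * Representations on a level surface *)

Lemma parity_split (K : numFieldType) d (p : mpoly 3 K) : (0 < d)%N ->
  {in msupp p, forall m, (mdeg m <= d)%N} ->
  exists q r, [/\ p = q + r,
    {in msupp q, forall m, (mdeg m <= d)%N /\ odd (mdeg m) = odd d} &
    {in msupp r, forall m, (mdeg m <= d.-1)%N /\ odd (mdeg m) = odd d.-1}].
Proof.
move=> d0 pd.
pose part (Q : pred nat) := \sum_(e < d.+1 | Q e) pihomog mdeg e p.
have partP Q m : m \in msupp (part Q) -> (mdeg m <= d)%N /\ Q (mdeg m).
  rewrite mcoeff_msupp raddf_sum /=; apply: contra_neqP => mQ.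
  apply: big1 => e Qe; rewrite mcoeff_pihomog; case: eqP => // me.
  by case: mQ; rewrite me -ltnS.
exists (part (fun e => odd e == odd d)), (part (fun e => odd e != odd d)); split.
- have sp : (msize p <= d.+1)%N.
    by rewrite msizeE; apply/bigmax_leqP_seq => m mp _; rewrite ltnS pd.
  rewrite [LHS](pihomog_partitionE sp).
  by rewrite (bigID (fun e : 'I_d.+1 => odd e == odd d)).
- by move=> m /partP [md /eqP mo].
- by move=> m /partP [md mo]; lia.
Qed.

Section MaxwellSurface.
Variable R : realType.
Local Notation C := R[i].
Local Notation toC := (real_complex R : {rmorphism R -> C}).
Variable B : 'M[R]_3.
Hypotheses (Bsym : B^T = B) (Binv : B \in unitmx).
Variable c : R.
Hypothesis c0 : c != 0.
Implicit Types (P X : mpoly 3 R).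

Let BCsym : (mx_complex B)^T = mx_complex B.
Proof. by rewrite /mx_complex map_trmx Bsym. Qed.
Let BCinv : mx_complex B \in unitmx. Proof. by rewrite map_unitmx. Qed.

Let qform_neq0 v : surface B c v -> qform (mx_complex B) (mx_complex v) != 0.
Proof. by rewrite qform_complex => ->; rewrite fmorph_eq0. Qed.

(** The reverse implication is immediate; the direct one requires a branch of
    the square root at every point of the surface, which exists as [c != 0]. *)
Lemma represents_ev P E (X : mpoly 3 C) :
  (forall v s, surface B c v -> sqrt_branch (mx_complex B) (mx_complex v) s ->
     E s (mx_complex v) = ev (mx_complex v) X) ->
  represents_on_surface B c P E <->
  forall v, surface B c v -> (ev v P)%:C = ev (mx_complex v) X.
Proof.
move=> EX; split=> [rep v Sv|PX v Sv s sb]; last by rewrite (EX _ _ Sv sb) -PX.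
have [s sb] := sqrt_branch_exists (qform_neq0 Sv).
by rewrite -(EX _ _ Sv sb); exact: rep.
Qed.

Lemma maxwell_sum_surface d (a : C) (u : poles C d) v s : surface B c v ->
  sqrt_branch (mx_complex B) (mx_complex v) s ->
  maxwell_sum B a u s (mx_complex v) =
  ev (mx_complex v) (maxwell_poly (mx_complex B) c%:C a u).
Proof.
move=> Sv sb; have QE : qform (mx_complex B) (mx_complex v) = c%:C.
  by rewrite qform_complex Sv.
by rewrite -QE; exact: maxwell_sum_ev (qform_neq0 Sv) sb.
Qed.

Lemma map_maxwell_poly d (a : R) (u : poles R d) :
  map_mpoly toC (maxwell_poly B c a u) =
  maxwell_poly (mx_complex B) c%:C a%:C (poles_complex u).
Proof.
rewrite /maxwell_poly raddf_sum; apply: eq_bigr => k _ /=.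
rewrite !map_mpolyZ map_multipole rmorphXn /=; congr (_ *: _).
by case: ifP => // _; rewrite rmorph1.
Qed.

Lemma represents_maxwell_poly d P (a : R) (u : poles R d) :
  represents_on_surface B c P (maxwell_sum B a%:C (poles_complex u)) <->
  forall v, surface B c v -> ev v P = ev v (maxwell_poly B c a u).
Proof.
rewrite (represents_ev P (X := map_mpoly toC (maxwell_poly B c a u))).
  by split=> PX v Sv; have := PX v Sv; rewrite ev_map;
    [exact: (fmorph_inj toC)|move->].
by move=> v s Sv sb; rewrite map_maxwell_poly; exact: maxwell_sum_surface.
Qed.

Lemma represents_maxwell_poly2 d e P (a b : R) (u : poles R d) (w : poles R e) :
  represents_on_surface B c P (fun s v =>
    maxwell_sum B a%:C (poles_complex u) s v +
    maxwell_sum B b%:C (poles_complex w) s v) <->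
  forall v, surface B c v ->
    ev v P = ev v (maxwell_poly B c a u + maxwell_poly B c b w).
Proof.
rewrite (represents_ev P
  (X := map_mpoly toC (maxwell_poly B c a u + maxwell_poly B c b w))).
  by split=> PX v Sv; have := PX v Sv; rewrite ev_map;
    [exact: (fmorph_inj toC)|move->].
move=> v s Sv sb; rewrite rmorphD /= !map_maxwell_poly evD.
by rewrite !(maxwell_sum_surface _ _ Sv sb).
Qed.

Lemma complex_maxwell_exists d P :
  {in msupp P, forall m, (mdeg m <= d)%N /\ odd (mdeg m) = odd d} ->
  exists (a : C) (u : poles C d), forall v, surface B c v ->
    (ev v P)%:C = ev (mx_complex v) (maxwell_poly (mx_complex B) c%:C a u).
Proof.
move=> Pd; have [h [hP hE]] := surface_decomp Bsym Binv c0
  (fun m mP => (Pd m mP).1) (fun m mP => (Pd m mP).2).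
have ex (k : 'I_(d./2).+1) := let: conj hk Dk := hP k (ltn_ord k) in
  complex_poles_exist Bsym Binv hk Dk.
pose u : poles C d := fun k => projT1 (cid (ex k)).
exists (mcoeff mnm0 (map_mpoly toC (h d./2))), u => v Sv.
rewrite (@maxwell_poly_sum _ _ _ _ _ (fun k => map_mpoly toC (h k))).
- rewrite hE // rmorph_sum ev_sum; apply: eq_bigr => k _ /=.
  by rewrite rmorphM rmorphXn evZ ev_map.
- by move=> k kd; apply: map_homog; have [] := hP k kd.
- by move=> k; exact: projT2 (cid (ex k)).
Qed.

Lemma real_maxwell_exists d P : positive_definite B ->
  {in msupp P, forall m, (mdeg m <= d)%N /\ odd (mdeg m) = odd d} ->
  exists (a : R) (u : poles R d), forall v, surface B c v ->
    ev v P = ev v (maxwell_poly B c a u).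
Proof.
move=> Bpos Pd; have [h [hP hE]] := surface_decomp Bsym Binv c0
  (fun m mP => (Pd m mP).1) (fun m mP => (Pd m mP).2).
have ex (k : 'I_(d./2).+1) := let: conj hk Dk := hP k (ltn_ord k) in
  real_poles_exist Bsym Binv Bpos hk Dk.
pose u : poles R d := fun k => projT1 (cid (ex k)).
exists (mcoeff mnm0 (h d./2)), u => v Sv.
rewrite (@maxwell_poly_sum _ _ _ _ _ h).
- by rewrite hE // ev_sum; apply: eq_bigr => k _; rewrite evZ.
- by move=> k kd; have [] := hP k kd.
- by move=> k; exact: projT2 (cid (ex k)).
Qed.

Lemma lap_eq_on_surface X Y : genuine_surface B c ->
  lap (invmx B) X = lap (invmx B) Y ->
  (forall v, surface B c v -> ev v X = ev v Y) -> X = Y.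
Proof.
move=> gB DXY XY; apply/eqP; rewrite -subr_eq0; apply/eqP.
apply: (harmonic_vanish_on_surface Bsym Binv gB) => [|v Sv].
  by rewrite lapB DXY subrr.
by rewrite evB XY // subrr.
Qed.

(** The components of a Maxwell polynomial are its terms, so that equality of
    components is equality of multipoles, up to the powers of [c]. *)
Lemma maxwell_components_inj d (a a' : R) (u u' : poles R d) :
  positive_definite B ->
  (forall k : 'I_(d./2).+1, pihomog mdeg (d - k.*2) (maxwell_poly B c a u) =
                            pihomog mdeg (d - k.*2) (maxwell_poly B c a' u')) ->
  equivalent_poles a u a' u'.
Proof.
move=> Bpos E; split=> [ed|k].
  have := E ord_max; rewrite !maxwell_component.
  have de : (ord_max : 'I_(d./2).+1).*2 = d by rewrite /=; lia.
  have us (w : poles R d) : w ord_max = [::] :> seq _.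
    by apply: size0nil; rewrite size_tuple de subnn.
  rewrite !us /= -/(nat_of_ord _) de eqxx => /(congr1 (mcoeff mnm0)).
  rewrite !mcoeffZ mcoeff1 eqxx !mulr1.
  by apply: mulIf; rewrite expf_neq0.
apply: (equivalent_vectors_multipole Bsym Binv Bpos).
have := E k; rewrite !maxwell_component; case: eqP => [kd|_].
  have us (w : poles R d) : w k = [::] :> seq _.
    by apply: size0nil; rewrite size_tuple kd subnn.
  by rewrite !us.
rewrite !scale1r => /(congr1 (fun p => (c ^+ k)^-1 *: p)).
by rewrite !scalerA mulVf ?expf_neq0 // !scale1r.
Qed.

End MaxwellSurface.

Unset Implicit Arguments.
Set Strict Implicit.
Set Printing Implicit Defensive.

Theorem theorem17 (R : realType) (B : 'M[R]_3) (hsym : B^T = B)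
    (hinv : B \in unitmx) :
  (* (1) *)
  (forall d : nat,
    [/\ is_direct_sum (homogeneous d)
          (fun k : 'I_(d./2).+1 => harmonic_summand B d k),
        forall g, orthogonal_group B g ->
          forall (k : 'I_(d./2).+1) (p : mpoly 3 R),
            harmonic_summand B d k p -> harmonic_summand B d k (psubst g p)
      & forall A : 'M[R[i]]_3, A \in unitmx -> mx_complex B = A *m A^T ->
          forall (k l : 'I_(d./2).+1) (p q : mpoly 3 R), k != l ->
            harmonic_summand B d k p -> harmonic_summand B d l q ->
            inner_product A p q = 0]) /\
  (* (2) *)
  (forall (c : R) (F : mpoly 3 R),
    exists2 P, harmonic_poly B P & {in surface B c, peval P =1 peval F}) /\
  (* (3) *)
  (forall (c : R) (M N : mpoly 3 R),
    exists P, dirichlet_solution B c M N P /\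
      (genuine_surface B c ->
        forall P', dirichlet_solution B c M N P' -> P' = P)) /\
  (* (4), polynomials whose monomials all have the parity of d *)
  (forall (c : R) (d : nat) (P : mpoly 3 R), c != 0 ->
    degree_le P d -> degrees_congruent_mod2 P d ->
    (exists (a : R[i]) (u : poles R[i] d),
      represents_on_surface B c P (maxwell_sum B a u)) /\
    (positive_definite B ->
      exists (a : R) (u : poles R d),
        represents_on_surface B c P (maxwell_sum B a%:C (poles_complex u)) /\
        (genuine_surface B c -> forall (a' : R) (u' : poles R d),
          represents_on_surface B c P
            (maxwell_sum B a'%:C (poles_complex u')) ->
          equivalent_poles a u a' u'))) /\
  (* (4), arbitrary polynomials: the sums of orders d and d - 1 together *)
  (forall (c : R) (d : nat) (P : mpoly 3 R), c != 0 -> (0 < d)%N ->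
    degree_le P d ->
    (exists (a b : R[i]) (u : poles R[i] d) (w : poles R[i] d.-1),
      represents_on_surface B c P
        (fun s v => maxwell_sum B a u s v + maxwell_sum B b w s v)) /\
    (positive_definite B ->
      exists (a b : R) (u : poles R d) (w : poles R d.-1),
        represents_on_surface B c P
          (fun s v => maxwell_sum B a%:C (poles_complex u) s v +
                      maxwell_sum B b%:C (poles_complex w) s v) /\
        (genuine_surface B c ->
          forall (a' b' : R) (u' : poles R d) (w' : poles R d.-1),
          represents_on_surface B c P
            (fun s v => maxwell_sum B a'%:C (poles_complex u') s v +
                        maxwell_sum B b'%:C (poles_complex w') s v) ->
          equivalent_poles a u a' u' /\ equivalent_poles b w b' w'))).
Proof.
split; [|split; [|split; [|split]]].
- move=> d; split.
  + exact: harmonic_direct_sum.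
  + by move=> g og k p; exact: harmonic_summand_invariant.
  + move=> A Au BE k l p q kl; apply: harmonic_summand_orthogonal => //.
    * by rewrite -ltnS.
    * by rewrite -ltnS.
- move=> c F; have [h Dh hE] := harmonic_on_surface hsym hinv c F.
  by exists h => // v /set_mem Sv; exact: hE.
- move=> c M N; have [p pE] := lap_surj hsym hinv M.
  have [h Dh hE] := harmonic_on_surface hsym hinv c (N - p).
  exists (p + h); split.
    split; first by rewrite -pE -[LHS]/(lap _ _) lapD Dh addr0.
    move=> v /set_mem Sv; rewrite -[LHS]/(ev v _) -[RHS]/(ev v _).
    by rewrite evD (hE _ Sv) evB addrC subrK.
  move=> gB P' [DP' P'N]; apply: (lap_eq_on_surface hsym hinv gB).
    by rewrite lapD Dh addr0 pE.
  move=> v Sv; rewrite evD (hE _ Sv) evB addrC subrK.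
  by apply: P'N; exact: mem_set.
- move=> c d P c0 Pd Pp.
  have P2 : {in msupp P, forall m, (mdeg m <= d)%N /\ odd (mdeg m) = odd d}.
    by move=> m mP; split; [exact: Pd|exact: Pp].
  split=> [|Bpos].
    have [a [u uE]] := complex_maxwell_exists hsym hinv c0 P2.
    exists a, u; apply/(represents_ev c0 _ _).2/uE => v s.
    exact: maxwell_sum_surface.
  have [a [u uE]] := real_maxwell_exists hsym hinv c0 Bpos P2.
  exists a, u; split; first exact/represents_maxwell_poly.
  move=> gB a' u' /(represents_maxwell_poly hsym hinv c0) u'E.
  apply: (maxwell_components_inj hsym hinv c0 Bpos) => k.
  congr (pihomog _ _ _); apply: (lap_eq_on_surface hsym hinv gB).
    by rewrite !lap_maxwell_poly.
  by move=> v Sv; rewrite -uE // u'E.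
- move=> c d P c0 d0 Pd.
  have [q [r [PE qd rd]]] := parity_split d0 Pd.
  split=> [|Bpos].
    have [a [u uE]] := complex_maxwell_exists hsym hinv c0 qd.
    have [b [w wE]] := complex_maxwell_exists hsym hinv c0 rd.
    exists a, b, u, w; apply: (represents_ev c0 _ (X :=
      maxwell_poly (mx_complex B) c%:C a u + maxwell_poly (mx_complex B) c%:C b w) _).2.
      move=> v s Sv sb; rewrite evD.
      by rewrite !(maxwell_sum_surface hsym hinv c0 _ _ Sv sb).
    by move=> v Sv; rewrite PE !evD rmorphD /= uE // wE.
  have [a [u uE]] := real_maxwell_exists hsym hinv c0 Bpos qd.
  have [b [w wE]] := real_maxwell_exists hsym hinv c0 Bpos rd.
  have rep v : surface B c v ->
      ev v P = ev v (maxwell_poly B c a u + maxwell_poly B c b w).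
    by move=> Sv; rewrite PE !evD uE // wE.
  exists a, b, u, w; split; first exact/represents_maxwell_poly2.
  move=> gB a' b' u' w' /(represents_maxwell_poly2 hsym hinv c0) rep'.
  have E : maxwell_poly B c a u + maxwell_poly B c b w =
           maxwell_poly B c a' u' + maxwell_poly B c b' w'.
    apply: (lap_eq_on_surface hsym hinv gB) => [|v Sv].
      by rewrite !lapD !lap_maxwell_poly.
    by rewrite -rep // rep'.
  split; apply: (maxwell_components_inj hsym hinv c0 Bpos) => k.
    have := congr1 (pihomog mdeg (d - k.*2)) E; rewrite !raddfD /=.
    have kd : odd (d - k.*2) != odd d.-1 by have := ltn_ord k; lia.
    by rewrite !(maxwell_component_parity _ _ _ _ kd) !addr0.
  have := congr1 (pihomog mdeg (d.-1 - k.*2)) E; rewrite !raddfD /=.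
  have kd : odd (d.-1 - k.*2) != odd d by have := ltn_ord k; lia.
  by rewrite !(maxwell_component_parity _ _ _ _ kd) !add0r.
Qed.
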